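(* Let $(H,\langle\cdot,\cdot\rangle_H,\|\cdot\|_H)$ and $(U,\langle\cdot,\cdot\rangle_U,\|\cdot\|_U)$ be separable $\mathbb{R}$-Hilbert spaces, let $\mathbb{H}\subseteq H$ be a non-empty orthonormal basis of $H$, let $\mathfrak{v}\colon\mathbb{H}\to\mathbb{R}$ satisfy $\sup_{h\in\mathbb{H}}\mathfrak{v}_h<0$, let $A\colon D(A)\subseteq H\to H$ be the linear operator with $D(A)=\{v\in H\colon\sum_{h\in\mathbb{H}}|\mathfrak{v}_h\langle h,v\rangle_H|^2<\infty\}$ and $Av=\sum_{h\in\mathbb{H}}\mathfrak{v}_h\langle h,v\rangle_Hh$ for all $v\in D(A)$, and let $(H_r,\langle\cdot,\cdot\rangle_{H_r},\|\cdot\|_{H_r})$, $r\in\mathbb{R}$, be the family of interpolation spaces associated to $-A$. Let $\beta\in[0,\infty)$, $T\in(0,\infty)$, let $(\Omega,\mathcal{F},\mathbb{P},(\mathbb{F}_t)_{t\in[0,T]})$ be a filtered probability space which fulfills the usual conditions, let $(W_t)_{t\in[0,T]}$ be an $\mathrm{Id}_U$-cylindrical $(\mathbb{F}_t)_{t\in[0,T]}$-Wiener process, let $B\in\mathrm{HS}(U,H_\beta)$, and let $\mathbb{U}\subseteq U$ be an orthonormal basis of $U$. For $I\in\mathcal{P}(\mathbb{H})$, $J\in\mathcal{P}(\mathbb{U})$ let $P_I\colon H\to H$ and $\hat P_J\colon U\to U$ be the linear operators with $P_I(x)=\sum_{h\in I}\langle h,x\rangle_Hh$ and $\hat P_J(y)=\sum_{u\in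 J}\langle u,y\rangle_Uu$. For every $\theta\in\varpi_T$, $I\in\mathcal{P}_0(\mathbb{H})$, $J\in\mathcal{P}(\mathbb{U})$ let $\chi^{\theta,I,J}\colon[0,T]\times\Omega\to[0,1]$ be an $(\mathbb{F}_t)_{t\in[0,T]}$-adapted stochastic process and let $\mathbf{O}^{\theta,I,J}\colon[0,T]\times\Omega\to P_I(H)$ be a stochastic process which satisfies $\mathbf{O}^{\theta,I,J}_0=0$ and for every $t\in[0,T]$, $\mathbb{P}$-almost surely, $$\mathbf{O}^{\theta,I,J}_t=e^{(t-\llcorner t\lrcorner_\theta)A}\mathbf{O}^{\theta,I,J}_{\llcorner t\lrcorner_\theta}+\frac{\int_{\llcorner t\lrcorner_\theta}^t\chi^{\theta,I,J}_{\llcorner t\lrcorner_\theta}e^{(t-\llcorner t\lrcorner_\theta)A}P_IB\hat P_J\,dW_s}{1+\big\|\int_{\llcorner t\lrcorner_\theta}^tP_IB\hat P_J\,dW_s\big\|_H^2}.$$ Let $p\in[1,\infty)$, $\gamma\in[0,\frac12+\beta)$. Then $$\sup_{\theta\in\varpi_T}\sup_{J\in\mathcal{P}(\mathbb{U})}\sup_{I\in\mathcal{P}_0(\mathbb{H})}\sup_{t\in[0,T]}\|\mathbf{O}^{\theta,I,J}_t\|_{L^p(\mathbb{P};H_\gamma)}<\infty.$$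
   Context: $\mathcal{P}(X)$ is the power set of $X$ and $\mathcal{P}_0(X)$ the set of all finite subsets of $X$. $\varpi_T=\{\theta\in\mathcal{P}_0([0,T])\colon\{0,T\}\subseteq\theta\}$. For $\theta\in\varpi_T$: $\llcorner t\lrcorner_\theta=\max([0,t)\cap\theta)$ for $t>0$ and $\llcorner0\lrcorner_\theta=0$. Interpolation spaces: for $r\ge0$, $H_r=D((-A)^r)$ with $\|v\|_{H_r}=\|(-A)^rv\|_H$; for $r<0$, $H_r$ is the completion of $H$ with respect to $\|v\|_{H_r}=\|(-A)^rv\|_H$. $\mathrm{HS}$ denotes Hilbert-Schmidt operators. $\|X\|_{L^p(\mathbb{P};V)}=(\mathbb{E}[\|X\|_V^p])^{1/p}$. *)

(* Defs.v *)
From mathcomp Require Export all_boot all_order all_algebra sesquilinear.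
From mathcomp Require Export all_classical all_reals all_analysis.
From mathcomp Require summability.

Set Implicit Arguments.
Unset Strict Implicit.
Unset Printing Implicit Defensive.
Export Order.TTheory GRing.Theory Num.Theory.
Export numFieldNormedType.Exports.

Local Open Scope classical_set_scope.
Local Open Scope ring_scope.

Definition separable (T : topologicalType) : Prop :=
  exists2 D : set T, countable D & dense D.

(* A real Hilbert space is a complete normed module H together with a positive
   definite form dot : {dot H for idfun} which induces the norm of H. *)
Definition induces_norm (R : realType) (H : normedModType R)
    (dot : {dot H for idfun}) : Prop :=
  forall x : H, dot x x = `|x| ^+ 2.

Section diagonal_operators.
Context {R : realType} {H : completeNormedModType R}.
Implicit Types (dot : {dot H for idfun}) (B S : set H) (v x : H).

Definition linear_span B : set H :=
  [set x | exists (s : seq H) (c : H -> R),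
     [set` s] `<=` B /\ x = \sum_(h <- s) c h *: h].

Definition orthonormal_set dot B : Prop :=
  forall h k, B h -> B k -> dot h k = (h == k)%:R.

Definition orthonormal_basis dot B : Prop :=
  orthonormal_set dot B /\ dense (linear_span B).

(* \sum_(h in B) g h <h, v> h, as the limit of the net of finite partial sums;
   summability.sum ranges over all of H, hence the indicator. *)
Definition diag_op dot B (g : H -> R) v : H :=
  summability.sum (fun h : H => (\1_B h * g h * dot h v) *: h).

Definition diag_dom dot B (g : H -> R) : set H :=
  [set v | (\esum_(h in B) (`|g h * dot h v| ^+ 2)%:E < +oo)%E].

(* The operators P_I and \hat P_J. *)
Definition proj dot S : H -> H := diag_op dot S (cst 1).

(* Functional calculus phi(A) of the diagonal operator A with A h = ev h *: h
   for h in B; the operator A itself, with its domain D(A), is the case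
   phi = id. *)
Definition fcalc dot B (ev : H -> R) (phi : R -> R) : H -> H :=
  diag_op dot B (phi \o ev).

Definition fcalc_dom dot B (ev : H -> R) (phi : R -> R) : set H :=
  diag_dom dot B (phi \o ev).

(* e^{tA} *)
Definition semigroup dot B (ev : H -> R) (t : R) : H -> H :=
  fcalc dot B ev (fun l => expR (t * l)).

(* H_r = D((-A)^r) with norm |v|_{H_r} = |(-A)^r v|_H, for r >= 0. *)
Definition interp_space dot B (ev : H -> R) (r : R) : set H :=
  fcalc_dom dot B ev (fun l => (- l) `^ r).

Definition interp_norm dot B (ev : H -> R) (r : R) v : R :=
  `|fcalc dot B ev (fun l => (- l) `^ r) v|.

End diagonal_operators.

Section hilbert_schmidt.
Context {R : realType} {U H : completeNormedModType R}.

(* The target is the subspace V of H with the (possibly stronger) norm nrm;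
   basU is an orthonormal basis of U, on whose choice neither notion depends. *)
Definition hs_norm2 (basU : set U) (nrm : H -> R) (L : U -> H) : \bar R :=
  \esum_(u in basU) (nrm (L u) ^+ 2)%:E.

Definition hilbert_schmidt (basU : set U) (V : set H) (nrm : H -> R)
    (L : U -> H) : Prop :=
  [/\ linear L, (forall u, V (L u)),
      (exists M : R, forall u, nrm (L u) <= M * `|u|) &
      (hs_norm2 basU nrm L < +oo)%E].

End hilbert_schmidt.

(* Measurability of f w.r.t. the sigma-algebra G on W and the Borel
   sigma-algebra of T. *)
Definition borel_measurable (W : Type) (T : topologicalType)
    (G : set (set W)) (f : W -> T) : Prop :=
  forall C : set T, <<s open >> C -> G (f @^-1` C).

Section stochastics.
Context {d : measure_display} {Omega : measurableType d} {R : realType}.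
Variables (P : probability Omega R) (T : R) (F : R -> set (set Omega)).

(* Only the values F t for t in [0, T] matter. *)
Definition filtration : Prop :=
  [/\ forall t : R, t \in `[0, T] -> sigma_algebra setT (F t),
      forall t : R, t \in `[0, T] -> F t `<=` measurable &
      forall s t, 0 <= s -> s <= t -> t <= T -> F s `<=` F t].

Definition usual_conditions : Prop :=
  (forall N, measurable N -> P N = 0%E -> F 0 N) /\
  (forall t, 0 <= t < T -> F t = \bigcap_(s in `]t, T]) F s).

Definition adapted (X : R -> Omega -> R) : Prop :=
  forall t : R, t \in `[0, T] -> forall C : set R, measurable C -> F t (X t @^-1` C).

Context {U : completeNormedModType R}.
Variable dotU : {dot U for idfun}.

(* Id_U-cylindrical F-Wiener process: W t u stands for "<W_t, u>".  The last
   field says that, given F s, the increments along orthonormal vectors are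
   independent centred Gaussians of variance t - s. *)
Record cylindrical_wiener (W : R -> U -> Omega -> R) : Prop := {
  cw_adapted : forall u, adapted (fun t => W t u) ;
  cw_linear : forall t : R, t \in `[0, T] -> forall (c : R) (u v : U),
    {ae P, forall w, W t (c *: u + v) w = c * W t u w + W t v w} ;
  cw_zero : forall u, {ae P, forall w, W 0 u w = 0} ;
  cw_continuous : forall u,
    {ae P, forall w, {within `[0, T], continuous (fun t => W t u w)}} ;
  cw_increments : forall s t, 0 <= s -> s < t -> t <= T ->
    forall (n : nat) (e : 'I_n -> U),
    (forall i j, dotU (e i) (e j) = (i == j)%:R) ->
    forall (A : set Omega) (C : 'I_n -> set R),
    F s A -> (forall i, measurable (C i)) ->
    P (A `&` \bigcap_(i in [set: 'I_n])
               (fun w => W t (e i) w - W s (e i) w) @^-1` C i) =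
    (P A * \prod_(i < n) normal_prob 0 (Num.sqrt (t - s)) (C i))%E }.

Context {H : completeNormedModType R}.
Variable dotH : {dot H for idfun}.

(* Elementary integrands are finite sums of terms
   1_{]l, r]}(s) 1_A <u, .> x with A in F l. *)
Record elem_term := ElemTerm {
  et_left : R ; et_right : R ; et_event : set Omega ; et_in : U ; et_out : H }.

Definition elem_admissible (a b : R) (z : elem_term) : Prop :=
  [/\ a <= et_left z, et_left z <= et_right z, et_right z <= b &
      F (et_left z) (et_event z)].

Definition elem_integrand (zs : seq elem_term) (s : R) (w : Omega) (y : U) : H :=
  \sum_(z <- zs) (\1_`]et_left z, et_right z] s * \1_(et_event z) w *
                  dotU (et_in z) y) *: et_out z.

Definition elem_integral (W : R -> U -> Omega -> R) (zs : seq elem_term)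
    (w : Omega) : H :=
  \sum_(z <- zs) (\1_(et_event z) w *
    (W (et_right z) (et_in z) w - W (et_left z) (et_in z) w)) *: et_out z.

Variables (basU : set U) (W : R -> U -> Omega -> R).

(* X is a version of the Ito integral int_a^b Y_s dW_s of an HS(U,H)-valued
   square-integrable Y: the L^2(P;H)-limit of the integrals of elementary
   integrands which converge to Y in L^2(ds x P; HS(U,H)). *)
Definition is_ito_integral (a b : R) (Y : R -> Omega -> U -> H)
    (X : Omega -> H) : Prop :=
  [/\ forall (s : R) w, s \in `[a, b] -> hilbert_schmidt basU setT (@Num.norm R H) (Y s w),
      forall (u : U) (h : H), measurable_fun (`[a, b] `*` [set: Omega])
        (fun z : R * Omega => dotH h (Y z.1 z.2 u)),
      borel_measurable measurable X &
      exists zs : nat -> seq elem_term,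
      [/\ forall n, all (fun z => `[< elem_admissible a b z >]) (zs n),
          (fun n => \int[P]_w \int[lebesgue_measure]_(s in `[a, b])
             hs_norm2 basU (@Num.norm R H)
               (fun y => elem_integrand (zs n) s w y - Y s w y)%R)%E
            @ \oo --> 0%E &
          (fun n => \int[P]_w (`|elem_integral W (zs n) w - X w| ^+ 2)%:E)%E
            @ \oo --> 0%E]].

(* A version of the Ito integral, which is unique up to P-null sets (and 0 by
   convention if Y is not integrable in the above sense). *)
Definition ito_integral (a b : R) (Y : R -> Omega -> U -> H) : Omega -> H :=
  xget (cst 0) [set X | is_ito_integral a b Y X].

End stochastics.

Section grids.
Context {R : realType}.

Definition varpi (T : R) : set (set R) :=
  [set theta | [/\ finite_set theta, theta `<=` `[0, T], theta 0 & theta T]].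

(* The supremum is a maximum: for theta in varpi T and 0 < t the set is finite
   and contains 0. *)
Definition grid_floor (theta : set R) (t : R) : R :=
  if 0 < t then sup (`[0, t[ `&` theta) else 0.

End grids.

(* P_0(X) for X a subset of the type S *)
Definition finite_subsets (S : choiceType) (X : set S) : set (set S) :=
  [set I | finite_set I /\ I `<=` X].

(* Main.v *)
(* In coordinates with respect to basH the scheme reads
   O_s = e^((s - s0) A) (O_s0 + chi k(|xi|^2) xi), where s0 is the preceding grid
   point, k takes values in [0, 1] and xi is a centred Gaussian vector that is
   independent of F_s0. Fix t and put Z_s = (-A)^gamma e^((t - s) A) O_s. The
   noise in Z_s - Z_s0 is an odd function of xi, so by symmetry the mixed term of
   first order drops out of E|Z_s|^(2m), and
   E|Z_s|^(2m) <= E|Z_s0|^(2m) + C (v E|Z_s0|^(2m-2) + v^m),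
   where v = (s - s0) |(-A)^gamma e^((t - s0) A) B|_HS^2
     <= C (s - s0) (t - s0)^(-2a) for some a < 1/2.
   As (t - s)^(-2a) is integrable, a discrete Gronwall argument along the grid
   bounds E|Z_t|^(2m) independently of the grid. That the stochastic integrals
   are these Gaussian vectors only needs their uniqueness, which is the Ito
   isometry for elementary integrands. *)

(* The factor k(|xi|^2) makes O neither Gaussian nor a stochastic integral, so moment inequalities
   for martingales do not apply directly. What survives is that k is bounded by 1 and that its
   argument is even in xi. The symmetry is essential: a mixed term of first order would cost a
   multiple of sqrt(v) per step, and such costs add up without bound when the grid is refined,
   whereas the v themselves add up to an integral. Even exponents keep everything polynomial, so the
   one-step estimate becomes an elementary inequality for (a + b + y)^m + (a + b - y)^m. Propagating
   every state to the fixed time t turns the recursion into Z_s = Z_s0 + noise, with the whole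
   smoothing effect of the semigroup in the size of the noise. The noise enters all constants
   through the trace v and never through the number of coordinates; this is what makes them uniform
   in I and J. Finally E|Z|^(2m-2) <= 1 + E|Z|^(2m), so the recursion closes on the single quantity
   1 + E|Z|^(2m). *)
Require Import Defs.
From mathcomp Require Import measurable_realfun finmap ring lra.
Set Implicit Arguments.
Unset Strict Implicit.
Unset Printing Implicit Defensive.
Local Open Scope classical_set_scope.
#[local] Existing Instance summability.totally_filter.
Local Open Scope ring_scope.

(** * Hilbert spaces *)

Section real_dot.
Context (R : realType) (H : completeNormedModType R) (dot : {dot H for idfun}).
Hypothesis hilb : induces_norm dot.
Implicit Types x y z : H.

Lemma dotC x y : dot x y = dot y x.
Proof. by rewrite hermC expr0 mul1r. Qed.

Lemma dotDl x y z : dot (x + y) z = dot x z + dot y z.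
Proof. exact: linearDl. Qed.

Lemma dotZl (a : R) x z : dot (a *: x) z = a * dot x z.
Proof. exact: linearZl_LR. Qed.

Lemma dotDr x y z : dot z (x + y) = dot z x + dot z y.
Proof. exact: linearDr. Qed.

Lemma dotZr (a : R) x z : dot z (a *: x) = a * dot z x.
Proof. by rewrite dotC dotZl dotC. Qed.

Lemma dotNl x z : dot (- x) z = - dot x z.
Proof. exact: linearNl. Qed.

Lemma dotNr x z : dot z (- x) = - dot z x.
Proof. exact: linearNr. Qed.

Lemma dot0l z : dot 0 z = 0.
Proof. exact: linear0l. Qed.

Lemma dot_suml I (s : seq I) (Q : pred I) (f : I -> H) z :
  dot (\sum_(i <- s | Q i) f i) z = \sum_(i <- s | Q i) dot (f i) z.
Proof. exact: linear_sumlz. Qed.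

Lemma dot_sumr I (s : seq I) (Q : pred I) (f : I -> H) z :
  dot z (\sum_(i <- s | Q i) f i) = \sum_(i <- s | Q i) dot z (f i).
Proof. exact: linear_sumr. Qed.

Lemma normB_sqr x y : `|x - y| ^+ 2 = `|x| ^+ 2 - 2 * dot x y + `|y| ^+ 2.
Proof.
rewrite -!hilb dotDl !dotDr !dotNr !dotNl (dotC y x); ring.
Qed.

Lemma CauchySchwarz_dot x y : `|dot x y| <= `|x| * `|y|.
Proof.
have [->|y0] := eqVneq y 0; first by rewrite dotC dot0l !normr0 mulr0.
have yn : 0 < `|y| ^+ 2 by rewrite exprn_gt0 // normr_gt0.
rewrite -(ler_pXn2r (n := 2)) ?nnegrE ?mulr_ge0 //.
rewrite real_normK ?num_real // exprMn.
(* This square expands to |y|^2 times the defect of the squared inequality. *)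
have := sqr_ge0 `|(`|y| ^+ 2) *: x - dot x y *: y|.
rewrite normB_sqr !normrZ !exprMn dotZl dotZr normr_id.
rewrite (real_normK (num_real (dot x y))).
have -> : `|y| ^+ 2 * `|y| ^+ 2 * `|x| ^+ 2 - 2 * (`|y| ^+ 2 * (dot x y * dot x y)) +
  dot x y ^+ 2 * `|y| ^+ 2 = `|y| ^+ 2 * (`|x| ^+ 2 * `|y| ^+ 2 - dot x y ^+ 2).
  by ring.
by rewrite pmulr_rge0 // subr_ge0.
Qed.

Lemma dot_continuous x : continuous (dot x).
Proof.
move=> y; apply/cvgrPdist_le => e e0.
have x0 : 0 < `|x| + 1 by rewrite ltr_pwDr.
near=> z; rewrite -dotNr -dotDr.
apply: le_trans (CauchySchwarz_dot _ _) _.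
apply: (@le_trans _ _ ((`|x| + 1) * `|y - z|)).
  by rewrite ler_wpM2r // lerDl.
rewrite mulrC -ler_pdivlMr //; near: z.
by apply: cvgr_dist_le; [exact: cvg_id|rewrite divr_gt0].
Unshelve. all: by end_near. Qed.

(** By Pythagoras, a vector x orthogonal to the span of B has distance at least |x| from every point
    of the span, so for x different from 0 the open ball of radius |x| around x would miss a dense
    set. *)
Lemma dense_dot_inj (B : set H) x :
  dense (linear_span B) -> (forall h, B h -> dot h x = 0) -> x = 0.
Proof.
move=> dB Bx; apply: contrapT => /eqP x0.
have xg : 0 < `|x| by rewrite normr_gt0.
have [] := dB (ball x `|x|).
- by exists x; exact: ballxx.
- exact: ball_open.
move=> y [xy [s [c [sB yE]]]].
have yx : dot x y = 0.
  rewrite dotC yE dot_suml big_seq big1 // => h hs.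
  by rewrite dotZl Bx ?mulr0 //; exact: sB.
move: xy; rewrite -ball_normE /= => xy.
have := normB_sqr x y; rewrite yx mulr0 subr0 => E.
suff: `|x| <= `|x - y| by rewrite leNgt xy.
by rewrite -(ler_pXn2r (n := 2)) ?nnegrE // E lerDl sqr_ge0.
Qed.

End real_dot.

(** * Orthonormal expansions and diagonal operators *)

Section orthonormal_sums.
Context (R : realType) (H : completeNormedModType R) (dot : {dot H for idfun}).
Hypothesis hilb : induces_norm dot.
Context (B : set H).
Hypothesis onB : orthonormal_set dot B.
Implicit Types (A : {fset H}) (c : H -> R).

Lemma orthonormal_dot_sum A c h : [set` A] `<=` B -> B h ->
  dot h (\sum_(k <- A) c k *: k) = \sum_(k <- A) (k == h)%:R * c k.
Proof.
move=> AB Bh; rewrite dot_sumr big_seq [RHS]big_seq; apply: eq_bigr => k kA.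
by rewrite dotZr onB //; [rewrite eq_sym mulrC|exact: AB].
Qed.

Lemma sum_fset_delta A (c : H -> R) h : h \in A ->
  \sum_(k <- A) (k == h)%:R * c k = c h.
Proof.
move=> hA; rewrite (big_fsetD1 h) //= eqxx mul1r big_seq big1 ?addr0 // => k.
by rewrite !inE => /andP[/negbTE -> _]; rewrite mul0r.
Qed.

Lemma norm_sum_sqr A c : [set` A] `<=` B ->
  `|\sum_(h <- A) c h *: h| ^+ 2 = \sum_(h <- A) c h ^+ 2.
Proof.
move=> AB; rewrite -hilb dot_suml big_seq [RHS]big_seq; apply: eq_bigr => h hA.
rewrite dotZl orthonormal_dot_sum //; last exact: AB.
by rewrite sum_fset_delta // expr2.
Qed.

Lemma norm_sub_fourier_sqr A v : [set` A] `<=` B ->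
  `|v - \sum_(h <- A) dot h v *: h| ^+ 2 =
  `|v| ^+ 2 - \sum_(h <- A) dot h v ^+ 2.
Proof.
move=> AB; rewrite (normB_sqr hilb) norm_sum_sqr // dot_sumr.
under eq_bigr do rewrite dotZr (dotC dot v) -expr2.
by ring.
Qed.

Lemma bessel A v : [set` A] `<=` B ->
  \sum_(h <- A) dot h v ^+ 2 <= `|v| ^+ 2.
Proof. by move=> /(norm_sub_fourier_sqr v) E; rewrite -subr_ge0 -E sqr_ge0. Qed.

Lemma partial_sumE (I : choiceType) (V : zmodType) (x : I -> V) (A : {fset I}) :
  summability.partial_sum x A = \sum_(h <- A) x h.
Proof. by rewrite big_seq_fsetE. Qed.

Lemma sum_fset_restrict (A : {fset H}) (x : H -> H) :
  (forall h, ~ B h -> x h = 0) ->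
  \sum_(h <- A) x h = \sum_(h <- [fset h in A | `[< B h >]]%fset) x h.
Proof.
move=> x0; rewrite big_fset /= [RHS]big_mkcond /=; apply: eq_bigr => h _.
by case: asboolP => // /x0.
Qed.

Lemma fset_sum_split (V : zmodType) (A A' : {fset H}) (f : H -> V) :
  (A `<=` A')%fset ->
  \sum_(h <- A') f h = \sum_(h <- A) f h + \sum_(h <- (A' `\` A)%fset) f h.
Proof.
move=> AA'; rewrite (big_fsetID _ (mem A) A') /=.
congr (_ + _); apply: perm_big; apply: uniq_perm; rewrite ?fset_uniq // => h.
  rewrite !inE /= andbC; case: (boolP (h \in A)) => //= hA.
  exact: (fsubsetP AA').
by rewrite !inE andbC.
Qed.

Lemma fsumR_incl (A A' : {fset H}) (f : H -> R) : (forall h, 0 <= f h) ->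
  (A `<=` A')%fset -> \sum_(h <- A) f h <= \sum_(h <- A') f h.
Proof. by move=> f0 AA'; rewrite (fset_sum_split _ AA') lerDl sumr_ge0. Qed.

(** The net is Cauchy: once a finite set A0 nearly attains the supremum of the sums of squares,
    every larger set adds an orthogonal tail of small norm. *)
Lemma sqsummable_cvg c (M : R) : (forall h, ~ B h -> c h = 0) ->
  (forall A, [set` A] `<=` B -> \sum_(h <- A) c h ^+ 2 <= M) ->
  cvg (summability.partial_sum (fun h => c h *: h) @ summability.totally).
Proof.
move=> c0 cM.
pose q A := \sum_(h <- A) c h ^+ 2.
have restr A : [set` [fset h in A | `[< B h >]]%fset] `<=` B.
  by move=> h /=; rewrite !inE => /andP[_ /asboolP].
have qM A : q A <= M.
  rewrite /q (_ : \sum_(h <- A) _ =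
      \sum_(h <- [fset h in A | `[< B h >]]%fset) c h ^+ 2).
    by apply: cM; exact: restr.
  rewrite big_fset /= [RHS]big_mkcond /=; apply: eq_bigr => h _.
  by case: asboolP => // /c0 ->; rewrite expr0n.
have supq : has_sup (range q).
  by split; [exists (q fset0); exists fset0|exists M => _ [A _ <-]].
apply/cauchy_cvgP/cauchy_ballP => e e0.
have e20 : 0 < e / 2 by rewrite divr_gt0.
have [_ [A0 _ <-] A0lt] :=
  sup_adherent (exprn_gt0 2 e20 : 0 < (e / 2) ^+ 2) supq.
have near0 (A : {fset H}) : (A0 `<=` A)%fset ->
    `|\sum_(h <- A0) c h *: h - \sum_(h <- A) c h *: h| < e / 2.
  move=> A0A; rewrite distrC (fset_sum_split _ A0A) addrC addKr.
  rewrite -(ltr_pXn2r (n := 2)) ?nnegrE // ?ltW //.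
  rewrite sum_fset_restrict; last by move=> h /c0 ->; rewrite scale0r.
  rewrite norm_sum_sqr //.
  apply: (@le_lt_trans _ _ (\sum_(h <- (A `\` A0)%fset) c h ^+ 2)).
    apply: fsumR_incl => [h|]; first exact: sqr_ge0.
    by apply/fsubsetP => h; rewrite !inE => /andP[].
  rewrite -(ltrD2l (q A0)) -(fset_sum_split _ A0A) -ltrBlDr.
  apply: le_lt_trans A0lt.
  by apply: lerB => //; apply: ub_le_sup; [case: supq|exists A].
exists (ball (\sum_(h <- A0) c h *: h) (e / 2),
        ball (\sum_(h <- A0) c h *: h) (e / 2)) => /=.
  by split; exists A0 => // A /= A0A; rewrite partial_sumE -ball_normE /=; exact: near0.
move=> [x y] /= [bx by_]; rewrite (splitr e).
exact: ball_triangle (ball_sym bx) by_.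
Qed.

(** The coordinate at h of the partial sums is constant as soon as the finite set contains h. *)
Lemma dot_sqsummable c v : 
  (summability.partial_sum (fun h => c h *: h) @ summability.totally --> v) ->
  (forall h, ~ B h -> c h = 0) -> forall h, B h -> dot h v = c h.
Proof.
move=> cv c0 h Bh.
have d : dot h (summability.partial_sum (fun h => c h *: h) A)
    @[A --> summability.totally] --> dot h v.
  by apply: (cvg_comp _ _ cv); exact: dot_continuous.
apply/esym; move: d; apply: cvg_unique.
  exact: Rhausdorff.
apply: cvg_near_cst; exists [fset h]%fset => // A /= hA.
have {}hA : h \in A by apply: (fsubsetP hA); rewrite inE.
rewrite partial_sumE sum_fset_restrict; last by move=> k /c0 ->; rewrite scale0r.
rewrite orthonormal_dot_sum //.
  by rewrite sum_fset_delta // !inE hA; apply/asboolP.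
by move=> k /=; rewrite !inE => /andP[_ /asboolP].
Qed.

Lemma sum_fin_supp (V : normedModType R) (x : H -> V) (A : {fset H}) :
  (forall h, h \notin A -> x h = 0) -> summability.sum x = \sum_(h <- A) x h.
Proof.
move=> x0; apply: cvg_lim; first exact: norm_hausdorff.
apply: cvg_near_cst; exists A => // A' /= AA'.
rewrite partial_sumE (fset_sum_split _ AA').
rewrite [X in _ + X](_ : _ = 0) ?addr0 // big_seq big1 // => h.
by rewrite !inE => /andP[/x0].
Qed.

(** [diag_op] is a [lim], which has an arbitrary value if the net diverges; the bound M on finite
    sums of squares is the usable form of v lying in the domain. *)
Lemma diag_op_cvg (S : set H) (g : H -> R) v (M : R) : S `<=` B ->
  (forall A, [set` A] `<=` S -> \sum_(h <- A) (g h * dot h v) ^+ 2 <= M) ->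
  (summability.partial_sum (fun h => (\1_S h * g h * dot h v) *: h)
     @ summability.totally --> diag_op dot S g v).
Proof.
move=> SB gM.
apply: (@sqsummable_cvg _ M).
  by move=> h Bh; rewrite indicE memNset ?mul0r // => /SB.
move=> A AB.
have -> : \sum_(h <- A) (\1_S h * g h * dot h v) ^+ 2 =
   \sum_(h <- [fset h in A | `[< S h >]]%fset) (g h * dot h v) ^+ 2.
  rewrite big_fset /= [RHS]big_mkcond /=; apply: eq_bigr => h _.
  rewrite indicE; case: asboolP => Sh; first by rewrite mem_set // mul1r.
  by rewrite memNset // !mul0r expr0n.
by apply: gM => h /=; rewrite !inE => /andP[_ /asboolP].
Qed.

Lemma dot_diag_op (S : set H) (g : H -> R) v (M : R) h : S `<=` B ->
  (forall A, [set` A] `<=` S -> \sum_(h <- A) (g h * dot h v) ^+ 2 <= M) ->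
  S h -> dot h (diag_op dot S g v) = g h * dot h v.
Proof.
move=> SB gM Sh; rewrite (dot_sqsummable (diag_op_cvg SB gM)) //.
- by rewrite indicE mem_set // mul1r.
- by move=> k Bk; rewrite indicE memNset ?mul0r // => /SB.
- exact: SB.
Qed.

(** The defining sum has finite support here, so the formula holds for every g, in particular for
    positive powers of -A. *)
Lemma diag_op_fin (S : set H) (g : H -> R) (A : {fset H}) (a : H -> R) :
  [set` A] `<=` S -> S `<=` B ->
  diag_op dot S g (\sum_(h <- A) a h *: h) = \sum_(h <- A) (g h * a h) *: h.
Proof.
move=> AS SB.
have AB : [set` A] `<=` B by apply: subset_trans SB.
rewrite /diag_op (@sum_fin_supp _ _ A).
  rewrite big_seq [RHS]big_seq; apply: eq_bigr => h hA.
  rewrite indicE mem_set ?mul1r; last exact: AS.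
  by rewrite orthonormal_dot_sum ?sum_fset_delta //; exact: AB.
move=> h hA; rewrite indicE; have [/set_mem Sh|] := boolP (h \in S); last first.
  by move=> _; rewrite !mul0r scale0r.
rewrite orthonormal_dot_sum //; last exact: SB.
rewrite big_seq big1 ?mulr0 ?scale0r // => k kA.
case: eqP => [kh|]; last by rewrite mul0r.
by rewrite -kh kA in hA.
Qed.

Lemma proj_fin (A : {fset H}) v : 
  proj dot [set` A] v = \sum_(h <- A) dot h v *: h.
Proof.
rewrite /proj /diag_op (@sum_fin_supp _ _ A).
  rewrite big_seq [RHS]big_seq; apply: eq_bigr => h hA.
  by rewrite indicE mem_set // !mul1r.
by move=> h /negP hA; rewrite indicE memNset ?mul0r ?scale0r.
Qed.

Lemma proj_cvg (S : set H) v : S `<=` B ->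
  (summability.partial_sum (fun h => (\1_S h * dot h v) *: h)
     @ summability.totally --> proj dot S v).
Proof.
move=> SB; have := @diag_op_cvg S (cst 1) v (`|v| ^+ 2) SB.
have -> : (fun h => (\1_S h * cst 1 h * dot h v) *: h) =
          (fun h => (\1_S h * dot h v) *: h).
  by apply/funext => h; rewrite mulr1.
apply => A AS; under eq_bigr do rewrite mul1r.
by apply: bessel; exact: subset_trans SB.
Qed.

Hypothesis denB : dense (linear_span B).

Lemma fourier_cvg v :
  (summability.partial_sum (fun h => (\1_B h * dot h v) *: h)
     @ summability.totally --> v).
Proof.
suff {2}-> : v = proj dot B v by exact: proj_cvg.
apply/eqP; rewrite -subr_eq0; apply/eqP.
apply: (dense_dot_inj hilb denB) => h Bh.
rewrite dotDr dotNr (@dot_diag_op _ _ _ (`|v| ^+ 2)) ?mul1r ?subrr //.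
by move=> A AS; under eq_bigr do rewrite mul1r; exact: bessel.
Qed.

End orthonormal_sums.

Lemma esum_ge_fset (R : realType) (T : choiceType) (S : set T) (f : T -> \bar R)
    (A : {fset T}) : (forall x, (0 <= f x)%E) -> [set` A] `<=` S ->
  (\sum_(x <- A) f x <= \esum_(x in S) f x)%E.
Proof.
move=> f0 AS; apply: ereal_sup_ubound; exists [set` A].
  by split => //; exact: finite_fset.
by rewrite fsbig_finite //= set_fsetK.
Qed.

Section gram_schmidt.
Context (R : realType) (H : completeNormedModType R) (dot : {dot H for idfun}).
Hypothesis hilb : induces_norm dot.

(** The law of the Wiener process is prescribed along orthonormal vectors only, while the noise of
    the scheme runs along arbitrary ones. In the induction, the residue of the new vector is either
    0 or is normalised and put in front. *)
Lemma gram_schmidt (s : seq H) : exists (m : nat) (e : 'I_m -> H),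
  (forall i j, dot (e i) (e j) = (i == j)%:R) /\
  (forall b, b \in s -> b = \sum_i dot (e i) b *: e i).
Proof.
elim: s => [|b s [m [e [eo es]]]].
  by exists 0%N, (fun=> 0); split=> // -[].
pose r := b - \sum_i dot (e i) b *: e i.
have er i : dot (e i) r = 0.
  rewrite /r dotDr dotNr dot_sumr (bigD1 i) //= dotZr eo eqxx mulr1.
  rewrite big1 ?addr0 ?subrr // => j ji; rewrite dotZr eo eq_sym (negbTE ji).
  by rewrite mulr0.
have [r0|r0] := eqVneq r 0.
  exists m, e; split => // c; rewrite inE => /orP[/eqP ->|]; last exact: es.
  by apply/eqP; rewrite -subr_eq0; apply/eqP.
pose e' (i : 'I_m.+1) := if unlift ord0 i is Some j then e j else `|r|^-1 *: r.
have e'0 : e' ord0 = `|r|^-1 *: r by rewrite /e' unlift_none.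
have e'S i : e' (lift ord0 i) = e i by rewrite /e' liftK.
have rn : `|r| != 0 by rewrite normr_eq0.
exists m.+1, e'; split.
  move=> i j; case: (unliftP ord0 i) => [i' ->|->];
    case: (unliftP ord0 j) => [j' ->|->]; rewrite !(e'S, e'0) //.
  - by rewrite dotZr er mulr0.
  - by rewrite dotZl (dotC dot r) er mulr0.
  - by rewrite eqxx dotZr dotZl hilb expr2 mulKf // mulVf.
move=> c; rewrite inE => /orP[/eqP ->|/es cE].
  rewrite big_ord_recl e'0; under eq_bigr do rewrite e'S.
  rewrite scalerA dotZl.
  have -> : dot r b = `|r| ^+ 2.
    rewrite -hilb {3}/r dotDr dotNr dot_sumr big1 ?subr0 // => i _.
    by rewrite dotZr (dotC dot r) er mulr0.
  rewrite expr2 mulKf // mulfV // scale1r.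
  by rewrite /r subrK.
rewrite big_ord_recl e'0; under eq_bigr do rewrite e'S.
suff -> : dot (`|r|^-1 *: r) c = 0 by rewrite scale0r add0r.
rewrite dotZl cE dot_sumr big1 ?mulr0 // => i _.
by rewrite dotZr (dotC dot r) er mulr0.
Qed.

End gram_schmidt.

Section coordinates.
Context (R : realType) (H : completeNormedModType R) (dot : {dot H for idfun}).
Hypothesis hilb : induces_norm dot.
Context (B : set H).
Hypothesis onB : orthonormal_set dot B.

(** The numbers g h <h, v> are the coordinates of [diag_op dot B g v], so this is Bessel's
    inequality; membership in the domain supplies the bound under which these coordinates can be
    read off. *)
Lemma diag_dom_bessel (g : H -> R) v (A : {fset H}) :
  diag_dom dot B g v -> [set` A] `<=` B ->
  \sum_(h <- A) (g h * dot h v) ^+ 2 <= `|diag_op dot B g v| ^+ 2.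
Proof.
move=> gv AB.
have [M [M0 ME]] : exists M, 0 <= M /\
    (\esum_(h in B) (`|g h * dot h v| ^+ 2)%:E = M%:E)%E.
  have E0 : (0 <= \esum_(h in B) (`|g h * dot h v| ^+ 2)%:E)%E.
    by apply: esum_ge0 => h _; rewrite lee_fin sqr_ge0.
  exists (fine (\esum_(h in B) (`|g h * dot h v| ^+ 2)%:E)).
  by rewrite fine_ge0 // fineK // ge0_fin_numE.
have gM (A' : {fset H}) : [set` A'] `<=` B -> \sum_(h <- A') (g h * dot h v) ^+ 2 <= M.
  move=> A'B; rewrite -lee_fin -ME -sumEFin.
  under eq_bigr do rewrite -(real_normK (num_real (_ * _))).
  by apply: esum_ge_fset => // h; rewrite lee_fin sqr_ge0.
rewrite (_ : \sum_(h <- A) _ = \sum_(h <- A) dot h (diag_op dot B g v) ^+ 2).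
  exact: (bessel hilb onB).
rewrite big_seq [RHS]big_seq; apply: eq_bigr => h hA.
by rewrite (dot_diag_op hilb onB (@subset_refl _ B) gM) //; exact: AB.
Qed.

Context (L : H -> R) (C : R).
Hypothesis linL : forall a u v, L (a *: u + v) = a * L u + L v.
Hypothesis bndL : forall u, `|L u| <= C * `|u|.

Let L0 : L 0 = 0.
Proof.
have := linL 1 0 0; rewrite scaler0 addr0 mul1r => /eqP.
by rewrite -subr_eq subrr => /eqP.
Qed.

Let L_sum (A : seq H) (c : H -> R) :
  L (\sum_(u <- A) c u *: u) = \sum_(u <- A) c u * L u.
Proof.
elim: A => [|u A IH]; first by rewrite !big_nil.
by rewrite !big_cons linL IH.
Qed.

Let L_continuous : continuous L.
Proof.
move=> y; apply/cvgrPdist_le => e e0.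
have C0 : 0 < `|C| + 1 by rewrite ltr_pwDr.
near=> z; have -> : L y - L z = L (y - z).
  have -> : y - z = (-1) *: z + y by rewrite scaleN1r addrC.
  by rewrite linL mulN1r addrC.
apply: le_trans (bndL _) _.
apply: (@le_trans _ _ ((`|C| + 1) * `|y - z|)).
  by rewrite ler_wpM2r // (le_trans (ler_norm _)) // lerDl.
rewrite mulrC -ler_pdivlMr //; near: z.
by apply: cvgr_dist_le; [exact: cvg_id|rewrite divr_gt0].
Unshelve. all: by end_near. Qed.

Lemma riesz_proj (J : set H) : J `<=` B -> exists b,
  (forall y, L (proj dot J y) = dot b y) /\
  (\sum_(u <- A) (\1_J u * L u) ^+ 2 @[A --> @summability.totally H]
     --> `|b| ^+ 2).
Proof.
move=> JB; pose c u := \1_J u * L u.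
have c0 h : ~ B h -> c h = 0.
  by move=> Bh; rewrite /c indicE memNset ?mul0r // => /JB.
have cM (A : {fset H}) : [set` A] `<=` B -> \sum_(h <- A) c h ^+ 2 <= C ^+ 2.
  move=> AB; set q := \sum_(h <- A) _.
  have q0 : 0 <= q by apply: sumr_ge0 => h _; rewrite sqr_ge0.
  have Lq : L (\sum_(u <- A) c u *: u) = q.
    rewrite L_sum; apply: eq_bigr => u _; rewrite /c expr2 indicE.
    by case: (u \in J); rewrite ?mul1r ?mul0r.
  have := bndL (\sum_(u <- A) c u *: u); rewrite Lq ger0_norm // => qC.
  (* L maps the vector with coordinates c to q, and the squared norm of this vector is q as well;
     hence q^2 <= C^2 q, and q cancels. *)
  have : q ^+ 2 <= C ^+ 2 * q.
    rewrite -[X in _ * X](norm_sum_sqr hilb onB) // -exprMn.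
    by rewrite lerXn2r ?nnegrE // (le_trans q0).
  have [->|qn0] := eqVneq q 0; first by rewrite sqr_ge0.
  by rewrite expr2 ler_pM2r // lt_def qn0.
pose b := lim (summability.partial_sum (fun h => c h *: h) @ summability.totally).
have cb : (summability.partial_sum (fun h => c h *: h) @ summability.totally --> b).
  exact: (sqsummable_cvg hilb onB c0 cM).
exists b; split.
  move=> y.
  have c1 : L (summability.partial_sum (fun h => (\1_J h * dot h y) *: h) A)
      @[A --> summability.totally] --> L (proj dot J y).
    have c0' := proj_cvg hilb onB (v:=y) JB.
    by apply: (cvg_comp _ _ c0'); exact: L_continuous.
  have c2 : dot y (summability.partial_sum (fun h => c h *: h) A)
      @[A --> summability.totally] --> dot y b.
    by apply: (cvg_comp _ _ cb); exact: dot_continuous.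
  rewrite [RHS]dotC; apply: (cvg_unique (@Rhausdorff R) c1).
  move: c2; apply: cvg_trans; apply: near_eq_cvg; near=> A.
  rewrite !partial_sumE L_sum dot_sumr; apply: eq_bigr => h _.
  by rewrite dotZr /c (dotC dot y); ring.
pose f (A : {fset H}) := \sum_(u <- A) (\1_J u * L u) ^+ 2.
pose g A := `|summability.partial_sum (fun h => c h *: h) A| ^+ 2.
suff fg : f = g.
  change (f @ @summability.totally H --> `|b| ^+ 2); rewrite fg.
  have c4 : `|summability.partial_sum (fun h => c h *: h) A|
      @[A --> summability.totally] --> `|b| by apply: cvg_norm; exact: cb.
  by apply: (cvg_comp _ (fun x : R => x ^+ 2) c4); exact: exprn_continuous.
apply/funext => A; rewrite /f /g partial_sumE (sum_fset_restrict A (B := B)); last first.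
  by move=> h /c0 ->; rewrite scale0r.
rewrite (norm_sum_sqr hilb onB); last first.
  by move=> h /=; rewrite !inE => /andP[_ /asboolP].
rewrite big_fset /= [RHS]big_mkcond /=; apply: eq_bigr => h _.
by case: asboolP => // /c0; rewrite /c => ->; rewrite expr0n.
Unshelve. all: by end_near. Qed.

End coordinates.

Section parseval.
Context (R : realType) (U H : completeNormedModType R).
Context (dotU : {dot U for idfun}) (dotH : {dot H for idfun}).
Hypotheses (hilbU : induces_norm dotU) (hilbH : induces_norm dotH).
Context (basU : set U).
Hypothesis onbU : orthonormal_basis dotU basU.

Let onU : orthonormal_set dotU basU. Proof. by case: onbU. Qed.

Lemma parseval_cvg (u v : U) :
  \sum_(e <- A) \1_basU e * (dotU u e * dotU v e) @[A --> @summability.totally U]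
    --> dotU u v.
Proof.
have cv := @fourier_cvg _ _ _ hilbU _ onU (proj2 onbU) v.
pose f (A : {fset U}) := \sum_(e <- A) \1_basU e * (dotU u e * dotU v e).
pose g A := dotU u (summability.partial_sum (fun h => (\1_basU h * dotU h v) *: h) A).
suff fg : f = g.
  change (f @ @summability.totally U --> dotU u v); rewrite fg.
  by apply: (cvg_comp _ _ cv); exact: dot_continuous.
apply/funext => A; rewrite /f /g partial_sumE dot_sumr; apply: eq_bigr => e _.
by rewrite dotZr (dotC dotU v e); ring.
Qed.

(** For finite rank the double sum is the limit of the sums of |L e|^2 over finite sets of basis
    vectors, each of which is at most the full sum. This direction later bounds the second moment of
    a stochastic integral by its integrand. *)
Lemma parseval_ge (T : Type) (s : seq T) (c : T -> R) (u : T -> U) (x : T -> H) :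
  ((\sum_(i <- s) \sum_(j <- s)
      c i * c j * dotU (u i) (u j) * dotH (x i) (x j))%:E <=
   hs_norm2 basU (@Num.norm R H)
     (fun y => \sum_(i <- s) (c i * dotU (u i) y) *: x i)%R)%E.
Proof.
set E := hs_norm2 _ _ _; pose L y := \sum_(i <- s) (c i * dotU (u i) y) *: x i.
have normL y : `|L y| ^+ 2 = \sum_(i <- s) \sum_(j <- s)
    c i * c j * (dotU (u i) y * dotU (u j) y) * dotH (x i) (x j).
  rewrite -hilbH dot_suml; apply: eq_bigr => i _; rewrite dot_sumr.
  by apply: eq_bigr => j _; rewrite dotZl dotZr; ring.
have E0 : (0 <= E)%E by apply: esum_ge0 => y _; rewrite lee_fin sqr_ge0.
have [->|Efin] := eqVneq E +oo%E; first exact: leey.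
have {Efin}Efin : E \is a fin_num by rewrite ge0_fin_numE // ltey.
rewrite -(fineK Efin) lee_fin.
pose q (A : {fset U}) := \sum_(i <- s) \sum_(j <- s) c i * c j *
  (\sum_(e <- A) \1_basU e * (dotU (u i) e * dotU (u j) e)) * dotH (x i) (x j).
have qcv : q @ @summability.totally U --> \sum_(i <- s) \sum_(j <- s)
      c i * c j * dotU (u i) (u j) * dotH (x i) (x j).
  apply: cvg_big => [|i _]; first exact: add_continuous.
  apply: cvg_big => [|j _]; first exact: add_continuous.
  by apply: cvgMl; apply: cvgMr; exact: parseval_cvg.
have qE (A : {fset U}) : q A = \sum_(e <- [fset e in A | `[< basU e >]]%fset) `|L e| ^+ 2.
  under eq_bigr do rewrite normL.
  rewrite exchange_big /=; apply: eq_bigr => i _.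
  rewrite exchange_big /=; apply: eq_bigr => j _.
  rewrite -mulr_suml -mulr_sumr; congr (_ * _ * _).
  rewrite big_fset /= [RHS]big_mkcond /=; apply: eq_bigr => e _.
  rewrite indicE; case: asboolP => ue; first by rewrite mem_set // mul1r.
  by rewrite memNset // mul0r.
rewrite -(cvg_lim (@Rhausdorff R) qcv).
apply: limr_le; first by apply/cvg_ex; eexists; exact: qcv.
apply: nearW => A; rewrite qE -lee_fin (fineK Efin) -sumEFin.
by apply: esum_ge_fset => [y|y /=]; [rewrite lee_fin sqr_ge0|rewrite !inE => /andP[_ /asboolP]].
Qed.

End parseval.

(** * The Hilbert-Schmidt operator in coordinates *)

Section hilbert_schmidt_coordinates.
Context (R : realType) (U H : completeNormedModType R).
Context (dotU : {dot U for idfun}) (dotH : {dot H for idfun}).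
Hypotheses (hilbU : induces_norm dotU) (hilbH : induces_norm dotH).
Context (basU : set U) (basH : set H) (ev : H -> R) (beta : R) (B : U -> H).
Hypothesis onbU : orthonormal_basis dotU basU.
Hypothesis onbH : orthonormal_basis dotH basH.
Hypothesis ev0 : forall h, basH h -> ev h < 0.
Hypothesis BHS : hilbert_schmidt basU (interp_space dotH basH ev beta)
  (interp_norm dotH basH ev beta) B.

Let onU : orthonormal_set dotU basU. Proof. by case: onbU. Qed.
Let onH : orthonormal_set dotH basH. Proof. by case: onbH. Qed.

Lemma interp_norm_coord_le (I : {fset H}) (v : H) :
  [set` I] `<=` basH -> interp_space dotH basH ev beta v ->
  \sum_(h <- I) ((- ev h) `^ beta * dotH h v) ^+ 2 <=
    interp_norm dotH basH ev beta v ^+ 2.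
Proof. by move=> Ih Bv; exact: (diag_dom_bessel hilbH onH Bv Ih). Qed.

(** The functional y |-> <h, B y> is bounded because its multiple by the positive weight (-ev
    h)^beta is a coordinate of (-A)^beta B y. *)
Lemma hs_functional (J : set U) (h : H) : J `<=` basU -> basH h ->
  exists b, (forall y, dotH h (B (proj dotU J y)) = dotU b y) /\
  (\sum_(u <- A) (\1_J u * dotH h (B u)) ^+ 2 @[A --> @summability.totally U]
     --> `|b| ^+ 2).
Proof.
move=> JU hH; have [linB BV [M BM] _] := BHS.
have l0 : 0 < (- ev h) `^ beta by rewrite powR_gt0 // oppr_gt0 ev0.
apply: (@riesz_proj _ _ _ hilbU _ onU _ (M / (- ev h) `^ beta)) => //.
  by move=> a u v; rewrite linB dotDr dotZr.
move=> u; rewrite mulrAC ler_pdivlMr //; apply: le_trans (BM u).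
rewrite -(ler_pXn2r (n := 2)) ?nnegrE ?mulr_ge0 ?normr_ge0 ?(ltW l0) //.
have hI : [set` [fset h]%fset] `<=` basH.
  by move=> k /=; rewrite inE => /eqP ->.
have := interp_norm_coord_le hI (BV u).
by rewrite big_seq_fset1 !exprMn real_normK ?num_real // mulrC.
Qed.

(** K is the squared Hilbert-Schmidt norm of B into H_beta, and b h is the image of h under the
    adjoint of B P_J. Restricting to J and to a finite I only drops nonnegative terms of the double
    sum over basis vectors, so K serves all J and I. *)
Lemma hs_coordinates : exists K, 0 <= K /\ forall (J : set U), J `<=` basU ->
  exists b : H -> U,
  (forall h, basH h -> forall y, dotH h (B (proj dotU J y)) = dotU (b h) y) /\
  (forall I : {fset H}, [set` I] `<=` basH ->
     \sum_(h <- I) ((- ev h) `^ beta) ^+ 2 * `|b h| ^+ 2 <= K).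
Proof.
have [linB BV _ HSfin] := BHS.
set E := hs_norm2 _ _ _ in HSfin.
have E0 : (0 <= E)%E by apply: esum_ge0 => y _; rewrite lee_fin sqr_ge0.
have Efin : E \is a fin_num by rewrite ge0_fin_numE.
exists (fine E); split=> [|J JU]; first exact: fine_ge0.
have /boolp.choice[b bP] : forall h, exists b, basH h ->
  (forall y, dotH h (B (proj dotU J y)) = dotU b y) /\
  (\sum_(u <- A) (\1_J u * dotH h (B u)) ^+ 2 @[A --> @summability.totally U]
     --> `|b| ^+ 2).
  move=> h; have [hH|nH] := pselect (basH h); last by exists 0.
  by have [b ?] := hs_functional JU hH; exists b.
exists b; split=> [h hH|I IH]; first by have [] := bP h hH.
pose q (A : {fset U}) := \sum_(h <- I | `[< basH h >]) ((- ev h) `^ beta) ^+ 2 *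
  \sum_(u <- A) (\1_J u * dotH h (B u)) ^+ 2.
have restrI (f : H -> R) : \sum_(h <- I) f h = \sum_(h <- I | `[< basH h >]) f h.
  rewrite [RHS]big_mkcond /= big_seq [RHS]big_seq; apply: eq_bigr => h hI.
  by case: asboolP => // /(_ (IH _ hI)).
have qcv : q @ @summability.totally U -->
    \sum_(h <- I | `[< basH h >]) ((- ev h) `^ beta) ^+ 2 * `|b h| ^+ 2.
  apply: cvg_big => [|h /asboolP hH]; first exact: add_continuous.
  by apply: cvgMr; have [] := bP h hH.
rewrite restrI -(cvg_lim (@Rhausdorff R) qcv).
apply: limr_le; first by apply/cvg_ex; eexists; exact: qcv.
apply: nearW => A; rewrite /q -restrI -lee_fin (fineK Efin).
under eq_bigr do rewrite mulr_sumr.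
rewrite exchange_big /=.
apply: (@le_trans _ _ (\sum_(u <- [fset e in A | `[< basU e >]]%fset)
   interp_norm dotH basH ev beta (B u) ^+ 2)%:E).
  rewrite lee_fin big_fset /= [leRHS]big_mkcond /=; apply: ler_sum => u _.
  case: asboolP => uU; last first.
    rewrite big1 // => h _; rewrite indicE memNset ?mul0r ?expr0n ?mulr0 //.
    by move=> /JU.
  apply: le_trans (interp_norm_coord_le IH (BV u)).
  apply: ler_sum => h _; rewrite -exprMn indicE.
  case: (u \in J); rewrite ?mul1r // mul0r mulr0 expr0n /=.
  exact: sqr_ge0.
rewrite -sumEFin.
by apply: esum_ge_fset => [y|y /=]; [rewrite lee_fin sqr_ge0|rewrite !inE => /andP[_ /asboolP]].
Qed.

End hilbert_schmidt_coordinates.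

(** * Gaussian moments *)

Section centred_normal.
Context (R : realType).
Implicit Types (s : R) (f : R -> \bar R).
Local Notation leb := (@lebesgue_measure R).

Lemma normal_pdf0E s x : s != 0 ->
  normal_pdf 0 s x = normal_peak s * expR (- x ^+ 2 / (s ^+ 2 *+ 2)).
Proof. by move=> s0; rewrite normal_pdfE // /normal_fun subr0. Qed.

Lemma measurable_normal_pdfE s :
  measurable_fun setT (fun x : measurableTypeR R => (normal_pdf 0 s x)%:E).
Proof. by apply: measurableT_comp => //; exact: measurable_normal_pdf. Qed.

Local Notation "'d nu '/d mu" := (Radon_Nikodym_SigmaFinite.f nu mu).

(** Lebesgue measure is invariant under reflection and the centred density is even. *)
Lemma normal_prob_opp s (C : set R) : s != 0 -> measurable C ->
  normal_prob 0 s (-%R @^-1` C) = normal_prob 0 s C.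
Proof.
move=> s0 mC.
have mN : measurable_fun setT (-%R : measurableTypeR R -> measurableTypeR R).
  by [].
transitivity (\int[pushforward leb (-%R : measurableTypeR R -> measurableTypeR R)]_(x in C)
    (normal_pdf 0 s x)%:E)%E.
  rewrite ge0_integral_pushforward //.
  - by rewrite /normal_prob; apply: eq_integral => x _ /=; rewrite !normal_pdf0E // sqrrN.
  - by apply: measurable_funTS; apply: (proj2 (measurable_EFinP _ _)); exact: measurable_normal_pdf.
  - by move=> x _; rewrite lee_fin normal_pdf_ge0.
by apply: eq_measure_integral => A mA _; exact: lebesgue_measureN.
Qed.

(** The Radon-Nikodym derivative is known only through its integrals; these agree with those of the
    density on all measurable sets, so both coincide almost everywhere. *)
Lemma integral_normal_prob s f : measurable_fun setT f -> (forall x, 0 <= f x)%E ->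
  (\int[normal_prob 0 s]_x f x = \int[leb]_x (f x * (normal_pdf 0 s x)%:E))%E.
Proof.
move=> mf f0.
rewrite -(Radon_Nikodym_SigmaFinite.change_of_variables
  (normal_prob_dominates 0 s) f0 measurableT mf).
have mp : measurable_fun setT (fun x => (normal_pdf 0 s x)%:E).
  apply: (proj2 (measurable_EFinP _ _)); exact: measurable_normal_pdf.
have mrn := Radon_Nikodym_SigmaFinite.f_integrable (normal_prob_dominates 0 s).
apply: ae_eq_integral => //.
- by apply: emeasurable_funM => //; exact: measurable_int mrn.
- exact: emeasurable_funM.
- have E : ae_eq leb setT ('d (normal_prob 0 s) '/d leb) (fun x => (normal_pdf 0 s x)%:E).
    apply: integral_ae_eq => //.
    move=> E _ mE; rewrite -Radon_Nikodym_SigmaFinite.f_integral //.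
    exact: normal_prob_dominates.
  by apply: filterS E => x E Dx; rewrite E.
Qed.

Lemma normal_pdf_moment_bound (j : nat) : exists C : R, 0 <= C /\
  forall x : R, x ^+ (2 * j) * normal_pdf 0 1 x <= C * normal_pdf 0 2 x.
Proof.
have p1 : 0 < normal_peak (1 : R) by apply: normal_peak_gt0.
have p2 : 0 < normal_peak (2 : R) by apply: normal_peak_gt0.
(* The exponents of the two densities differ by (1/2 - 1/8) x^2 = 3/8 x^2, and z^j / j! <= e^z at z
   = 3/8 x^2 produces j! (8/3)^j; the peaks correct the normalisation. *)
pose C : R := (j`!)%:R * (8 / 3) ^+ j * normal_peak 1 / normal_peak 2.
exists C; split.
  by rewrite /C !mulr_ge0 // ?exprn_ge0 ?divr_ge0 ?invr_ge0 // ltW.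
move=> x; rewrite !normal_pdf0E //.
have E : expR (- x ^+ 2 / (1 ^+ 2 *+ 2)) =
    expR (- x ^+ 2 / (2 ^+ 2 *+ 2)) / expR (3 / 8 * x ^+ 2) :> R.
  by rewrite -expRN -expRD; congr expR; field.
rewrite E /C.
set a := expR (- x ^+ 2 / _); set b := expR (3 / 8 * _).
have a0 : 0 < a by exact: expR_gt0.
have b0 : 0 < b by exact: expR_gt0.
have xb : x ^+ (2 * j) <= (j`!)%:R * (8 / 3) ^+ j * b.
  have y0 : 0 <= 3 / 8 * x ^+ 2 by rewrite mulr_ge0 // sqr_ge0.
  have : (3 / 8 * x ^+ 2) ^+ j / (j`!)%:R <= b.
    rewrite /b; case: (j) => [|k].
      by rewrite expr0 fact0 divr1 -[leLHS]expR0 ler_expR.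
    by apply: le_trans (expR_ge1Dxn k y0); rewrite lerDr.
  rewrite ler_pdivrMr ?ltr0n ?fact_gt0 // exprMn -exprM => H0.
  have q0 : 0 < (3 / 8) ^+ j :> R by rewrite exprn_gt0.
  rewrite -(ler_pM2l q0) [leRHS](_ : _ = b * (j`!)%:R) //.
  have -> : (8 / 3) ^+ j = ((3 / 8) ^+ j)^-1 :> R by rewrite -exprVn invf_div.
  by field; rewrite gt_eqF.
rewrite (_ : _ * (normal_peak 2 * a) = (j`!)%:R * (8 / 3) ^+ j * (normal_peak 1 * a)); last first.
  by field; rewrite gt_eqF.
rewrite [leLHS](_ : _ = x ^+ (2 * j) / b * (normal_peak 1 * a)); last first.
  by field; rewrite gt_eqF.
apply: ler_wpM2r; first by rewrite mulr_ge0 ?ltW.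
by rewrite ler_pdivrMr.
Qed.

(** The substitution by s x reduces every moment to standard deviation 1, where it is finite by
    comparison with the density of standard deviation 2. *)
Lemma normal_moment : exists kappa : nat -> R, (forall j, 0 <= kappa j) /\
  forall s, 0 < s -> forall j,
    (\int[normal_prob 0 s]_x (x ^+ (2 * j))%:E = (s ^+ (2 * j) * kappa j)%:E)%E.
Proof.
pose K (j : nat) := (\int[leb]_x (x ^+ (2 * j) * normal_pdf 0 1 x)%:E)%E.
have xj0 (x : R) j : 0 <= x ^+ (2 * j) by rewrite exprM exprn_ge0 // sqr_ge0.
have mxj j : measurable_fun setT (fun x : R => (x ^+ (2 * j))%:E).
  by apply/measurable_EFinP; exact: exprn_measurable.
have K0 j : (0 <= K j)%E.
  by apply: integral_ge0 => x _; rewrite lee_fin mulr_ge0 // normal_pdf_ge0.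
have Kfin j : K j \is a fin_num.
  rewrite ge0_fin_numE //.
  have [C [C0 CP]] := normal_pdf_moment_bound j.
  apply: (@le_lt_trans _ _ (\int[leb]_x (C%:E * (normal_pdf 0 2 x)%:E))%E).
    apply: ge0_le_integral => //.
    - by move=> x _; rewrite lee_fin mulr_ge0 // normal_pdf_ge0.
    - apply/measurable_EFinP; apply: measurable_funM.
        exact: exprn_measurable.
      exact: measurable_normal_pdf.
    - apply/measurable_EFinP; apply: measurable_funM => //.
      exact: measurable_normal_pdf.
    - by move=> x _; rewrite lee_fin.
  rewrite ge0_integralZl_EFin //.
  - by rewrite integral_normal_pdf mule1 ltry.
  - by move=> x _; rewrite lee_fin normal_pdf_ge0.
  - exact: measurable_normal_pdfE.
exists (fine \o K); split=> [j|s s0 j] /=; first exact: fine_ge0.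
rewrite integral_normal_prob //.
pose F (x : R) := s * x.
have dF : F^`()%classic = cst s.
  apply/funext => x; rewrite derive1E deriveM // derive_cst scaler0 addr0.
  by rewrite derive_id /GRing.scale /= mulr1.
under eq_integral do rewrite -EFinM.
rewrite (@increasing_ge0_integration_by_substitutionT _ F).
- rewrite dF EFinM fineK // /K -ge0_integralZl_EFin //.
  + apply: eq_integral => x _ /=; congr EFin; rewrite /F !fctE !normal_pdf0E ?gt_eqF //.
    rewrite /normal_peak.
    have -> : - (s * x) ^+ 2 / (s ^+ 2 *+ 2) = - x ^+ 2 / (1 ^+ 2 *+ 2).
      by field; rewrite gt_eqF.
    have -> : Num.sqrt (s ^+ 2 * pi *+ 2) = s * Num.sqrt (1 ^+ 2 * pi *+ 2).
      rewrite -mulrnAr sqrtrM ?sqr_ge0 // sqrtr_sqr gtr0_norm //.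
      by rewrite expr1n mul1r.
    have q0 : Num.sqrt (1 ^+ 2 * pi *+ 2) != 0 :> R.
      by rewrite expr1n mul1r gt_eqF // sqrtr_gt0 pmulrn_lgt0 // pi_gt0.
    by rewrite exprMn; field; rewrite q0 gt_eqF.
  + by move=> x _; rewrite lee_fin mulr_ge0 // normal_pdf_ge0.
  + apply/measurable_EFinP; apply: measurable_funM.
      exact: exprn_measurable.
    exact: measurable_normal_pdf.
- by move=> x y xy; rewrite /F ltr_pM2l.
- by rewrite dF => ?; exact: cvg_cst.
- by rewrite dF; exact: is_cvg_cst.
- by rewrite dF; exact: is_cvg_cst.
- by move=> x; rewrite /F; exact: derivableM.
- by apply: gt0_cvgMrNy => //; exact: cvg_id.
- by apply: gt0_cvgMry => //; exact: cvg_id.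
- move=> x; apply: cvgM; first exact: exprn_continuous.
  by apply: continuous_normal_pdf; rewrite gt_eqF.
- by move=> x; rewrite mulr_ge0 // normal_pdf_ge0.
- by move=> x; rewrite lee_fin.
Qed.

End centred_normal.

(** * Increments of the Wiener process *)

Section tuple_law.
Context d (T : measurableType d) (R : realType) (n : nat).

Definition box (C : 'I_n -> set T) : set (n.-tuple T) :=
  [set x | forall i, C i (tnth x i)].

Lemma measurable_box (C : 'I_n -> set T) :
  (forall i, measurable (C i)) -> measurable (box C).
Proof.
move=> mC.
have -> : box C = \bigcap_(i in [set: 'I_n]) ((fun x => tnth x i) @^-1` C i).
  by apply/seteqP; split=> x /= xC i; [move=> _|]; exact: xC.
apply: fin_bigcap_measurable; first exact: finite_finset.
by move=> i _; rewrite -[X in measurable X]setTI; exact: measurable_tnth.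
Qed.

(** Boxes are stable under intersection and generate the product sigma-algebra; a condition on one
    component is a box with [setT] in all others. *)
Lemma tuple_measure_unique (m1 m2 : {measure set (n.-tuple T) -> \bar R}) :
  (m1 setT < +oo)%E ->
  (forall C, (forall i, measurable (C i)) -> m1 (box C) = m2 (box C)) ->
  forall A, measurable A -> m1 A = m2 A.
Proof.
move=> m1fin m12.
pose G := [set box C | C in [set C : 'I_n -> set T | forall i, measurable (C i)]].
have GT : G setT.
  by exists (fun=> setT) => [i|]; [exact: measurableT|apply/seteqP; split].
apply: (measure_unique G (fun=> setT)) => //.
- rewrite eqEsubset; split.
    apply: smallest_sub; first exact: smallest_sigma_algebra.
    elim/big_ind: _ => [//|A B sA sB|i _]; first by rewrite subUset.
    move=> _ [A mA <-]; rewrite setTI; apply: sub_sigma_algebra.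
    exists (fun j => if j == i then A else setT) => /= [j|].
      by case: ifP.
    apply/seteqP; split=> x /=; first by move=> /(_ i); rewrite eqxx.
    by move=> Ax j; case: eqP => // ->.
  apply: smallest_sub; first exact: sigma_algebra_measurable.
  by move=> _ [C mC <-]; exact: measurable_box.
- move=> _ _ [C mC <-] [C' mC' <-]; exists (fun i => C i `&` C' i) => /=.
    by move=> i; exact: measurableI.
  apply/seteqP; split=> x /=; first by move=> CC'; split=> i; case: (CC' i).
  by move=> [Cx C'x] i; split.
- by apply/seteqP; split=> // x _; exists 0%N.
- by move=> _ [C mC <-]; exact: m12.
Qed.
End tuple_law.

Section increments.
Context (R : realType) (U : completeNormedModType R) (dotU : {dot U for idfun}).
Hypothesis hilbU : induces_norm dotU.
Context (d : measure_display) (Omega : measurableType d) (P : probability Omega R).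
Context (T : R) (F : R -> set (set Omega)).
Hypothesis Ffilt : filtration T F.
Context (W : R -> U -> Omega -> R).
Hypothesis Wwiener : cylindrical_wiener P T F dotU W.

Definition incr (s t : R) (u : U) (w : Omega) : R := W t u w - W s u w.

(** Omega equipped with F s as its sigma-algebra: measurability with respect to F s becomes ordinary
    measurability under a type annotation, and products such as F_s x R^n are available. *)
Notation Fs s := (g_sigma_algebraType (F s)).

Lemma filtration_measurableE s : 0 <= s -> s <= T ->
  forall A, measurable (A : set (Fs s)) = F s A.
Proof.
move=> s0 sT A; rewrite measurable_g_measurableTypeE //.
by have [+ _ _] := Ffilt; apply; rewrite in_itv /= s0.
Qed.

Lemma filtration_id_measurable s : 0 <= s -> s <= T ->
  measurable_fun setT (id : Omega -> Fs s).
Proof.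
move=> s0 sT _ A; rewrite filtration_measurableE // setTI.
by have [_ + _] := Ffilt; apply; rewrite in_itv /= s0.
Qed.

Lemma filtration_measurable s (f : Fs s -> R) : 0 <= s -> s <= T ->
  measurable_fun setT f -> measurable_fun setT (f : Omega -> R).
Proof.
move=> s0 sT mf; exact: (measurableT_comp mf (filtration_id_measurable s0 sT)).
Qed.

Lemma filtration_measurable_le s t (f : Omega -> R) : 0 <= s -> s <= t -> t <= T ->
  measurable_fun setT (f : Fs s -> R) -> measurable_fun setT (f : Fs t -> R).
Proof.
move=> s0 st tT mf _ A mA; have t0 := le_trans s0 st; have sT := le_trans st tT.
rewrite filtration_measurableE //.
have [_ _ /(_ s t s0 st tT)] := Ffilt; apply.
by rewrite -filtration_measurableE //; exact: mf.
Qed.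

Lemma wiener_measurable s u : 0 <= s -> s <= T ->
  measurable_fun setT (W s u : Fs s -> R).
Proof.
move=> s0 sT _ A mA; rewrite filtration_measurableE // setTI.
by apply: (cw_adapted Wwiener) => //; rewrite in_itv /= s0.
Qed.

Lemma incr_measurable s t u : 0 <= s -> s <= t -> t <= T ->
  measurable_fun setT (incr s t u : Fs t -> R).
Proof.
move=> s0 st tT; apply: measurable_funB.
  by apply: wiener_measurable => //; exact: le_trans st.
apply: (filtration_measurable_le s0 st tT).
by apply: wiener_measurable => //; exact: le_trans tT.
Qed.

Lemma incr_measurableT s t u : 0 <= s -> s <= t -> t <= T ->
  measurable_fun setT (incr s t u).
Proof.
move=> s0 st tT; apply: (@filtration_measurable t) => //.
  exact: le_trans st.
exact: incr_measurable.
Qed.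

(* Both image laws on F_s x R^n agree on the pi-system of rectangles with a
   box as second factor. *)
Lemma incr_symmetric s t n (e : 'I_n -> U) (Phi : Fs s * n.-tuple R -> \bar R) :
  0 <= s -> s < t -> t <= T ->
  (forall i j, dotU (e i) (e j) = (i == j)%:R) ->
  measurable_fun setT Phi -> (forall z, 0 <= Phi z)%E ->
  (\int[P]_w Phi (w, [tuple incr s t (e i) w | i < n]) =
   \int[P]_w Phi (w, [tuple (- incr s t (e i) w)%R | i < n]))%E.
Proof.
move=> s0 st tT eo mPhi Phi0.
have sT : s <= T by exact: le_trans (ltW st) tT.
pose X w : Fs s * n.-tuple R := (w, [tuple incr s t (e i) w | i < n]).
pose Y w : Fs s * n.-tuple R := (w, [tuple - incr s t (e i) w | i < n]).
have mX2 : measurable_fun setT (fun w => [tuple incr s t (e i) w | i < n]).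
  apply/measurable_fun_tnthP => i.
  apply: eq_measurable_fun (incr_measurableT (e i) s0 (ltW st) tT).
  by move=> w _; rewrite /= tnth_mktuple.
have mY2 : measurable_fun setT (fun w => [tuple - incr s t (e i) w | i < n]).
  apply/measurable_fun_tnthP => i.
  apply: eq_measurable_fun (measurableT_comp _ (incr_measurableT (e i) s0 (ltW st) tT)); last first.
    exact: oppr_measurable.
  by move=> w _; rewrite /= tnth_mktuple.
have mX : measurable_fun setT X.
  by apply: measurable_fun_pair => //; exact: filtration_id_measurable.
have mY : measurable_fun setT Y.
  by apply: measurable_fun_pair => //; exact: filtration_id_measurable.
have m12 (A : set (Fs s)) (B : set (n.-tuple R)) : measurable A -> measurable B ->
    P (X @^-1` (A `*` B)) = P (Y @^-1` (A `*` B)).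
  move=> mA mB; have FA : F s A by rewrite -filtration_measurableE.
  have mA' : measurable (A : set Omega).
    by have := filtration_id_measurable s0 sT measurableT mA; rewrite setTI.
  (* For fixed A, restricting P to A makes both sides finite measures in the second factor alone,
     which need to be compared on boxes only. *)
  pose m1 := measure_function_pushforward__canonical__measure_function_Measure
    (mrestr P mA') mX2.
  pose m2 := measure_function_pushforward__canonical__measure_function_Measure
    (mrestr P mA') mY2.
  suff H : m1 B = m2 B.
    move: H; rewrite /m1 /m2 /= /pushforward /mrestr => H.
    have XE : X @^-1` (A `*` B) =
        (fun w => [tuple incr s t (e i) w | i < n]) @^-1` B `&` A.
      by apply/seteqP; split=> w [].
    have YE : Y @^-1` (A `*` B) =
        (fun w => [tuple - incr s t (e i) w | i < n]) @^-1` B `&` A.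
      by apply/seteqP; split=> w [].
    by rewrite XE YE.
  apply: tuple_measure_unique mB.
    rewrite /= /pushforward /mrestr; apply: le_lt_trans (ltry 1).
    by rewrite preimage_setT setTI; exact: probability_le1.
  move=> C mC; rewrite /= /pushforward /mrestr ![_ `&` A]setIC.
  have W1 := cw_increments Wwiener s0 st tT eo FA.
  have -> : (fun w => [tuple incr s t (e i) w | i < n]) @^-1` box C =
      \bigcap_(i in [set: 'I_n]) (fun w => W t (e i) w - W s (e i) w) @^-1` C i.
    apply/seteqP; split=> w /= wC i; last by rewrite tnth_mktuple; exact: wC.
    by move=> _; have := wC i; rewrite tnth_mktuple.
  have -> : (fun w => [tuple - incr s t (e i) w | i < n]) @^-1` box C =
      \bigcap_(i in [set: 'I_n]) (fun w => W t (e i) w - W s (e i) w) @^-1`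
        (-%R @^-1` C i).
    apply/seteqP; split=> w /= wC i; last by rewrite tnth_mktuple; exact: wC.
    by move=> _; have := wC i; rewrite tnth_mktuple.
  rewrite !W1 //.
    congr (_ * _)%E; apply: eq_bigr => i _; rewrite normal_prob_opp //.
    by rewrite gt_eqF // sqrtr_gt0 subr_gt0.
  move=> i; rewrite -[X in measurable X]setTI.
  exact: (oppr_measurable measurableT).
pose muX := measure_function_pushforward__canonical__measure_function_Measure P mX.
pose muY := measure_function_pushforward__canonical__measure_function_Measure P mY.
transitivity (\int[muX]_z Phi z)%E.
  by rewrite (ge0_integral_pushforward mX).
transitivity (\int[muY]_z Phi z)%E; last first.
  by rewrite (ge0_integral_pushforward mY).
apply: eq_measure_integral => Z mZ _.
apply: (measure_unique [set A `*` B | A in measurable & B in measurable] (fun=> setT)) => //.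
- exact: measurable_prod_measurableType.
- move=> _ _ [A mA [B mB <-]] [A' mA' [B' mB' <-]].
  rewrite -setXI; exists (A `&` A'); first exact: measurableI.
  by exists (B `&` B') => //; exact: measurableI.
- by move=> _; exists setT => //; exists setT => //; rewrite setXTT.
- by apply/seteqP; split=> // x _; exists 0%N.
- by move=> _ [A mA [B mB <-]]; exact: m12.
- by move=> _; rewrite /= /pushforward preimage_setT; rewrite probability_setT ltry.
Qed.

End increments.

Section increment_laws.
Context (R : realType) (U : completeNormedModType R) (dotU : {dot U for idfun}).
Hypothesis hilbU : induces_norm dotU.
Context (d : measure_display) (Omega : measurableType d) (P : probability Omega R).
Context (T : R) (F : R -> set (set Omega)).
Hypothesis Ffilt : filtration T F.
Context (W : R -> U -> Omega -> R).
Hypothesis Wwiener : cylindrical_wiener P T F dotU W.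

Notation Fs s := (g_sigma_algebraType (F s)).
Notation incr := (incr W).

(** The law of the pair (w, increment) on F_s x R is a product measure, as [cw_increments] for a
    single unit vector shows on rectangles; Tonelli's theorem then splits the integral. *)
Lemma incr_independent s t u (Z : Fs s -> \bar R) (f : R -> \bar R) :
  0 <= s -> s < t -> t <= T -> dotU u u = 1 ->
  measurable_fun setT Z -> (forall w, 0 <= Z w)%E ->
  measurable_fun setT f -> (forall x, 0 <= f x)%E ->
  (\int[P]_w (Z w * f (incr s t u w)) =
   \int[P]_w Z w * \int[normal_prob 0 (Num.sqrt (t - s))]_x f x)%E.
Proof.
move=> s0 st tT u1 mZ Z0 mf f0.
have sT : s <= T by exact: le_trans (ltW st) tT.
have mid := filtration_id_measurable Ffilt s0 sT.
pose nu := normal_prob 0 (Num.sqrt (t - s)) : probability (measurableTypeR R) R.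
pose X (w : Omega) : Fs s * measurableTypeR R := (w : Fs s, incr s t u w).
have mincr := incr_measurableT Ffilt Wwiener u s0 (ltW st) tT.
have mX : measurable_fun setT X by apply: measurable_fun_pair.
(* P restricted to F s, written as the law of the identity map. *)
pose m1 : probability (Fs s) R := distribution P (mfun_Sub (mem_set mid)).
pose m' := measure_function_pushforward__canonical__measure_function_Measure P mX.
have m'E (A : set (Fs s)) (B : set (measurableTypeR R)) : measurable A ->
    measurable B -> m' (A `*` B) = (m1 A * nu B)%E.
  move=> mA mB; have FA : F s A by rewrite -(filtration_measurableE Ffilt).
  rewrite /m' /m1 /= /distribution /pushforward.
  have eo (i j : 'I_1) : dotU u u = (i == j)%:R by rewrite !ord1 eqxx.
  have := cw_increments Wwiener s0 st tT (e := fun=> u) eo FA (C := fun=> B) (fun=> mB).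
  rewrite big_ord1 => <-; congr (P _); apply/seteqP; split=> w /=.
    by move=> [Aw Bw]; split.
  by move=> [Aw Bw]; split=> //; exact: (Bw ord0).
have mZf : measurable_fun setT (fun z : Fs s * measurableTypeR R => (Z z.1 * f z.2)%E).
  apply: emeasurable_funM; first exact: measurableT_comp measurable_fst.
  exact: measurableT_comp measurable_snd.
have Zf0 (z : Fs s * measurableTypeR R) : (0 <= Z z.1 * f z.2)%E.
  by rewrite mule_ge0.
transitivity (\int[m']_z (Z z.1 * f z.2))%E.
  by rewrite (ge0_integral_pushforward mX).
transitivity (\int[(m1 \x nu)%E]_z (Z z.1 * f z.2))%E.
  by apply: eq_measure_integral => A mA _; apply/esym; exact: product_measure_unique m'E _ mA.
rewrite fubini_tonelli1 //.
transitivity (\int[m1]_x (Z x * \int[nu]_y f y))%E.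
  by apply: eq_integral => x _; rewrite /fubini_F /= ge0_integralZl.
rewrite ge0_integralZr //; last by apply: integral_ge0.
by congr (_ * _)%E; rewrite ge0_integral_distribution.
Qed.

Lemma wiener_linear t : 0 <= t -> t <= T -> forall I (s : seq I) (c : I -> R) (u : I -> U),
  {ae P, forall w, W t (\sum_(i <- s) c i *: u i) w = \sum_(i <- s) c i * W t (u i) w}.
Proof.
move=> t0 tT I s c u; have tT' : t \in `[0, T] by rewrite in_itv /= t0.
elim: s => [|i s IH].
  (* Additivity at 0 = 1 0 + 0 forces W t 0 = 0 almost surely. *)
  have := cw_linear Wwiener tT' 1 0 0; apply: filterS => w.
  rewrite !big_nil scaler0 addr0 mul1r => /eqP.
  by rewrite -subr_eq subrr => /eqP.
have := cw_linear Wwiener tT' (c i) (u i) (\sum_(j <- s) c j *: u j).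
by apply: filterS2 IH => w E1 E2; rewrite !big_cons E2 E1.
Qed.

Lemma incr_linear s t : 0 <= s -> s <= t -> t <= T ->
  forall I (r : seq I) (c : I -> R) (u : I -> U),
  {ae P, forall w, incr s t (\sum_(i <- r) c i *: u i) w =
    \sum_(i <- r) c i * incr s t (u i) w}.
Proof.
move=> s0 st tT I r c u.
have := wiener_linear (le_trans s0 st) tT r c u.
apply: filterS2 (wiener_linear s0 (le_trans st tT) r c u) => w E1 E2.
rewrite /incr E1 E2 -sumrB; apply: eq_bigr => i _.
by rewrite mulrBr.
Qed.

Lemma incrZ s t c u : 0 <= s -> s <= t -> t <= T ->
  {ae P, forall w, incr s t (c *: u) w = c * incr s t u w}.
Proof.
move=> s0 st tT; have := incr_linear s0 st tT [:: tt] (fun=> c) (fun=> u).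
by apply: filterS => w; rewrite !big_seq1.
Qed.

Lemma incrD s t u v : 0 <= s -> s <= t -> t <= T ->
  {ae P, forall w, incr s t (u + v) w = incr s t u w + incr s t v w}.
Proof.
move=> s0 st tT; have := incr_linear s0 st tT [:: u; v] (fun=> 1) id.
by apply: filterS => w; rewrite !big_cons !big_nil !scale1r !mul1r !addr0.
Qed.

Lemma ae_forall_ord n (Q : 'I_n -> Omega -> Prop) :
  (forall i, {ae P, forall w, Q i w}) -> {ae P, forall w, forall i, Q i w}.
Proof.
move=> H.
have : {ae P, forall w, forall k : nat, forall kn : (k < n)%N, Q (Ordinal kn) w}.
  apply: ae_foralln => k; have [kn|nkn] := pselect (k < n)%N.
    by apply: filterS (H (Ordinal kn)) => w Qw kn'; rewrite (bool_irrelevance kn' kn).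
  by apply: aeW => w kn; case: nkn.
by apply: filterS => w Qw [k kn]; exact: Qw.
Qed.

End increment_laws.

(** The integral of a nonnegative function is a supremum over simple functions below it, hence
    monotone without measurability. This is used for the Hilbert-Schmidt norms in the definition of
    the Ito integral, which are sums over a basis and not known to be measurable. *)
Lemma le_lower_integral (R : realType) (d : measure_display) (T : measurableType d)
    (mu : {measure set T -> \bar R}) (D : set T) (f g : T -> \bar R) :
  (forall x, D x -> 0 <= g x)%E -> (forall x, D x -> f x <= g x)%E ->
  (\int[mu]_(x in D) f x <= \int[mu]_(x in D) g x)%E.
Proof.
move=> g0 fg; rewrite integralE.
apply: (@le_trans _ _ (\int[mu]_(x in D) (f^\+)%E x)%E).
  by rewrite -[leRHS]sube0 leeB // integral_ge0.
rewrite !ge0_integralE //.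
apply: le_ereal_sup => _ [h /= hf <-]; exists h => // x; apply: le_trans (hf x) _.
rewrite /patch; case: ifPn => // /set_mem Dx; rewrite funeposE ge_max.
by rewrite fg // g0.
Qed.

Section square_integrable.
Context (R : realType) (d : measure_display) (Omega : measurableType d).
Context (P : probability Omega R).
Implicit Types f g : Omega -> R.

Definition sqint f : Prop := measurable_fun setT f /\
  P.-integrable setT (EFin \o (fun w => f w ^+ 2)).

Lemma sqintM f g : sqint f -> sqint g ->
  P.-integrable setT (EFin \o (fun w => f w * g w)).
Proof.
move=> [mf f2] [mg g2]; apply: le_integrable (integrableD measurableT f2 g2) => //.
  by apply/measurable_EFinP; exact: measurable_funM.
move=> w _ /=; rewrite lee_fin.
rewrite [leRHS]ger0_norm ?addr_ge0 ?sqr_ge0 //.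
rewrite ler_norml; apply/andP; split.
  have := sqr_ge0 (f w + g w); have := sqr_ge0 (f w); have := sqr_ge0 (g w).
  by rewrite sqrrD; lra.
have := sqr_ge0 (f w - g w); have := sqr_ge0 (f w); have := sqr_ge0 (g w).
by rewrite sqrrB; lra.
Qed.

Lemma sqintD f g : sqint f -> sqint g -> sqint (fun w => f w + g w).
Proof.
move=> [mf f2] [mg g2]; have fg := sqintM (conj mf f2) (conj mg g2).
split; first exact: measurable_funD.
have H := integrableD measurableT (integrableD measurableT f2 g2)
  (integrableD measurableT fg fg).
apply: eq_integrable H => // w _ /=; rewrite -!EFinD; congr EFin; ring.
Qed.

Lemma sqint_bounded f g : measurable_fun setT g -> (forall w, 0 <= g w <= 1) ->
  sqint f -> sqint (fun w => g w * f w).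
Proof.
move=> mg g01 [mf f2]; split; first exact: measurable_funM.
apply: le_integrable f2 => //.
  by apply/measurable_EFinP/measurable_funX/measurable_funM.
move=> w _ /=; rewrite lee_fin !ger0_norm ?sqr_ge0 // exprMn.
have /andP[g0 g1] := g01 w.
by rewrite ler_piMl ?sqr_ge0 // exprn_ile1.
Qed.

Lemma Rintegral_sum I (s : seq I) (f : I -> Omega -> R) :
  (forall i, P.-integrable setT (EFin \o f i)) ->
  \int[P]_w (\sum_(i <- s) f i w) = \sum_(i <- s) \int[P]_w f i w.
Proof.
move=> fi; elim: s => [|i s IH].
  rewrite big_nil; under eq_Rintegral do rewrite big_nil.
  by rewrite Rintegral_cst // mul0r.
rewrite big_cons -IH -RintegralD //.
  by apply: eq_Rintegral => w _; rewrite big_cons.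
have := integrable_sum measurableT s (P := xpredT) (fun i _ => fi i).
by apply: eq_integrable => // w _ /=; rewrite sumEFin.
Qed.

Lemma ae_eq_Rintegral f g : measurable_fun setT f -> measurable_fun setT g ->
  {ae P, forall w, f w = g w} -> \int[P]_w f w = \int[P]_w g w.
Proof.
move=> mf mg fg; congr fine; apply: ae_eq_integral => //.
- exact/measurable_EFinP.
- exact/measurable_EFinP.
- by apply: filterS fg => w + _ /= => ->.
Qed.

End square_integrable.

(** [kappa R j] is the moment of order 2j of the standard normal law; it is kept as an abstract
    constant, even for j = 1. *)
Definition kappa (R : realType) : nat -> R := sval (cid (normal_moment R)).

Lemma kappa_ge0 (R : realType) j : 0 <= kappa R j.
Proof. by rewrite /kappa; case: cid => k [k0 _] /=. Qed.

Lemma normal_momentE (R : realType) (s : R) j : 0 < s ->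
  (\int[normal_prob 0 s]_x (x ^+ (2 * j))%:E = (s ^+ (2 * j) * kappa R j)%:E)%E.
Proof. by rewrite /kappa; case: cid => k [_ H] /= s0; exact: H. Qed.

(** * Moments and covariances of the increments *)

Section increment_moments.
Context (R : realType) (U : completeNormedModType R) (dotU : {dot U for idfun}).
Hypothesis hilbU : induces_norm dotU.
Context (d : measure_display) (Omega : measurableType d) (P : probability Omega R).
Context (T : R) (F : R -> set (set Omega)).
Hypothesis Ffilt : filtration T F.
Context (W : R -> U -> Omega -> R).
Hypothesis Wwiener : cylindrical_wiener P T F dotU W.

Notation Fs s := (g_sigma_algebraType (F s)).
Notation incr := (incr W).
Let fmeas := filtration_measurable Ffilt.
Let imeasT := incr_measurableT Ffilt Wwiener.

(** After normalising u this is independence of the increment from F s together with the Gaussian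
    moment. The equation u = |u| e also holds for u = 0, where e = 0 is no unit vector and the two
    sides vanish separately. *)
Lemma incr_moment s t u (Z : Omega -> R) j :
  0 <= s -> s < t -> t <= T -> (0 < j)%N ->
  measurable_fun setT (Z : Fs s -> R) -> (forall w, 0 <= Z w) ->
  (\int[P]_w (Z w * incr s t u w ^+ (2 * j))%:E =
   ((t - s) ^+ j * `|u| ^+ (2 * j) * kappa R j)%:E * \int[P]_w (Z w)%:E)%E.
Proof.
move=> s0 st tT j0 mZ Z0.
have sT : s <= T by exact: le_trans (ltW st) tT.
have st' := ltW st.
have mZT : measurable_fun setT Z by exact: fmeas mZ.
have mint v : measurable_fun setT (fun w => Z w * incr s t v w ^+ (2 * j)).
  apply: measurable_funM => //.
  by apply: measurable_funX; exact: imeasT.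
have x2j0 (x : R) : 0 <= x ^+ (2 * j) by rewrite exprM exprn_ge0 // sqr_ge0.
have [e [e1 ue]] : exists e, (u != 0 -> dotU e e = 1) /\ u = `|u| *: e.
  have [->|un0] := eqVneq u 0; first by exists 0; rewrite scaler0.
  exists (`|u|^-1 *: u); split=> [_|].
    by rewrite hilbU normrZ normfV normr_id mulVf ?expr1n // normr_eq0.
  by rewrite scalerA mulfV ?scale1r // normr_eq0.
transitivity (\int[P]_w (`|u| ^+ (2 * j) * (Z w * incr s t e w ^+ (2 * j)))%:E)%E.
  apply: ge0_ae_eq_integral => //.
  - exact/measurable_EFinP.
  - by apply/measurable_EFinP; apply: measurable_funM.
  - by move=> w _; rewrite lee_fin mulr_ge0.
  - by move=> w _; rewrite lee_fin !mulr_ge0.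
  - have := incrZ Wwiener `|u| e s0 st' tT; apply: filterS => w E _ .
    by rewrite {1}ue E exprMn; congr EFin; ring.
under eq_integral do rewrite EFinM.
rewrite ge0_integralZl_EFin; last 4 first.
- by [].
- by move=> w _; rewrite lee_fin mulr_ge0.
- exact/measurable_EFinP.
- exact: x2j0.
have [u0|un0] := eqVneq u 0.
  rewrite u0 normr0 !expr0n /= muln_eq0 /= (gtn_eqF j0) /=.
  by rewrite mulr0 mul0r !mul0e.
under eq_integral do rewrite EFinM.
have ind := incr_independent Ffilt Wwiener s0 st tT (e1 un0)
  (Z := fun w => (Z w)%:E) (f := fun x => (x ^+ (2 * j))%:E).
rewrite ind //; last 2 first.
- exact/measurable_EFinP.
- by apply/measurable_EFinP; exact: exprn_measurable.
rewrite normal_momentE ?sqrtr_gt0 ?subr_gt0 //.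
rewrite [(Num.sqrt _ ^+ _)]exprM sqr_sqrtr ?subr_ge0 //.
rewrite [(\int[P]_w _ * _)%E]muleC muleA -EFinM; congr (_%:E * _)%E; ring.
Qed.

Lemma incr_sqint s t u : 0 <= s -> s <= t -> t <= T -> sqint P (incr s t u).
Proof.
move=> s0 st tT; split; first exact: imeasT.
(* [cw_increments] speaks of s < t only; for s = t the increment is 0. *)
have [st'|] := ltP s t; last first.
  move=> ts; have -> : t = s by apply/eqP; rewrite eq_le ts st.
  apply: (@eq_integrable _ _ _ _ _ measurableT (cst 0%E)) (integrable0 _ _) => //.
  by move=> w _ /=; rewrite /incr subrr expr0n.
apply/integrableP; split.
  by apply/measurable_EFinP/measurable_funX; exact: imeasT.
have := @incr_moment s t u (cst 1) 1 s0 st' tT isT (measurable_cst _) (fun=> ler01).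
rewrite muln1 (_ : (fun w => _) = fun w => (incr s t u w ^+ 2)%:E); last first.
  by apply/funext => w; rewrite mul1r.
move=> E; under eq_integral do rewrite gee0_abs ?lee_fin ?sqr_ge0 //.
have I1 : (\int[P]_w (cst (1 : R) w)%:E = 1)%E.
  by rewrite [LHS](integral_cst P measurableT 1%:E) mul1e; exact: probability_setT.
by rewrite E I1 mule1 ltry.
Qed.

(** Almost surely the increments along the b i are a linear image of those along an orthonormal
    family, and a linear map commutes with the change of sign. *)
Lemma incr_symmetric_family s t n (b : 'I_n -> U) (Phi : Fs s * n.-tuple R -> \bar R) :
  0 <= s -> s < t -> t <= T ->
  measurable_fun setT Phi -> (forall z, 0 <= Phi z)%E ->
  (\int[P]_w Phi (w, [tuple incr s t (b i) w | i < n]) =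
   \int[P]_w Phi (w, [tuple (- incr s t (b i) w)%R | i < n]))%E.
Proof.
move=> s0 st tT mPhi Phi0; have st' := ltW st.
have sT : s <= T by exact: le_trans st' tT.
have mid := filtration_id_measurable Ffilt s0 sT.
have [m [e [eo es]]] := gram_schmidt hilbU [seq b i | i <- enum 'I_n].
have bE i : b i = \sum_j dotU (e j) (b i) *: e j.
  by apply: es; apply: map_f; rewrite mem_enum.
pose lin (y : m.-tuple R) := [tuple \sum_j dotU (e j) (b i) * tnth y j | i < n].
have mlin : measurable_fun setT lin.
  apply/measurable_fun_tnthP => i.
  apply: (eq_measurable_fun (fun y : m.-tuple R => \sum_j dotU (e j) (b i) * tnth y j)).
    by move=> y _; rewrite /= tnth_mktuple.
  apply: measurable_sum => j; apply: measurable_funM => //.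
  exact: measurable_tnth.
pose Psi (z : Fs s * m.-tuple R) := Phi (z.1, lin z.2).
have mPsi : measurable_fun setT Psi.
  apply: measurableT_comp => //; apply: measurable_fun_pair => //.
  exact: measurableT_comp measurable_snd.
have mtup k (c : 'I_k -> U) : measurable_fun setT
    (fun w : Omega => (w : Fs s, [tuple incr s t (c i) w | i < k])).
  apply: measurable_fun_pair => //; apply/measurable_fun_tnthP => i.
  apply: eq_measurable_fun (imeasT (c i) s0 st' tT).
  by move=> w _; rewrite /= tnth_mktuple.
have mtupN k (c : 'I_k -> U) : measurable_fun setT
    (fun w : Omega => (w : Fs s, [tuple - incr s t (c i) w | i < k])).
  apply: measurable_fun_pair => //; apply/measurable_fun_tnthP => i.
  apply: eq_measurable_fun (measurableT_comp _ (imeasT (c i) s0 st' tT)); last first.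
    exact: oppr_measurable.
  by move=> w _; rewrite /= tnth_mktuple.
have aeb : {ae P, forall w, forall i,
    incr s t (b i) w = \sum_j dotU (e j) (b i) * incr s t (e j) w}.
  apply: ae_forall_ord => i; have := incr_linear Wwiener s0 st' tT
    (index_enum 'I_m) (fun j => dotU (e j) (b i)) e.
  by apply: filterS => w; rewrite -bE.
transitivity (\int[P]_w Psi (w, [tuple incr s t (e i) w | i < m]))%E.
  apply: ge0_ae_eq_integral => //.
  - exact: measurableT_comp mPhi (mtup _ b).
  - exact: measurableT_comp mPsi (mtup _ e).
  - by move=> w _; exact: Phi0.
  - apply: (filterS _ aeb) => w E _; rewrite /Psi /=; congr (Phi (_, _)).
    apply: eq_from_tnth => i; rewrite !tnth_mktuple E; apply: eq_bigr => j _.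
    by rewrite tnth_mktuple.
rewrite (incr_symmetric Ffilt Wwiener s0 st tT eo mPsi); last by move=> z; exact: Phi0.
apply: ge0_ae_eq_integral => //.
- exact: measurableT_comp mPsi (mtupN _ e).
- exact: measurableT_comp mPhi (mtupN _ b).
- by move=> w _; exact: Phi0.
- apply: (filterS _ aeb) => w E _; rewrite /Psi /=; congr (Phi (_, _)).
  apply: eq_from_tnth => i; rewrite !tnth_mktuple E -sumrN; apply: eq_bigr => j _.
  by rewrite tnth_mktuple mulrN.
Qed.

(** The symmetry is available for nonnegative functionals, so it is applied to the positive part of
    Z times the increment: the change of sign turns it into the negative part, and the two integrals
    agree. *)
Lemma incr_mean0 s t u (Z : Omega -> R) : 0 <= s -> s <= t -> t <= T ->
  measurable_fun setT (Z : Fs s -> R) -> sqint P Z -> \int[P]_w (Z w * incr s t u w) = 0.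
Proof.
move=> s0 st tT mZ sZ.
have [st'|ts] := ltP s t; last first.
  have -> : t = s by apply/eqP; rewrite eq_le ts st.
  under eq_Rintegral do rewrite /incr subrr mulr0.
  by rewrite Rintegral_cst // mul0r.
have iZ := sqintM sZ (incr_sqint u s0 st tT).
pose Phi (z : Fs s * 1.-tuple R) := (Num.max (Z z.1 * tnth z.2 ord0) 0)%:E.
have mPhi : measurable_fun setT Phi.
  apply/measurable_EFinP; apply: measurable_maxr => //.
  apply: measurable_funM; first exact: measurableT_comp measurable_fst.
  exact: measurableT_comp (measurable_tnth ord0) measurable_snd.
have Phi0 z : (0 <= Phi z)%E by rewrite lee_fin le_max lexx orbT.
have := incr_symmetric_family (fun=> u) s0 st' tT mPhi Phi0.
pose f w := (Z w * incr s t u w)%:E.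
have -> : (fun w => Phi (w, [tuple incr s t u w | _ < 1])) = (f^\+)%E.
  by apply/funext => w; rewrite /Phi /f tnth_mktuple funeposE EFin_max.
have -> : (fun w => Phi (w, [tuple (- incr s t u w)%R | _ < 1])) = (f^\-)%E.
  by apply/funext => w; rewrite /Phi /f tnth_mktuple funenegE mulrN EFin_max EFinN.
move=> E; rewrite /Rintegral integralE -/f E subee //.
have := integrable_neg_fin_num measurableT iZ.
by [].
Qed.

End increment_moments.

Section increment_covariance.
Context (R : realType) (U : completeNormedModType R) (dotU : {dot U for idfun}).
Hypothesis hilbU : induces_norm dotU.
Context (d : measure_display) (Omega : measurableType d) (P : probability Omega R).
Context (T : R) (F : R -> set (set Omega)).
Hypothesis Ffilt : filtration T F.
Context (W : R -> U -> Omega -> R).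
Hypothesis Wwiener : cylindrical_wiener P T F dotU W.

Notation Fs s := (g_sigma_algebraType (F s)).
Notation incr := (incr W).
Let fmeas := filtration_measurable Ffilt.
Let imeasT := incr_measurableT Ffilt Wwiener.
Let isq := incr_sqint hilbU Ffilt Wwiener.

Lemma incr_second_moment s t u (Z : Omega -> R) : 0 <= s -> s <= t -> t <= T ->
  measurable_fun setT (Z : Fs s -> R) -> (forall w, 0 <= Z w <= 1) ->
  \int[P]_w (Z w * incr s t u w ^+ 2) =
  kappa R 1 * (t - s) * `|u| ^+ 2 * \int[P]_w Z w.
Proof.
move=> s0 st tT mZ Z01.
have [st'|ts] := ltP s t; last first.
  have -> : t = s by apply/eqP; rewrite eq_le ts st.
  under eq_Rintegral do rewrite /incr subrr expr0n mulr0.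
  by rewrite Rintegral_cst // subrr !(mulr0, mul0r).
have Z0 w : 0 <= Z w by have /andP[] := Z01 w.
have sT : s <= T by exact: le_trans tT.
have iZ : P.-integrable setT (EFin \o Z).
  apply: (@le_integrable _ _ _ P _ measurableT _ (cst 1%E)).
  - by apply/measurable_EFinP; exact: fmeas mZ.
  - by move=> w _ /=; rewrite lee_fin normr1 ger0_norm //; have /andP[] := Z01 w.
  - exact: finite_measure_integrable_cst.
rewrite /Rintegral.
have := incr_moment hilbU Ffilt Wwiener u s0 st' tT (isT : (0 < 1)%N) mZ Z0.
rewrite muln1 => ->.
rewrite fineM //; last exact: (integrable_fin_num measurableT iZ).
by rewrite /= expr1; ring.
Qed.

(** Polarisation: the second moments along u + v, u and v are known and the increment is additive
    almost surely. *)
Lemma incr_cov s t u v (Z : Omega -> R) : 0 <= s -> s <= t -> t <= T ->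
  measurable_fun setT (Z : Fs s -> R) -> (forall w, 0 <= Z w <= 1) ->
  \int[P]_w (Z w * (incr s t u w * incr s t v w)) =
  kappa R 1 * (t - s) * dotU u v * \int[P]_w Z w.
Proof.
move=> s0 st tT mZ Z01; have sT : s <= T by exact: le_trans tT.
have mZT : measurable_fun setT Z by exact: fmeas mZ.
have Zi x y : P.-integrable setT (EFin \o (fun w => Z w * (incr s t x w * incr s t y w))).
  have := sqintM (sqint_bounded mZT Z01 (isq x s0 st tT)) (isq y s0 st tT).
  by apply: eq_integrable => // w _ /=; rewrite mulrA.
have H := incr_second_moment (u + v) s0 st tT mZ Z01.
have E : \int[P]_w (Z w * incr s t (u + v) w ^+ 2) =
  \int[P]_w (Z w * incr s t u w ^+ 2) + (\int[P]_w (Z w * (incr s t u w * incr s t v w))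
  + (\int[P]_w (Z w * (incr s t u w * incr s t v w)) +
     \int[P]_w (Z w * incr s t v w ^+ 2))).
  under [X in _ = X + _]eq_Rintegral do rewrite expr2.
  under [X in _ = _ + (_ + (_ + X))]eq_Rintegral do rewrite expr2.
  have i1 := integrableD measurableT (Zi u v) (Zi v v).
  have i2 := integrableD measurableT (Zi u v) i1.
  rewrite -(RintegralD measurableT (Zi u v) (Zi v v)).
  rewrite -(RintegralD measurableT (Zi u v) i1) -(RintegralD measurableT (Zi u u) i2).
  apply: ae_eq_Rintegral.
  - by apply: measurable_funM => //; apply: measurable_funX; exact: imeasT.
  - have mi x : measurable_fun setT (incr s t x) by exact: imeasT.
    have mp x y : measurable_fun setT (fun w => Z w * (incr s t x w * incr s t y w)).
      by apply: measurable_funM => //; apply: measurable_funM.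
    apply: measurable_funD; first exact: mp.
    by apply: measurable_funD; [exact: mp|apply: measurable_funD; exact: mp].
  - have := incrD Wwiener u v s0 st tT; apply: filterS => w ->; ring.
move: H; rewrite E !incr_second_moment // -(hilbU (u + v)) dotDl !dotDr !hilbU (dotC dotU v u).
by move=> H; lra.
Qed.

(** Increments are cut at the later left and at the earlier right endpoint. Only the pieces over the
    common interval are correlated; any other piece lies before or after its partner and drops out
    by the vanishing conditional mean. *)
Lemma incr_pair l r l' r' u u' (g g' : Omega -> R) :
  0 <= l -> l <= r -> r <= T -> 0 <= l' -> l' <= r' -> r' <= T ->
  measurable_fun setT (g : Fs l -> R) -> (forall w, 0 <= g w <= 1) ->
  measurable_fun setT (g' : Fs l' -> R) -> (forall w, 0 <= g' w <= 1) ->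
  \int[P]_w (g w * incr l r u w * (g' w * incr l' r' u' w)) =
  kappa R 1 * Num.max 0 (Num.min r r' - Num.max l l') * dotU u u' *
  \int[P]_w (g w * g' w).
Proof.
(* Common left endpoint: the longer increment is cut at r0, and what follows r0 has mean zero given
   F r0. *)
have same l0 r0 r0' v v' (f f' : Omega -> R) : 0 <= l0 -> l0 <= r0 -> r0 <= r0' -> r0' <= T ->
    measurable_fun setT (f : Fs l0 -> R) -> (forall w, 0 <= f w <= 1) ->
    measurable_fun setT (f' : Fs l0 -> R) -> (forall w, 0 <= f' w <= 1) ->
    \int[P]_w (f w * incr l0 r0 v w * (f' w * incr l0 r0' v' w)) =
    kappa R 1 * (r0 - l0) * dotU v v' * \int[P]_w (f w * f' w).
  move=> l00 lr rr' r'T mf f01 mf' f'01.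
  have rT : r0 <= T by exact: le_trans r'T.
  have lT : l0 <= T by exact: le_trans rT.
  have r00 : 0 <= r0 by exact: le_trans lr.
  have mff : measurable_fun setT ((fun w => f w * f' w) : Fs l0 -> R).
    exact: measurable_funM.
  have ff01 w : 0 <= f w * f' w <= 1.
    have /andP[a b] := f01 w; have /andP[a' b'] := f'01 w.
    by rewrite mulr_ge0 //= mulr_ile1.
  have mffT : measurable_fun setT (fun w => f w * f' w) by exact: fmeas mff.
  have sq := sqint_bounded mffT ff01 (isq v l00 lr rT).
  rewrite -(incr_cov v v' l00 lr rT mff ff01).
  have i1 := sqintM sq (isq v' l00 lr rT).
  have i2 := sqintM sq (isq v' r00 rr' r'T).
  transitivity (\int[P]_w (f w * f' w * incr l0 r0 v w * incr l0 r0 v' w) +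
    \int[P]_w (f w * f' w * incr l0 r0 v w * incr r0 r0' v' w)).
    rewrite -RintegralD //; apply: eq_Rintegral => w _.
    by rewrite /incr; ring.
  rewrite [X in _ + X](_ : _ = 0) ?addr0.
    by apply: eq_Rintegral => w _; rewrite mulrA.
  apply: (incr_mean0 hilbU Ffilt Wwiener) => //.
  apply: measurable_funM; last exact: (incr_measurable Ffilt Wwiener).
  exact: (filtration_measurable_le Ffilt l00 lr rT).
(* Ordered left endpoints: the part of the first increment before l0' is known at time l0', and the
   rest starts at l0' like the second increment. *)
have ord l0 r0 l0' r0' v v' (f f' : Omega -> R) :
    0 <= l0 -> l0 <= r0 -> r0 <= T -> l0' <= r0' -> r0' <= T -> l0 <= l0' ->
    measurable_fun setT (f : Fs l0 -> R) -> (forall w, 0 <= f w <= 1) ->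
    measurable_fun setT (f' : Fs l0' -> R) -> (forall w, 0 <= f' w <= 1) ->
    \int[P]_w (f w * incr l0 r0 v w * (f' w * incr l0' r0' v' w)) =
    kappa R 1 * Num.max 0 (Num.min r0 r0' - l0') * dotU v v' * \int[P]_w (f w * f' w).
  move=> l00 lr rT l'r' r'T ll' mf f01 mf' f'01.
  have l'0 : 0 <= l0' by exact: le_trans ll'.
  have l'T : l0' <= T by exact: le_trans r'T.
  have mf1 : measurable_fun setT (f : Fs l0' -> R).
    exact: (filtration_measurable_le Ffilt l00 ll' l'T).
  have mff : measurable_fun setT ((fun w => f w * f' w) : Fs l0' -> R).
    exact: measurable_funM.
  have ff01 w : 0 <= f w * f' w <= 1.
    have /andP[a b] := f01 w; have /andP[a' b'] := f'01 w.
    by rewrite mulr_ge0 //= mulr_ile1.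
  have mffT : measurable_fun setT (fun w => f w * f' w) by exact: fmeas mff.
  have zero q : l0 <= q -> q <= l0' ->
      \int[P]_w (f w * f' w * incr l0 q v w * incr l0' r0' v' w) = 0.
    move=> lq ql'; have qT : q <= T by exact: le_trans l'T.
    apply: (incr_mean0 hilbU Ffilt Wwiener) => //.
      apply: measurable_funM => //.
      apply: (filtration_measurable_le Ffilt _ ql' l'T); first exact: le_trans lq.
      exact: (incr_measurable Ffilt Wwiener).
    exact: sqint_bounded mffT ff01 (isq v l00 lq qT).
  have [rl'|l'r] := leP r0 l0'.
    rewrite (_ : Num.max 0 _ = 0); last first.
      by apply/max_idPl; rewrite subr_le0 ge_min rl'.
    rewrite mulr0 !mul0r -[RHS](zero r0) //; apply: eq_Rintegral => w _; ring.
  have sq q1 q2 : 0 <= q1 -> q1 <= q2 -> q2 <= T -> sqint P (fun w => f w * f' w * incr q1 q2 v w).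
    by move=> q10 q12 q2T; exact: sqint_bounded mffT ff01 (isq v q10 q12 q2T).
  have i1 := sqintM (sq l0 l0' l00 ll' l'T) (isq v' l'0 l'r' r'T).
  have i2 := sqintM (sq l0' r0 l'0 (ltW l'r) rT) (isq v' l'0 l'r' r'T).
  transitivity (\int[P]_w (f w * f' w * incr l0 l0' v w * incr l0' r0' v' w) +
    \int[P]_w (f w * f' w * incr l0' r0 v w * incr l0' r0' v' w)).
    rewrite -RintegralD //; apply: eq_Rintegral => w _.
    by rewrite /incr; ring.
  rewrite zero // add0r.
  have [rr'|r'r] := leP r0 r0'.
    rewrite max_r ?subr_ge0 ?(ltW l'r) //.
    rewrite -(same l0' r0 r0' v v' f f') ?(ltW l'r) //.
    by apply: eq_Rintegral => w _; ring.
  rewrite max_r ?subr_ge0 // (dotC dotU v v').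
  under [in RHS]eq_Rintegral do rewrite mulrC.
  rewrite -(same l0' r0' r0 v' v f' f) ?(ltW r'r) //.
  by apply: eq_Rintegral => w _; ring.
move=> l0 lr rT l'0 l'r' r'T mg g01 mg' g'01.
have [ll'|l'l] := leP l l'; first exact: ord.
rewrite minC dotC; under [in RHS]eq_Rintegral do rewrite mulrC.
rewrite -(ord l' r' l r u' u g' g) ?(ltW l'l) //.
by apply: eq_Rintegral => w _; ring.
Qed.

End increment_covariance.

(** * The Ito isometry and uniqueness of the Ito integral *)

Section interval_overlap.
Context (R : realType).

(** The length of the intersection of ]l, r] and ]l', r']. *)
Definition overlap (l r l' r' : R) : R := Num.max 0 (Num.min r r' - Num.max l l').

Lemma integral_overlap (a b l r l' r' : R) : a <= l -> r <= b -> a <= l' -> r' <= b ->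
  (\int[lebesgue_measure]_(s in `[a, b]) (\1_`]l, r] s * \1_`]l', r'] s : R)%:E =
   (overlap l r l' r')%:E)%E.
Proof.
move=> al rb al' rb'.
transitivity (\int[lebesgue_measure]_(s in `[a, b]) (\1_(`]l, r] `&` `]l', r']) s : R)%:E)%E.
  by apply: eq_integral => s _; rewrite indicI.
rewrite integral_indic //; last exact: measurableI.
have -> : `]l, r] `&` `]l', r'] `&` `[a, b] = `]Num.max l l', Num.min r r']%classic.
  apply/seteqP; split=> s /=; rewrite !in_itv /= ?gt_max ?le_min.
    by move=> [[/andP[-> ->] /andP[-> ->]] _].
  move=> /andP[/andP[ls l's] /andP[sr sr']]; split.
    by rewrite ls l's sr sr'.
  by rewrite (ltW (le_lt_trans al ls)) (le_trans sr rb).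
rewrite /= lebesgue_measure_itv /= lte_fin /overlap; case: ltP => H.
  by rewrite -EFinD [Num.max 0 _]max_r // subr_ge0 ltW.
by rewrite [Num.max 0 _]max_l // subr_le0.
Qed.

Lemma overlap_indic_integrable (a b l r l' r' : R) (c : R) :
  (@lebesgue_measure R).-integrable `[a, b]
    (EFin \o (fun s => c * (\1_`]l, r] s * \1_`]l', r'] s))).
Proof.
apply: (@le_integrable _ _ _ lebesgue_measure _ _ _ (cst `|c|%:E)) => //.
- apply/measurable_EFinP; apply: measurable_funM => //; apply: measurable_funM => //.
- move=> s _ /=; rewrite lee_fin normr_id normrM ler_piMr //.
  rewrite !indicE; case: (_ \in _); case: (_ \in _);
    by rewrite ?(mulr0, mul0r, mul1r) ?normr0 ?normr1.
- apply/integrableP; split; first exact: measurable_cst.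
  rewrite integral_cst //= lebesgue_measure_itv /=.
  by case: ifP => _; rewrite ?mule0 ?ltry // -EFinD -EFinM ltry.
Qed.

End interval_overlap.

Section isometry.
Context (R : realType) (U H : completeNormedModType R).
Context (dotU : {dot U for idfun}) (dotH : {dot H for idfun}).
Hypotheses (hilbU : induces_norm dotU) (hilbH : induces_norm dotH).
Context (d : measure_display) (Omega : measurableType d) (P : probability Omega R).
Context (T : R) (F : R -> set (set Omega)).
Hypothesis Ffilt : filtration T F.
Context (W : R -> U -> Omega -> R).
Hypothesis Wwiener : cylindrical_wiener P T F dotU W.
Context (basU : set U).
Hypothesis onbU : orthonormal_basis dotU basU.

Notation Fs s := (g_sigma_algebraType (F s)).
Notation incr := (incr W).

(* Elementary integrands with a random coefficient in [0, 1] in place of the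
   indicator of an event. *)
Record rand_term := RandTerm {
  rt_left : R ; rt_right : R ; rt_coef : Omega -> R ; rt_in : U ; rt_out : H }.

Definition rand_admissible (a b : R) (z : rand_term) : Prop :=
  [/\ a <= rt_left z, rt_left z <= rt_right z, rt_right z <= b,
      measurable_fun setT (rt_coef z : Fs (rt_left z) -> R) &
      forall w, 0 <= rt_coef z w <= 1].

Context (I : finType) (zs : I -> rand_term).

(** Families indexed by a finite type are used because the difference of two of them is then indexed
    by a sum type. *)
Definition rand_integrand (s : R) (w : Omega) (y : U) : H :=
  \sum_i (\1_`]rt_left (zs i), rt_right (zs i)] s * rt_coef (zs i) w *
           dotU (rt_in (zs i)) y) *: rt_out (zs i).

Definition rand_integral (w : Omega) : H :=
  \sum_i (rt_coef (zs i) w *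
     incr (rt_left (zs i)) (rt_right (zs i)) (rt_in (zs i)) w) *: rt_out (zs i).

(** Both sides become double sums over pairs of terms: the left one by the covariances of
    increments, the right one by Parseval and the lengths of overlaps. The majorant h is compared on
    ]a, b] only, because the terms vanish at s = a whereas the integrands of interest need not. *)
Lemma rand_isometry (a b : R) (h : R -> Omega -> \bar R) :
  0 <= a -> b <= T -> (forall i, rand_admissible a b (zs i)) ->
  (forall s w, s \in `[a, b] -> (0 <= h s w)%E) ->
  (forall s w, s \in `]a, b] ->
     (hs_norm2 basU (@Num.norm R H) (rand_integrand s w) <= h s w)%E) ->
  (\int[P]_w (`|rand_integral w| ^+ 2)%:E <=
   (kappa R 1)%:E * \int[P]_w \int[lebesgue_measure]_(s in `[a, b]) h s w)%E.
Proof.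
move=> a0 bT adm h0 hsh.
pose l i := rt_left (zs i); pose r i := rt_right (zs i).
pose g i := rt_coef (zs i); pose u i := rt_in (zs i); pose x i := rt_out (zs i).
have l0 i : 0 <= l i by have [al _ _ _ _] := adm i; exact: le_trans al.
have lr i : l i <= r i by have [_ lr _ _ _] := adm i.
have rT i : r i <= T by have [_ _ rb _ _] := adm i; exact: le_trans rb bT.
have al i : a <= l i by have [] := adm i.
have rb i : r i <= b by have [] := adm i.
have mg i : measurable_fun setT (g i : Fs (l i) -> R) by have [] := adm i.
have g01 i w : 0 <= g i w <= 1 by have [_ _ _ _] := adm i; apply.
have mgT i : measurable_fun setT (g i).
  exact: (filtration_measurable Ffilt (l0 i) (le_trans (lr i) (rT i)) (mg i)).
have sq i : sqint P (fun w => g i w * incr (l i) (r i) (u i) w).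
  apply: (sqint_bounded (mgT i) (g01 i)).
  exact: (incr_sqint hilbU Ffilt Wwiener).
have sqg i : sqint P (g i).
  have -> : g i = (fun w => g i w * 1) by apply/funext => w; rewrite mulr1.
  apply: (sqint_bounded (mgT i) (g01 i)); split; first exact: measurable_cst.
  apply: (@eq_integrable _ _ _ _ _ measurableT (cst 1%E)).
    by move=> w _ /=; rewrite expr1n.
  exact: finite_measure_integrable_cst.
pose q i j := dotU (u i) (u j) * dotH (x i) (x j).
pose ov i j := overlap (l i) (r i) (l j) (r j).
pose Q := \sum_i \sum_j ov i j * q i j * \int[P]_w (g i w * g j w).
have LHS_E : (\int[P]_w (`|rand_integral w| ^+ 2)%:E = (kappa R 1 * Q)%:E)%E.
  have normE w : `|rand_integral w| ^+ 2 = \sum_i \sum_j dotH (x i) (x j) *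
      (g i w * incr (l i) (r i) (u i) w * (g j w * incr (l j) (r j) (u j) w)).
    rewrite -hilbH dot_suml; apply: eq_bigr => i _; rewrite dot_sumr.
    by apply: eq_bigr => j _; rewrite dotZl dotZr mulrA [LHS]mulrC.
  have ij i j : P.-integrable setT (EFin \o (fun w => dotH (x i) (x j) *
      (g i w * incr (l i) (r i) (u i) w * (g j w * incr (l j) (r j) (u j) w)))).
    have := integrableZl measurableT (dotH (x i) (x j)) (sqintM (sq i) (sq j)).
    by apply: eq_integrable => // w _ /=; rewrite -EFinM.
  have si i : P.-integrable setT (EFin \o (fun w => \sum_j dotH (x i) (x j) *
      (g i w * incr (l i) (r i) (u i) w * (g j w * incr (l j) (r j) (u j) w)))).
    have := integrable_sum measurableT (index_enum I) (P := xpredT) (fun j _ => ij i j).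
    by apply: eq_integrable => // w _ /=; rewrite sumEFin.
  have sii : P.-integrable setT (EFin \o (fun w => `|rand_integral w| ^+ 2)).
    have := integrable_sum measurableT (index_enum I) (P := xpredT) (fun i _ => si i).
    by apply: eq_integrable => // w _ /=; rewrite normE sumEFin.
  rewrite -(fineK (integrable_fin_num measurableT sii)); congr EFin.
  change (\int[P]_w (`|rand_integral w| ^+ 2) = kappa R 1 * Q).
  under eq_Rintegral do rewrite normE.
  rewrite Rintegral_sum // mulr_sumr; apply: eq_bigr => i _.
  rewrite Rintegral_sum // mulr_sumr; apply: eq_bigr => j _.
  rewrite RintegralZl //; last exact: sqintM.
  rewrite (incr_pair hilbU Ffilt Wwiener) // /ov /overlap /q; ring.
rewrite LHS_E EFinM; apply: lee_wpmul2l; first by rewrite lee_fin kappa_ge0.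
(* Q is turned into the iterated integral of the double sum [G], with the lengths of overlaps
   written as time integrals. [G] is then compared with h pointwise, as h may fail to be
   measurable. *)
pose G1 w := \sum_i \sum_j ov i j * q i j * (g i w * g j w).
have QE : (Q%:E = \int[P]_w (G1 w)%:E)%E.
  have ij i j : P.-integrable setT (EFin \o (fun w => ov i j * q i j * (g i w * g j w))).
    have := integrableZl measurableT (ov i j * q i j) (sqintM (sqg i) (sqg j)).
    by apply: eq_integrable => // w _ /=; rewrite -EFinM.
  have si i : P.-integrable setT (EFin \o (fun w => \sum_j ov i j * q i j * (g i w * g j w))).
    have := integrable_sum measurableT (index_enum I) (P := xpredT) (fun j _ => ij i j).
    by apply: eq_integrable => // w _ /=; rewrite sumEFin.
  have sii : P.-integrable setT (EFin \o G1).
    have := integrable_sum measurableT (index_enum I) (P := xpredT) (fun i _ => si i).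
    by apply: eq_integrable => // w _ /=; rewrite sumEFin.
  rewrite -(fineK (integrable_fin_num measurableT sii)); congr EFin.
  change (Q = \int[P]_w G1 w); rewrite /G1.
  rewrite Rintegral_sum //; apply: eq_bigr => i _.
  rewrite Rintegral_sum //; apply: eq_bigr => j _.
  by rewrite RintegralZl //; exact: sqintM.
rewrite QE; apply: le_lower_integral => [w _|w _].
  by apply: integral_ge0 => s sab; exact: h0.
pose G s w := \sum_i \sum_j (q i j * (g i w * g j w)) *
  (\1_`]l i, r i] s * \1_`]l j, r j] s).
have -> : ((G1 w)%:E = \int[lebesgue_measure]_(s in `[a, b]) (G s w)%:E)%E.
  have ij i j := @overlap_indic_integrable R a b (l i) (r i) (l j) (r j) (q i j * (g i w * g j w)).
  have si i : (@lebesgue_measure R).-integrable `[a, b] (EFin \o (fun s => \sum_j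
      (q i j * (g i w * g j w)) * (\1_`]l i, r i] s * \1_`]l j, r j] s))).
    have := integrable_sum _ (index_enum I) (P := xpredT) (fun j _ => ij i j).
    by move=> /(_ (measurable_itv _)); apply: eq_integrable => // s _ /=; rewrite sumEFin.
  rewrite /G; under eq_integral do rewrite -sumEFin.
  rewrite integral_sum // /G1 -sumEFin; apply: eq_bigr => i _.
  under eq_integral do rewrite -sumEFin.
  rewrite integral_sum //; last by move=> k; exact: ij.
  rewrite -sumEFin; apply: eq_bigr => j _.
  under eq_integral do rewrite EFinM.
  rewrite integralZl //; last first.
    have := @overlap_indic_integrable R a b (l i) (r i) (l j) (r j) 1.
    by apply: eq_integrable => // s _ /=; rewrite mul1r.
  rewrite integral_overlap // -EFinM /ov; congr EFin; ring.
apply: le_lower_integral => [s sab|s]; first exact: h0.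
(* At s = a all half-open intervals are missed and [G] is 0. *)
rewrite /= in_itv /= => /andP[as_ sb]; have [sa|/eqP sa] := eqVneq s a.
  rewrite (_ : G s w = 0) ?h0 //; first by rewrite in_itv /= as_.
  rewrite /G big1 // => i _; rewrite big1 // => j _.
  rewrite [\1__ s]indicE memNset ?mul0r ?mulr0 //= in_itv /= sa ltNge al //.
have sab : s \in `]a, b].
  by rewrite in_itv /= sb andbT lt_neqAle as_ andbT eq_sym; apply/eqP.
apply: le_trans (hsh s w sab).
apply: le_trans (parseval_ge hilbU hilbH onbU (index_enum I)
  (fun i => \1_`]l i, r i] s * g i w) u x).
rewrite lee_fin le_eqVlt; apply/orP; left; apply/eqP.
apply: eq_bigr => i _; apply: eq_bigr => j _; rewrite /q; ring.
Qed.

End isometry.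

Section ito_uniqueness.
Context (R : realType) (U H : completeNormedModType R).
Context (dotU : {dot U for idfun}) (dotH : {dot H for idfun}).
Hypotheses (hilbU : induces_norm dotU) (hilbH : induces_norm dotH).
Context (d : measure_display) (Omega : measurableType d) (P : probability Omega R).
Context (T : R) (F : R -> set (set Omega)).
Hypothesis Ffilt : filtration T F.
Context (W : R -> U -> Omega -> R).
Hypothesis Wwiener : cylindrical_wiener P T F dotU W.
Context (basU : set U).
Hypothesis onbU : orthonormal_basis dotU basU.

Notation Fs s := (g_sigma_algebraType (F s)).

Lemma borel_measurable_comp (X : Omega -> H) (phi : H -> R) :
  borel_measurable measurable X -> continuous phi -> measurable_fun setT (phi \o X).
Proof.
move=> mX cphi; apply: (@measurability _ _ _ _ _ _ (@RGenOInfty.G R)).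
  exact: RGenOInfty.measurableE.
move=> _ [_ [x ->] <-]; rewrite setTI comp_preimage; apply: mX.
apply: sub_sigma_algebra; apply: open_comp; first by move=> y _; exact: cphi.
by apply: interval_open.
Qed.

(** H carries no measurable structure, so the squared norm is expanded into products of real
    functions, each a continuous image of X or a coefficient. *)
Lemma norm_sub_rand_measurable (a b : R) (X : Omega -> H) (I : finType)
    (zs : I -> rand_term U H Omega) :
  0 <= a -> b <= T ->
  borel_measurable measurable X -> (forall i, rand_admissible F a b (zs i)) ->
  measurable_fun setT (fun w => `|rand_integral W zs w - X w| ^+ 2).
Proof.
move=> a0 bT mX adm.
pose c i w := rt_coef (zs i) w * incr W (rt_left (zs i)) (rt_right (zs i)) (rt_in (zs i)) w.
have mc i : measurable_fun setT (c i).
  have [al lr rb mg _] := adm i.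
  have l0 : 0 <= rt_left (zs i) by exact: le_trans al.
  have rT : rt_right (zs i) <= T by exact: le_trans bT.
  apply: measurable_funM; last exact: (incr_measurableT Ffilt Wwiener).
  exact: (filtration_measurable Ffilt l0 (le_trans lr rT) mg).
have -> : (fun w => `|rand_integral W zs w - X w| ^+ 2) = (fun w =>
    \sum_i \sum_j c i w * (c j w * dotH (rt_out (zs i)) (rt_out (zs j)))
    - 2 * (\sum_i c i w * dotH (rt_out (zs i)) (X w)) + `|X w| ^+ 2).
  apply/funext => w; rewrite (normB_sqr hilbH) -hilbH !dot_suml; congr (_ - 2 * _ + _).
    apply: eq_bigr => i _; rewrite dot_sumr; apply: eq_bigr => j _.
    by rewrite dotZl dotZr.
  by apply: eq_bigr => i _; rewrite dotZl.
apply: measurable_funD; first apply: measurable_funB.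
- apply: measurable_sum => i; apply: measurable_sum => j.
  by apply: measurable_funM => //; apply: measurable_funM.
- apply: measurable_funM => //; apply: measurable_sum => i.
  apply: measurable_funM => //.
  exact: (borel_measurable_comp mX (@dot_continuous _ _ _ hilbH (rt_out (zs i)))).
- apply: measurable_funX.
  exact: (borel_measurable_comp mX (@norm_continuous _ _)).
Qed.

Definition rand_of_elem (z : @elem_term d Omega R U H) : rand_term U H Omega :=
  RandTerm (et_left z) (et_right z) (\1_(et_event z)) (et_in z) (et_out z).

Definition rand_opp (z : rand_term U H Omega) : rand_term U H Omega :=
  RandTerm (rt_left z) (rt_right z) (rt_coef z) (rt_in z) (- rt_out z).

(** Approximant minus candidate is again a family of random terms, so the isometry bounds its second
    moment by the distance of the integrands, which tends to 0. The approximants thus converge in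
    L^2 to X and to the candidate. *)
Lemma ito_unique (a b : R) (Y : R -> Omega -> U -> H) (X : Omega -> H)
    (J : finType) (cs : J -> rand_term U H Omega) :
  0 <= a -> b <= T -> is_ito_integral P F dotU dotH basU W a b Y X ->
  (forall j, rand_admissible F a b (cs j)) ->
  (forall s w y, s \in `]a, b] -> Y s w y = rand_integrand dotU cs s w y) ->
  {ae P, forall w, X w = rand_integral W cs w}.
Proof.
move=> a0 bT [_ _ mX [zs [adm Ycvg Xcvg]]] cadm YE.
pose es n (i : 'I_(size (zs n))) := rand_of_elem (tnth (in_tuple (zs n)) i).
pose tm n (i : 'I_(size (zs n)) + J) : rand_term U H Omega :=
  match i with inl i => @es n i | inr j => rand_opp (cs j) end.
have esadm n i : rand_admissible F a b (@es n i).
  have : elem_admissible F a b (tnth (in_tuple (zs n)) i).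
    by apply/asboolP; exact: (elimT all_tnthP (adm n : all _ (in_tuple (zs n)))).
  move=> [al lr rb FA]; split => //=.
    have l0 := le_trans a0 al; have lT := le_trans lr (le_trans rb bT).
    have mA : measurable (et_event (tnth (in_tuple (zs n)) i) : set (Fs (et_left (tnth (in_tuple (zs n)) i)))).
      by rewrite (filtration_measurableE Ffilt).
    exact: measurable_indic.
  by move=> w; rewrite indicE; case: (_ \in _); rewrite /= ?ler01 ?lexx.
have tmadm n i : rand_admissible F a b (@tm n i).
  case: i => [i|j] /=; first exact: esadm.
  by have [] := cadm j.
have esE n w : elem_integral W (zs n) w = rand_integral W (@es n) w.
  by rewrite /elem_integral big_tnth.
have tmE n w : rand_integral W (@tm n) w = rand_integral W (@es n) w - rand_integral W cs w.
  rewrite /rand_integral big_sumType /=; congr (_ + _).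
  by rewrite -sumrN; apply: eq_bigr => j _; rewrite scalerN.
pose eps n := (\int[P]_w \int[lebesgue_measure]_(s in `[a, b])
             hs_norm2 basU (@Num.norm R H)
               (fun y => elem_integrand dotU (zs n) s w y - Y s w y)%R)%E.
pose dlt n := (\int[P]_w (`|elem_integral W (zs n) w - X w| ^+ 2)%:E)%E.
have iso n : (\int[P]_w (`|rand_integral W (@tm n) w| ^+ 2)%:E <= (kappa R 1)%:E * eps n)%E.
  apply: (rand_isometry hilbU hilbH Ffilt Wwiener onbU) => //.
    by move=> s w _; apply: esum_ge0 => u _; rewrite lee_fin sqr_ge0.
  move=> s w sab; rewrite le_eqVlt; apply/orP; left; apply/eqP.
  congr (hs_norm2 _ _ _); apply/funext => y; rewrite YE //.
  rewrite /rand_integrand big_sumType /elem_integrand [in RHS]big_tnth; congr (_ + _).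
  by rewrite -sumrN; apply: eq_bigr => j _; rewrite scalerN.
pose V := (\int[P]_w (`|rand_integral W cs w - X w| ^+ 2)%:E)%E.
have mV : measurable_fun setT (fun w => `|rand_integral W cs w - X w| ^+ 2).
  exact: norm_sub_rand_measurable a0 bT mX cadm.
have V0 : (0 <= V)%E by apply: integral_ge0 => w _; rewrite lee_fin sqr_ge0.
(* V does not depend on n while the right side tends to 0; the factors 2 come from (y + z)^2 <= 2
   y^2 + 2 z^2. *)
have Vle n : (V <= 2%:E * dlt n + 2%:E * ((kappa R 1)%:E * eps n))%E.
  have mdlt : measurable_fun setT (fun w => `|elem_integral W (zs n) w - X w| ^+ 2).
    under eq_fun do rewrite esE.
    exact: norm_sub_rand_measurable a0 bT mX (esadm n).
  have mtm : measurable_fun setT (fun w => `|rand_integral W (@tm n) w| ^+ 2).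
    have m0 : borel_measurable measurable (cst 0 : Omega -> H).
      by move=> C _; rewrite preimage_cst; case: ifP.
    have := norm_sub_rand_measurable a0 bT m0 (tmadm n).
    by under eq_fun do rewrite subr0.
  apply: (@le_trans _ _ (2%:E * dlt n + 2%:E * (\int[P]_w (`|rand_integral W (@tm n) w| ^+ 2)%:E))%E); last first.
    by rewrite leeD2l // lee_wpmul2l.
  have sq0 (x : R) : 0 <= x ^+ 2 by exact: sqr_ge0.
  have pull (f : Omega -> R) : measurable_fun setT (fun w => f w ^+ 2) ->
      (2%:E * \int[P]_w (f w ^+ 2)%:E = \int[P]_w (2 * f w ^+ 2)%:E)%E.
    move=> mf; rewrite -ge0_integralZl_EFin; [by []|by []|
      by move=> w _; rewrite lee_fin|exact/measurable_EFinP|by []].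
  rewrite /dlt (pull _ mdlt) (pull _ mtm) -ge0_integralD //; last 2 first.
  - by apply/measurable_EFinP; apply: measurable_funM.
  - by apply/measurable_EFinP; apply: measurable_funM.
  apply: ge0_le_integral => //.
  - exact/measurable_EFinP.
  - apply: emeasurable_funD; apply/measurable_EFinP; exact: measurable_funM.
  move=> w _; rewrite -EFinD lee_fin tmE -esE.
  set e := elem_integral W (zs n) w; set c := rand_integral W cs w.
  have : `|c - X w| <= `|e - X w| + `|e - c|.
    by rewrite [leRHS]addrC (distrC e c); exact: ler_distD.
  have := normr_ge0 (c - X w); have := normr_ge0 (e - X w); have := normr_ge0 (e - c).
  set x := `|c - X w|; set y := `|e - X w|; set z := `|e - c| => z0 y0 x0 xyz.
  apply: (@le_trans _ _ ((y + z) ^+ 2)); first by rewrite lerXn2r ?nnegrE // addr_ge0.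
  have := sqr_ge0 (y - z); rewrite sqrrB sqrrD; lra.
have Vcvg : (fun n => 2%:E * dlt n + 2%:E * ((kappa R 1)%:E * eps n))%E @ \oo --> 0%E.
  have c1 := cvgeZl (isT : 2%:E \is a fin_num) Xcvg.
  have c2 := cvgeZl (isT : 2%:E \is a fin_num) (cvgeZl (isT : (kappa R 1)%:E \is a fin_num) Ycvg).
  have := cvgeD _ c1 c2; rewrite !mule0 adde0; apply.
  by [].
have VE : V = 0%E.
  apply/eqP; rewrite eq_le V0 andbT -(cvg_lim (@ereal_hausdorff R) Vcvg).
  apply: lime_ge; first by apply/cvg_ex; exists 0%E.
  exact: nearW.
have : ae_eq P setT (EFin \o (fun w => `|rand_integral W cs w - X w| ^+ 2)) (cst 0%E).
  apply/ae_eq_integral_abs => //; first exact/measurable_EFinP.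
  rewrite -[RHS]VE; apply: eq_integral => w _ /=.
  by rewrite ger0_norm ?sqr_ge0.
apply: filterS => w /(_ I) /= [] /eqP.
by rewrite sqrf_eq0 normr_eq0 subr_eq0 => /eqP ->.
Qed.

End ito_uniqueness.

(** * The one-step moment estimate *)

Section power_inequalities.
Context (R : realType).
Implicit Types a b y p r e : R.

Lemma exprD_le2 a b m : 0 <= a -> 0 <= b ->
  (a + b) ^+ m <= 2 ^+ m * (a ^+ m + b ^+ m).
Proof.
move=> a0 b0; have [ab|/ltW ba] := leP a b.
  apply: (@le_trans _ _ ((2 * b) ^+ m)).
    by rewrite lerXn2r ?nnegrE ?addr_ge0 ?mulr_ge0 //; lra.
  by rewrite exprMn ler_wpM2l ?exprn_ge0 // lerDr exprn_ge0.
apply: (@le_trans _ _ ((2 * a) ^+ m)).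
  by rewrite lerXn2r ?nnegrE ?addr_ge0 ?mulr_ge0 //; lra.
by rewrite exprMn ler_wpM2l ?exprn_ge0 // lerDl exprn_ge0.
Qed.

(** The mean value bound for the power m + 1, with the derivative taken at the larger point a +
    b. *)
Lemma exprD_le_tangent a b m : 0 <= a -> 0 <= b ->
  (a + b) ^+ m.+1 <= a ^+ m.+1 + m.+1%:R * (b * (a + b) ^+ m).
Proof.
move=> a0 b0; have A0 : 0 <= a + b by rewrite addr_ge0.
elim: m => [|m IH]; first by rewrite !expr1 expr0 mulr1 mul1r.
rewrite exprS; apply: (le_trans (ler_wpM2l A0 IH)).
have aA : a ^+ m.+1 <= (a + b) ^+ m.+1 by rewrite lerXn2r ?nnegrE // lerDl.
have := ler_wpM2l b0 aA.
rewrite (exprS a m.+1) (exprS (a + b) m).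
set X := (a + b) ^+ m; set Y := a ^+ m.+1; set N := (m.+1)%:R.
rewrite -(natr1 m.+1) -/N => H.
have -> : (a + b) * (Y + N * (b * X)) = a * Y + b * Y + N * (b * ((a + b) * X)) by ring.
have -> : (N + 1) * (b * ((a + b) * X)) = b * ((a + b) * X) + N * (b * ((a + b) * X)) by ring.
by rewrite -addrA lerD2l lerD2r.
Qed.

(* With s_m and d_m the sum and the difference of (A + y)^m and (A - y)^m,
   one has s_(m+1) = A s_m + y d_m and d_(m+1) = A d_m + y s_m. *)
Lemma symmetric_power_aux m : exists2 c : R, 0 <= c & forall a b y,
  0 <= a -> 0 <= b -> y ^+ 2 <= 4 * a * b ->
  ((a + b + y) ^+ m.+1 + (a + b - y) ^+ m.+1 <=
     2 * (a + b) ^+ m.+1 + c * (b * (a + b) ^+ m)) /\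
  (y * ((a + b + y) ^+ m.+1 - (a + b - y) ^+ m.+1) <= c * (b * (a + b) ^+ m.+1)).
Proof.
elim: m => [|m [c c0 IH]].
  (* For m = 0 the second claim reads 2 y^2 <= 8 b (a + b). *)
  exists 8 => // a b y a0 b0 yab; rewrite !expr1 expr0; split.
    by lra.
  have -> : y * (a + b + y - (a + b - y)) = 2 * y ^+ 2 by ring.
  by have := mulr_ge0 a0 b0; have := mulr_ge0 b0 b0; nra.
(* The first claim needs 2 c. The second needs c + 8 * 2^(m+1), where y^2 <= 4 b (a + b) and the sum
   of the powers is at most 2 (2 (a + b))^(m+1) because |y| <= a + b. *)
exists (2 * c + 8 * 2 ^+ m.+1); first by rewrite addr_ge0 // mulr_ge0 // exprn_ge0.
move=> a b y a0 b0 yab; have [H1 H2] := IH a b y a0 b0 yab.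
have A0 : 0 <= a + b by rewrite addr_ge0.
have yA : `|y| <= a + b.
  rewrite -(ler_pXn2r (n := 2)) ?nnegrE // real_normK ?num_real //.
  by apply: le_trans yab _; have := sqr_ge0 (a - b); rewrite sqrrB sqrrD; lra.
move: yA; rewrite ler_norml => /andP[yA1 yA2].
have P0 : 0 <= a + b + y by lra.
have M0 : 0 <= a + b - y by lra.
have S2 : (a + b + y) ^+ m.+1 + (a + b - y) ^+ m.+1 <= 2 * (2 * (a + b)) ^+ m.+1.
  rewrite mulr2n mulrDl mul1r lerD // lerXn2r ?nnegrE ?mulr_ge0 //; lra.
have S0 : 0 <= (a + b + y) ^+ m.+1 + (a + b - y) ^+ m.+1.
  by rewrite addr_ge0 // exprn_ge0.
rewrite !(exprS _ m.+1).
set p := (a + b + y) ^+ m.+1 in H1 H2 S2 S0 *.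
set q := (a + b - y) ^+ m.+1 in H1 H2 S2 S0 *.
have bX0 : 0 <= b * (a + b) ^+ m.+1 by rewrite mulr_ge0 // exprn_ge0.
have bXX0 : 0 <= b * ((a + b) * (a + b) ^+ m.+1) by rewrite !mulr_ge0 // exprn_ge0.
have t0 : 0 <= 2 ^+ m.+1 :> R by rewrite exprn_ge0.
split.
  have -> : (a + b + y) * p + (a + b - y) * q = (a + b) * (p + q) + y * (p - q) by ring.
  have := ler_wpM2l A0 H1.
  have -> : (a + b) * (2 * (a + b) ^+ m.+1 + c * (b * (a + b) ^+ m)) =
     2 * ((a + b) * (a + b) ^+ m.+1) + c * (b * (a + b) ^+ m.+1).
    by rewrite (exprS _ m); ring.
  have := mulr_ge0 t0 bX0; move: H2; nra.
have -> : y * ((a + b + y) * p - (a + b - y) * q) =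
    (a + b) * (y * (p - q)) + y ^+ 2 * (p + q) by ring.
have K1 := ler_wpM2l A0 H2.
have K2 : y ^+ 2 * (p + q) <= 4 * (b * (a + b)) * (2 * (2 * (a + b)) ^+ m.+1).
  apply: ler_pM => //; first exact: sqr_ge0.
  by apply: le_trans yab _; have := mulr_ge0 b0 b0; nra.
move: K2; rewrite exprMn.
have -> : 4 * (b * (a + b)) * (2 * (2 ^+ m.+1 * (a + b) ^+ m.+1)) =
   8 * 2 ^+ m.+1 * (b * ((a + b) * (a + b) ^+ m.+1)) by ring.
move: K1; have -> : (a + b) * (c * (b * (a + b) ^+ m.+1)) =
  c * (b * ((a + b) * (a + b) ^+ m.+1)) by ring.
have := mulr_ge0 c0 bXX0; nra.
Qed.

(** To be read with a = |V|^2, b = |N|^2 and y = 2 <V, N>, so that the condition on y is the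
    Cauchy-Schwarz inequality. Summing over both signs of N removes the term of order sqrt(b); the
    remaining error is at least linear in b. *)
Lemma symmetric_power_le m : exists2 C : R, 0 <= C & forall a b y,
  0 <= a -> 0 <= b -> y ^+ 2 <= 4 * a * b ->
  (a + b + y) ^+ m.+1 + (a + b - y) ^+ m.+1 <=
  2 * (a ^+ m.+1 + C * (a ^+ m * b + b ^+ m.+1)).
Proof.
have [c c0 H] := symmetric_power_aux m.
exists ((m.+1%:R + c) * 2 ^+ m); first by rewrite mulr_ge0 ?addr_ge0 ?exprn_ge0.
move=> a b y a0 b0 /(H a b y a0 b0)[+ _].
have T := exprD_le_tangent m a0 b0.
have D : b * (a + b) ^+ m <= 2 ^+ m * (a ^+ m * b + b ^+ m.+1).
  apply: (le_trans (ler_wpM2l b0 (exprD_le2 m a0 b0))).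
  by rewrite exprS le_eqVlt; apply/orP; left; apply/eqP; ring.
have N0 : 0 <= m.+1%:R :> R by [].
have D1 := ler_wpM2l N0 D; have D2 := ler_wpM2l c0 D.
have X0 : 0 <= c * (2 ^+ m * (a ^+ m * b + b ^+ m.+1)).
  by rewrite mulr_ge0 // mulr_ge0 ?exprn_ge0 // addr_ge0 ?mulr_ge0 ?exprn_ge0.
move: T D1 D2 X0.
set X := b * (a + b) ^+ m; set Y := 2 ^+ m * _; set Z := (a + b) ^+ m.+1.
rewrite -mulrA -/Y => *; lra.
Qed.

(** Either p < e r, and the second term dominates, or r <= p / e, and the first one does. *)
Lemma young_power p r e m : 0 <= p -> 0 <= r -> 0 < e ->
  p * r ^+ m <= e ^- m * p ^+ m.+1 + e * r ^+ m.+1.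
Proof.
move=> p0 r0 e0; have [pr|/ltW rp] := leP p (e * r).
  apply: (@le_trans _ _ (e * r ^+ m.+1)).
    by rewrite exprS mulrA ler_wpM2r ?exprn_ge0.
  by rewrite lerDr mulr_ge0 ?exprn_ge0 // invr_ge0 exprn_ge0 // ltW.
apply: (@le_trans _ _ (e ^- m * p ^+ m.+1)); last first.
  by rewrite lerDl mulr_ge0 ?exprn_ge0 // ltW.
have : (e * r) ^+ m <= p ^+ m by rewrite lerXn2r ?nnegrE // mulr_ge0 // ltW.
rewrite exprMn exprS => H.
rewrite mulrCA ler_wpM2l // -(ler_pM2l (exprn_gt0 m e0)).
by rewrite mulrA mulfV ?mul1r // gt_eqF // exprn_gt0.
Qed.

Lemma sum_CauchySchwarz n (x y : 'I_n -> R) :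
  (\sum_i x i * y i) ^+ 2 <= (\sum_i x i ^+ 2) * (\sum_i y i ^+ 2).
Proof.
rewrite -subr_ge0 -(pmulr_rge0 _ (ltr0n R 2)).
(* Lagrange's identity. *)
have -> : 2 * ((\sum_i x i ^+ 2) * (\sum_i y i ^+ 2) - (\sum_i x i * y i) ^+ 2) =
    \sum_i \sum_j (x i * y j - x j * y i) ^+ 2.
  have e1 : (\sum_i x i ^+ 2) * (\sum_i y i ^+ 2) = \sum_i \sum_j (x i * y j) ^+ 2.
    by rewrite big_distrlr /=; do 2 (apply: eq_bigr => ? _); rewrite exprMn.
  have e2 : (\sum_i x i ^+ 2) * (\sum_i y i ^+ 2) = \sum_i \sum_j (x j * y i) ^+ 2.
    by rewrite mulrC big_distrlr /=; do 2 (apply: eq_bigr => ? _); rewrite exprMn mulrC.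
  have e3 : (\sum_i x i * y i) ^+ 2 = \sum_i \sum_j (x i * y j) * (x j * y i).
    rewrite expr2 big_distrlr /=; do 2 (apply: eq_bigr => ? _); ring.
  rewrite mulrBr e3 mulr2n mulrDl mul1r {1}e1 e2 mulrDl mul1r -big_split -big_split -sumrB /=.
  apply: eq_bigr => i _; rewrite -big_split -big_split -sumrB /=; apply: eq_bigr => j _.
  ring.
by do 2 (apply: sumr_ge0 => ? _); exact: sqr_ge0.
Qed.

End power_inequalities.

(** * Dimension-free moments of the noise of one step *)

Section step.
Context (R : realType) (U : completeNormedModType R) (dotU : {dot U for idfun}).
Hypothesis hilbU : induces_norm dotU.
Context (d : measure_display) (Omega : measurableType d) (P : probability Omega R).
Context (T : R) (F : R -> set (set Omega)).
Hypothesis Ffilt : filtration T F.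
Context (W : R -> U -> Omega -> R).
Hypothesis Wwiener : cylindrical_wiener P T F dotU W.

Notation Fs s := (g_sigma_algebraType (F s)).
Notation incr := (incr W).

Let imeasT := incr_measurableT Ffilt Wwiener.

Context (s t : R) (s0 : 0 <= s) (st : s < t) (tT : t <= T).
Context (n : nat) (b : 'I_n -> U) (c q : 'I_n -> R).
Hypothesis q0 : forall i, 0 < q i.
Hypothesis cq : forall i, c i ^+ 2 * ((t - s) * `|b i| ^+ 2) <= q i.

Let Q := \sum_i q i.
Let noise w := \sum_i c i ^+ 2 * incr s t (b i) w ^+ 2.

Let Q0 : 0 <= Q. Proof. by apply: sumr_ge0 => i _; exact: ltW. Qed.

Let noise_ge0 w : 0 <= noise w.
Proof. by apply: sumr_ge0 => i _; rewrite mulr_ge0 // sqr_ge0. Qed.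

Let minc i : measurable_fun setT (incr s t (b i)).
Proof. by apply: imeasT => //; exact: ltW. Qed.

Let mnoise : measurable_fun setT noise.
Proof.
apply: measurable_sum => i; apply: measurable_funM => //.
exact: measurable_funX.
Qed.

Lemma noise_independent (Z : Omega -> R) :
  measurable_fun setT (Z : Fs s -> R) -> (forall w, 0 <= Z w) ->
  (\int[P]_w (Z w * noise w)%:E <=
   (kappa R 1 * Q)%:E * \int[P]_w (Z w)%:E)%E.
Proof.
move=> mZ Z0; have sT : s <= T by exact: le_trans (ltW st) tT.
have mZT : measurable_fun setT Z by exact: (filtration_measurable Ffilt s0 sT mZ).
have I0 : (0 <= \int[P]_w (Z w)%:E)%E by apply: integral_ge0 => w _; rewrite lee_fin.
have E w : (Z w * noise w)%:E =
    (\sum_(i < n) (c i ^+ 2)%:E * (Z w * incr s t (b i) w ^+ (2 * 1))%:E)%E.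
  rewrite /noise mulr_sumr -sumEFin; apply: eq_bigr => i _.
  by rewrite -EFinM mulrCA muln1.
have m1 i : measurable_fun setT (fun w => (Z w * incr s t (b i) w ^+ (2 * 1))%:E).
  apply/measurable_EFinP; apply: measurable_funM => //; exact: measurable_funX.
have n1 i w : (0 <= (Z w * incr s t (b i) w ^+ (2 * 1))%:E)%E.
  by rewrite lee_fin mulr_ge0 // muln1 sqr_ge0.
under eq_integral do rewrite E.
rewrite ge0_integral_sum //; last 2 first.
- by move=> i; exact: measurable_funeM.
- by move=> i w _; rewrite mule_ge0 // lee_fin sqr_ge0.
have -> : ((kappa R 1 * Q)%:E * \int[P]_w (Z w)%:E =
    \sum_(i < n) (kappa R 1 * q i)%:E * \int[P]_w (Z w)%:E)%E.
  rewrite -ge0_sume_distrl => [|i _]; last by rewrite lee_fin mulr_ge0 ?kappa_ge0 ?ltW.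
  by rewrite sumEFin -mulr_sumr.
apply: lee_sum => i _; rewrite ge0_integralZl_EFin //; last exact: sqr_ge0.
rewrite (incr_moment hilbU Ffilt Wwiener) // muleA -EFinM lee_wpmul2r // lee_fin.
rewrite expr1 muln1 mulrA mulrC ler_wpM2l ?kappa_ge0 //.
Qed.

(** Young's inequality with weights e i of sum at most 1/2 lets half of the left side be absorbed
    pointwise, before any integration. What remains is a sum of Gaussian moments, and the choice of
    e i makes it a multiple of Q^(m+1) without any factor n. *)
Lemma noise_moment m :
  (\int[P]_w (noise w ^+ m.+1)%:E <= (2 ^+ m.+1 * kappa R m.+1 * Q ^+ m.+1)%:E)%E.
Proof.
pose p i w := c i ^+ 2 * incr s t (b i) w ^+ 2.
(* With this weight, q i ^ (m+1) / e i ^ m = (2 Q)^m q i, which is again summable to a power of Q.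
   Division by e i is why q i has to be positive. *)
pose e i := q i / (2 * Q).
have Qi (i : 'I_n) : 0 < Q.
  by rewrite /Q (bigD1 i) //= ltr_pwDl // sumr_ge0 // => j _; exact: ltW.
have e0 i : 0 < e i by rewrite /e divr_gt0 // mulr_gt0 // (Qi i).
have p0 i w : 0 <= p i w by rewrite mulr_ge0 // sqr_ge0.
have ptw w : noise w ^+ m.+1 <= \sum_i 2 * (e i ^- m * p i w ^+ m.+1).
  have N0 : 0 <= noise w ^+ m.+1 by rewrite exprn_ge0.
  have H : noise w ^+ m.+1 <= \sum_i e i ^- m * p i w ^+ m.+1 + (\sum_i e i) * noise w ^+ m.+1.
    rewrite {1}exprS {1}/noise mulr_suml mulr_suml -big_split /=.
    by apply: ler_sum => i _; exact: (young_power m (p0 i w) (noise_ge0 w) (e0 i)).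
  have eh : (\sum_i e i) * noise w ^+ m.+1 <= 2^-1 * noise w ^+ m.+1.
    apply: ler_wpM2r => //; rewrite /e -mulr_suml -/Q.
    have [QE|Qn0] := eqVneq Q 0; first by rewrite QE mul0r invr_ge0.
    by rewrite invfM mulrCA mulfV // mulr1.
  by rewrite -mulr_sumr; clear Qi; lra.
have mp i : measurable_fun setT (fun w => (p i w ^+ m.+1)%:E).
  by apply/measurable_EFinP; apply: measurable_funX; apply: measurable_funM => //; exact: measurable_funX.
have k0 i : 0 <= 2 * e i ^- m by rewrite mulr_ge0 // invr_ge0 exprn_ge0 // ltW.
apply: (@le_trans _ _ (\int[P]_w (\sum_(i < n) (2 * e i ^- m)%:E * (p i w ^+ m.+1)%:E))%E).
  apply: ge0_le_integral => //.
  - by move=> w _; rewrite lee_fin exprn_ge0.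
  - by apply/measurable_EFinP; exact: measurable_funX.
  - by apply: emeasurable_sum => i; exact: measurable_funeM.
  - move=> w _; under eq_bigr do rewrite -EFinM.
    rewrite sumEFin lee_fin; apply: le_trans (ptw w) _.
    by apply: ler_sum => i _; rewrite mulrA.
rewrite ge0_integral_sum //; last 2 first.
- by move=> i; exact: measurable_funeM.
- by move=> i w _; rewrite mule_ge0 // lee_fin // exprn_ge0.
have -> : 2 ^+ m.+1 * kappa R m.+1 * Q ^+ m.+1 =
    \sum_(i < n) (2 * e i ^- m) * (kappa R m.+1 * q i ^+ m.+1).
  transitivity (\sum_(i < n) (2 ^+ m.+1 * kappa R m.+1 * Q ^+ m) * q i).
    by rewrite -mulr_sumr -/Q (exprSr Q) mulrA.
  apply: eq_bigr => i _; rewrite /e -exprVn invf_div exprMn exprMn exprVn !exprS.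
  have qi := gt_eqF (q0 i); have qm : q i ^+ m != 0 by rewrite expf_neq0 // qi.
  by field; rewrite qm.
rewrite -sumEFin; apply: lee_sum => i _.
rewrite ge0_integralZl_EFin //; last by move=> w _; rewrite lee_fin exprn_ge0.
rewrite [leRHS]EFinM; apply: lee_wpmul2l; first by rewrite lee_fin.
have E w : (p i w ^+ m.+1)%:E = (c i ^+ (2 * m.+1) * incr s t (b i) w ^+ (2 * m.+1))%:E.
  by rewrite /p exprMn -!exprM.
under eq_integral do rewrite E.
rewrite (incr_moment hilbU Ffilt Wwiener (b i) s0 st tT (j := m.+1)
  (Z := cst (c i ^+ (2 * m.+1)))) //; last first.
  by move=> w; rewrite exprM exprn_ge0 // sqr_ge0.
have -> : (\int[P]_w (cst (c i ^+ (2 * m.+1)) w)%:E = (c i ^+ (2 * m.+1))%:E)%E.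
  rewrite [LHS](integral_cst P measurableT (c i ^+ (2 * m.+1))%:E) -[RHS]mule1.
  by congr (_ * _)%E; exact: probability_setT.
rewrite -EFinM lee_fin.
have -> : (t - s) ^+ m.+1 * `|b i| ^+ (2 * m.+1) * kappa R m.+1 * c i ^+ (2 * m.+1) =
    kappa R m.+1 * (c i ^+ 2 * ((t - s) * `|b i| ^+ 2)) ^+ m.+1.
  by rewrite !(exprM _ 2) !exprMn; ring.
apply: ler_wpM2l; first exact: kappa_ge0.
have ts : 0 <= t - s by rewrite subr_ge0 ltW.
by rewrite lerXn2r ?nnegrE ?(ltW (q0 i)) // mulr_ge0 ?sqr_ge0 // mulr_ge0 // sqr_ge0.
Qed.

End step.

Section step_moment.
Context (R : realType) (U : completeNormedModType R) (dotU : {dot U for idfun}).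
Hypothesis hilbU : induces_norm dotU.
Context (d : measure_display) (Omega : measurableType d) (P : probability Omega R).
Context (T : R) (F : R -> set (set Omega)).
Hypothesis Ffilt : filtration T F.
Context (W : R -> U -> Omega -> R).
Hypothesis Wwiener : cylindrical_wiener P T F dotU W.

Notation Fs s := (g_sigma_algebraType (F s)).
Notation incr := (incr W).

(* The noise M is odd in the increments, whose law given F_s is symmetric, so
   that the mixed term of lowest order cancels. *)
Lemma step_moment (m : nat) : exists2 K : R, 0 <= K & forall s t n
  (b : 'I_n -> U) (c q : 'I_n -> R) (V : 'I_n -> Omega -> R) (chi : Omega -> R)
  (k : R -> R),
  0 <= s -> s < t -> t <= T -> (forall i, 0 < q i) ->
  (forall i, c i ^+ 2 * ((t - s) * `|b i| ^+ 2) <= q i) ->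
  (forall i, measurable_fun setT (V i : Fs s -> R)) ->
  measurable_fun setT (chi : Fs s -> R) -> (forall w, 0 <= chi w <= 1) ->
  measurable_fun setT k -> (forall x, 0 <= k x <= 1) ->
  (\int[P]_w ((\sum_i (V i w + c i * (chi w * k (\sum_j incr s t (b j) w ^+ 2) *
      incr s t (b i) w)) ^+ 2) ^+ m.+1)%:E <=
   \int[P]_w ((\sum_i V i w ^+ 2) ^+ m.+1)%:E +
   (K * \sum_i q i)%:E * \int[P]_w ((\sum_i V i w ^+ 2) ^+ m)%:E +
   (K * (\sum_i q i) ^+ m.+1)%:E)%E.
Proof.
have [C C0 CP] := symmetric_power_le R m.
(* The two summands are the constants of [noise_independent] and [noise_moment]. *)
exists (C * (kappa R 1 + 2 ^+ m.+1 * kappa R m.+1)).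
  by rewrite mulr_ge0 // addr_ge0 ?mulr_ge0 ?kappa_ge0 ?exprn_ge0.
move=> s t n b c q V chi k s0 st tT q0 cq mV mchi chi01 mk k01.
have st' := ltW st; have sT : s <= T by exact: le_trans tT.
pose Q := \sum_i q i.
have Q0 : 0 <= Q by apply: sumr_ge0 => i _; exact: ltW.
(* Odd in x, since x enters k through its squares only. *)
pose M (x : n.-tuple R) i w := c i * (chi w * k (\sum_j tnth x j ^+ 2) * tnth x i).
pose Phi (z : Fs s * n.-tuple R) := ((\sum_i (V i z.1 + M z.2 i z.1) ^+ 2) ^+ m.+1)%:E.
have mx i : measurable_fun setT (fun z : Fs s * n.-tuple R => tnth z.2 i).
  exact: (measurableT_comp (measurable_tnth i) measurable_snd).
have mPhi : measurable_fun setT Phi.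
  apply/measurable_EFinP; apply: measurable_funX; apply: measurable_sum => i.
  apply: measurable_funX; apply: measurable_funD.
    exact: (measurableT_comp (mV i) measurable_fst).
  apply: measurable_funM => //; apply: measurable_funM => //; apply: measurable_funM.
    exact: (measurableT_comp mchi measurable_fst).
  apply: (measurableT_comp mk); apply: measurable_sum => j; exact: measurable_funX.
have Phi0 z : (0 <= Phi z)%E.
  by rewrite lee_fin exprn_ge0 // sumr_ge0 // => i _; exact: sqr_ge0.
pose X w := [tuple incr s t (b i) w | i < n].
pose X' w := [tuple (- incr s t (b i) w)%R | i < n].
have sym : (\int[P]_w Phi (w, X w) = \int[P]_w Phi (w, X' w))%E.
  exact: (incr_symmetric_family hilbU Ffilt Wwiener b s0 st tT mPhi Phi0).
have IE : (\int[P]_w ((\sum_i (V i w + c i * (chi w * k (\sum_j incr s t (b j) w ^+ 2) *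
      incr s t (b i) w)) ^+ 2) ^+ m.+1)%:E = \int[P]_w Phi (w, X w))%E.
  apply: eq_integral => w _; rewrite /Phi /M /X /=; congr (_ ^+ _)%:E.
  apply: eq_bigr => i _; rewrite tnth_mktuple.
  by under [in RHS]eq_bigr do rewrite tnth_mktuple.
rewrite IE; set I := (\int[P]_w Phi (w, X w))%E.
pose a w := \sum_i V i w ^+ 2.
pose nu w := \sum_i c i ^+ 2 * incr s t (b i) w ^+ 2.
have a0 w : 0 <= a w by apply: sumr_ge0 => i _; exact: sqr_ge0.
have nu0 w : 0 <= nu w by apply: sumr_ge0 => i _; rewrite mulr_ge0 // sqr_ge0.
have mT f : measurable_fun setT (f : Fs s -> R) -> measurable_fun setT (f : Omega -> R).
  exact: (filtration_measurable Ffilt s0 sT).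
have ma : measurable_fun setT (a : Fs s -> R).
  by apply: measurable_sum => i; exact: measurable_funX.
have mnu : measurable_fun setT nu.
  apply: measurable_sum => i; apply: measurable_funM => //; apply: measurable_funX.
  exact: (incr_measurableT Ffilt Wwiener).
have ptw w : (Phi (w, X w) + Phi (w, X' w) <=
    (2 * (a w ^+ m.+1 + C * (a w ^+ m * nu w + nu w ^+ m.+1)))%:E)%E.
  pose x i := c i * (chi w * k (\sum_j incr s t (b j) w ^+ 2) * incr s t (b i) w).
  pose y := 2 * \sum_i V i w * x i.
  pose B := \sum_i x i ^+ 2.
  have P1 : Phi (w, X w) = ((a w + B + y) ^+ m.+1)%:E.
    rewrite /Phi /M /X /=; congr (_ ^+ _)%:E.
    rewrite /a /B /y mulr_sumr -!big_split /=; apply: eq_bigr => i _.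
    rewrite tnth_mktuple; under eq_bigr do rewrite tnth_mktuple.
    rewrite -/(x i); ring.
  have P2 : Phi (w, X' w) = ((a w + B - y) ^+ m.+1)%:E.
    rewrite /Phi /M /X' /=; congr (_ ^+ _)%:E.
    rewrite /a /B /y mulr_sumr -sumrN -!big_split /=; apply: eq_bigr => i _.
    rewrite tnth_mktuple; under eq_bigr do rewrite tnth_mktuple sqrrN.
    rewrite !mulrN -/(x i); ring.
  rewrite P1 P2 -EFinD lee_fin.
  have B0 : 0 <= B by apply: sumr_ge0 => i _; exact: sqr_ge0.
  have Bnu : B <= nu w.
    apply: ler_sum => i _; rewrite /x exprMn ler_wpM2l ?sqr_ge0 // exprMn.
    have /andP[h0 h1] := chi01 w.
    have /andP[g0 g1] := k01 (\sum_j incr s t (b j) w ^+ 2).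
    rewrite ler_piMl ?sqr_ge0 // exprn_ile1 ?mulr_ge0 //.
    exact: mulr_ile1.
  have yab : y ^+ 2 <= 4 * a w * B.
    have := sum_CauchySchwarz (fun i => V i w) x; rewrite /y exprMn.
    by rewrite -/(a w) -/B; lra.
  apply: le_trans (CP _ _ _ (a0 w) B0 yab) _.
  rewrite ler_wpM2l // lerD2l ler_wpM2l // lerD //.
    by rewrite ler_wpM2l // exprn_ge0.
  by rewrite lerXn2r ?nnegrE.
(* By symmetry 2 I is the integral of the sum over both signs, to which the pointwise bound
   applies. *)
have h1 : (2%:E * I <= \int[P]_w (2 * (a w ^+ m.+1 + C * (a w ^+ m * nu w + nu w ^+ m.+1)))%:E)%E.
  have mXX : measurable_fun setT (fun w : Omega => (w : Fs s, X w)).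
    apply: measurable_fun_pair; first exact: (filtration_id_measurable Ffilt s0 sT).
    apply/measurable_fun_tnthP => i.
    apply: eq_measurable_fun (incr_measurableT Ffilt Wwiener (b i) s0 st' tT).
    by move=> w _; rewrite /= tnth_mktuple.
  have mXX' : measurable_fun setT (fun w : Omega => (w : Fs s, X' w)).
    apply: measurable_fun_pair; first exact: (filtration_id_measurable Ffilt s0 sT).
    apply/measurable_fun_tnthP => i.
    apply: eq_measurable_fun (measurableT_comp _ (incr_measurableT Ffilt Wwiener (b i) s0 st' tT)); last first.
      exact: oppr_measurable.
    by move=> w _; rewrite /= tnth_mktuple.
  have -> : (2%:E * I = \int[P]_w (Phi (w, X w) + Phi (w, X' w)))%E.
    rewrite ge0_integralD //; last 2 first.
    - exact: measurableT_comp mPhi mXX.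
    - exact: measurableT_comp mPhi mXX'.
    by rewrite -sym -/I mule_natl mule2n.
  apply: ge0_le_integral => //.
  - by move=> w _; rewrite adde_ge0.
  - by apply: emeasurable_funD; [exact: measurableT_comp mPhi mXX|exact: measurableT_comp mPhi mXX'].
  - apply/measurable_EFinP; apply: measurable_funM => //; apply: measurable_funD.
      by apply: measurable_funX; exact: mT.
    apply: measurable_funM => //; apply: measurable_funD.
      by apply: measurable_funM => //; apply: measurable_funX; exact: mT.
    exact: measurable_funX.
have am0 j w : 0 <= a w ^+ j by exact: exprn_ge0.
have mam j : measurable_fun setT ((fun w => a w ^+ j) : Fs s -> R) by exact: measurable_funX.
have num0 w : 0 <= nu w ^+ m.+1 by exact: exprn_ge0.
have an0 w : 0 <= a w ^+ m * nu w by exact: mulr_ge0.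
have i1 := noise_independent hilbU Ffilt Wwiener s0 st tT q0 cq (mam m) (am0 m).
have i2 := noise_moment hilbU Ffilt Wwiener s0 st tT q0 cq m.
have split_int : (\int[P]_w (a w ^+ m.+1 + C * (a w ^+ m * nu w + nu w ^+ m.+1))%:E =
    \int[P]_w (a w ^+ m.+1)%:E + C%:E * (\int[P]_w (a w ^+ m * nu w)%:E +
    \int[P]_w (nu w ^+ m.+1)%:E))%E.
  have ma1 : measurable_fun setT (fun w => (a w ^+ m.+1)%:E).
    by apply/measurable_EFinP; exact: mT.
  have man : measurable_fun setT (fun w => (a w ^+ m * nu w)%:E).
    by apply/measurable_EFinP; apply: measurable_funM => //; exact: mT.
  have mn : measurable_fun setT (fun w => (nu w ^+ m.+1)%:E).
    by apply/measurable_EFinP; exact: measurable_funX.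
  under eq_integral do rewrite EFinD EFinM EFinD.
  have mann := emeasurable_funD man mn.
  have n1 w : setT w -> (0 <= (a w ^+ m * nu w)%:E + (nu w ^+ m.+1)%:E)%E.
    by move=> _; rewrite -EFinD lee_fin addr_ge0.
  have n2 w : setT w -> (0 <= C%:E * ((a w ^+ m * nu w)%:E + (nu w ^+ m.+1)%:E))%E.
    by move=> wT; rewrite mule_ge0 // n1.
  have mC := measurable_funeM C%:E mann.
  have n3 w : setT w -> (0 <= (a w ^+ m.+1)%:E)%E by rewrite lee_fin.
  have n4 w : setT w -> (0 <= (a w ^+ m * nu w)%:E)%E by rewrite lee_fin.
  have n5 w : setT w -> (0 <= (nu w ^+ m.+1)%:E)%E by rewrite lee_fin.
  rewrite ge0_integralD // ge0_integralZl_EFin //.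
  by rewrite (ge0_integralD P measurableT n4 man n5 mn).
suff H : (2%:E * I <= 2%:E * (\int[P]_w (a w ^+ m.+1)%:E +
   (C * (kappa R 1 + 2 ^+ m.+1 * kappa R m.+1) * Q)%:E * \int[P]_w (a w ^+ m)%:E +
   (C * (kappa R 1 + 2 ^+ m.+1 * kappa R m.+1) * Q ^+ m.+1)%:E))%E.
  by move: H; rewrite lee_pmul2l.
apply: (le_trans h1).
under eq_integral do rewrite EFinM.
rewrite ge0_integralZl_EFin //; last 2 first.
- by move=> w _; rewrite lee_fin addr_ge0 // mulr_ge0 // addr_ge0.
- apply/measurable_EFinP; apply: measurable_funD; first exact: mT.
  apply: measurable_funM => //; apply: measurable_funD.
    by apply: measurable_funM => //; exact: mT.
  exact: measurable_funX.
apply: lee_wpmul2l => //; rewrite split_int -addeA; apply: leeD2l.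
have J0 : (0 <= \int[P]_w (a w ^+ m)%:E)%E by apply: integral_ge0 => w _; rewrite lee_fin.
apply: (@le_trans _ _ (C%:E * ((kappa R 1 * Q)%:E * \int[P]_w (a w ^+ m)%:E +
   (2 ^+ m.+1 * kappa R m.+1 * Q ^+ m.+1)%:E))%E).
  by apply: lee_wpmul2l => //; exact: leeD.
rewrite ge0_muleDr ?mule_ge0 ?lee_fin ?mulr_ge0 ?kappa_ge0 ?exprn_ge0 //.
have e2 : 0 <= 2 ^+ m.+1 * kappa R m.+1 by rewrite mulr_ge0 ?kappa_ge0 ?exprn_ge0.
apply: leeD.
  rewrite muleA -EFinM lee_wpmul2r // lee_fin -mulrA ler_wpM2l // ler_wpM2r //.
  by rewrite lerDl.
rewrite -EFinM lee_fin -[leRHS]mulrA ler_wpM2l // ler_wpM2r ?exprn_ge0 //.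
by rewrite lerDr kappa_ge0.
Qed.

End step_moment.

(** * Moment bounds along the grid *)

Section grid_floor_properties.
Context (R : realType).

Lemma finite_set_has_max (A : set R) : finite_set A -> A !=set0 ->
  exists2 x, A x & forall y, A y -> y <= x.
Proof.
move=> /finite_seqP[s ->]; elim: s => [|x s IH] [y ys] //.
have [s0|] := eqVneq s [::].
  by exists x; rewrite /= s0 ?inE // => z; rewrite inE => /eqP ->.
case: s IH ys => // z s IH _ _.
have [|m ms mM] := IH; first by exists z; rewrite /= inE eqxx.
have [xm|mx] := leP x m.
  exists m => [|u] /=; first by rewrite inE [m \in _]ms orbT.
  by rewrite inE => /orP[/eqP ->//|]; exact: mM.
exists x => [|u] /=; first by rewrite inE eqxx.
by rewrite inE => /orP[/eqP ->//|/mM um]; exact: le_trans um (ltW mx).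
Qed.

Lemma grid_floor_in (T : R) theta s : varpi T theta -> 0 < s ->
  [/\ theta (grid_floor theta s), 0 <= grid_floor theta s & grid_floor theta s < s].
Proof.
move=> [fin _ th0 _] s0; rewrite /grid_floor s0.
have fA : finite_set (`[0, s[ `&` theta) by exact: finite_setIr.
have [|x [xs thx] xM] := finite_set_has_max fA.
  by exists 0; split => //=; rewrite in_itv /= lexx.
suff -> : sup (`[0, s[ `&` theta) = x.
  by move: xs; rewrite /= in_itv /= => /andP[-> ->].
apply/eqP; rewrite eq_le; apply/andP; split.
  by apply: ge_sup; [exists x|move=> y /xM].
by apply: ub_le_sup; [exists x => y /xM|].
Qed.

(** Induction on the number of grid points in [0, s[: the point [grid_floor theta s] is among them
    but is not below itself. The time s need not belong to the grid. *)
Lemma grid_induction (T : R) theta (Q : R -> Prop) : varpi T theta -> Q 0 ->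
  (forall s, 0 < s -> s <= T -> Q (grid_floor theta s) -> Q s) ->
  forall s, 0 <= s -> s <= T -> Q s.
Proof.
move=> th Q0 QS; have [fin _ _ _] := th.
pose below s := fset_set (`[0, s[ `&` theta).
have fB s : finite_set (`[0, s[ `&` theta) by exact: finite_setIr.
suff H N : forall s, 0 <= s -> s <= T -> (#|` below s| < N)%N -> Q s.
  by move=> s s0 sT; exact: (H #|` below s|.+1).
elim: N => // N IH s s0 sT sN.
have [->//|sn0] := eqVneq s 0.
have sp : 0 < s by rewrite lt_neqAle eq_sym sn0.
have [thf f0 fs] := grid_floor_in th sp.
apply: QS => //; apply: IH => //; first by rewrite (le_trans (ltW fs)).
rewrite -ltnS (leq_trans _ sN) // ltnS.
apply: fproper_ltn_card; rewrite fproperE; apply/andP; split.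
  apply/fsubsetP => x; rewrite !in_fset_set // => /set_mem[].
  rewrite /= in_itv /= => /andP[x0 xf] thx; apply/mem_set; split => //=.
  by rewrite in_itv /= x0 (lt_trans xf).
apply/fsubsetPn; exists (grid_floor theta s).
  by rewrite in_fset_set //; apply/mem_set; split => //=; rewrite in_itv /= f0.
rewrite in_fset_set //; apply/negP => /set_mem[].
by rewrite /= in_itv /= ltxx andbF.
Qed.

End grid_floor_properties.

(** * Smoothing by the semigroup and its integrable singularity *)

Section power_bounds.
Context (R : realType).
Implicit Types x a k : R.

Lemma powR_le_expR x a : 0 <= x -> 0 <= a <= 1 -> x `^ a <= expR x.
Proof.
move=> x0 /andP[a0 a1]; apply: le_trans (expR_ge1Dx x).
have [x1|/ltW x1] := leP x 1.
  apply: (@le_trans _ _ 1); last by rewrite lerDl.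
  by have := ge0_ler_powR a0 (x0 : x \in Num.nneg) (ler01 : 1 \in Num.nneg) x1; rewrite powR1.
apply: (@le_trans _ _ x); last by rewrite lerDr.
by rewrite -[leRHS]powRr1 // ler_powR.
Qed.

(* Convexity of exp: x and 1 are x^k e^((1-k) ln x) and x^k e^(-k ln x). *)
Lemma powR_bernoulli x k : 0 <= x -> 0 < k -> k <= 1 -> x `^ k <= 1 + k * (x - 1).
Proof.
move=> x0 k0 k1; have [->|xn0] := eqVneq x 0.
  by rewrite powR0 ?gt_eqF //; lra.
have xp : 0 < x by rewrite lt_neqAle eq_sym xn0.
have P0 : 0 < x `^ k by exact: powR_gt0.
pose L := ln x.
have E1 : x = x `^ k * expR ((1 - k) * L).
  by rewrite /powR gt_eqF // -expRD -mulrDl addrC subrK mul1r lnK.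
have E2 : 1 = x `^ k * expR (- k * L).
  by rewrite /powR gt_eqF // -expRD mulNr subrr expR0.
have H1 := expR_ge1Dx ((1 - k) * L); have H2 := expR_ge1Dx (- k * L).
have K1 : x `^ k * (1 + (1 - k) * L) <= x by rewrite {2}E1 ler_pM2l.
have K2 : x `^ k * (1 + - k * L) <= 1 by rewrite [leRHS]E2 ler_pM2l.
have K3 := ler_wpM2l (ltW k0) K1.
have k1' : 0 <= 1 - k by lra.
have K4 := ler_wpM2l k1' K2.
set M := x `^ k in K3 K4 *.
have E : k * (M * (1 + (1 - k) * L)) + (1 - k) * (M * (1 + - k * L)) = M by ring.
lra.
Qed.

(** Concavity of x^k, that is, Bernoulli's inequality at t1 / t0. With t0 and t1 the times left
    until t at both ends of a step, it bounds a summand of a left Riemann sum of r |-> (t - r)^(k -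
    1) by its integral. *)
Lemma powR_increment_ge (t0 t1 k : R) : 0 < t0 -> 0 <= t1 -> 0 < k -> k <= 1 ->
  (t0 - t1) * (t0 `^ k / t0) <= (t0 `^ k - t1 `^ k) / k.
Proof.
move=> t00 t10 k0 k1; rewrite ler_pdivlMr //.
have := @powR_bernoulli (t1 / t0) k (divr_ge0 t10 (ltW t00)) k0 k1.
have P0 : 0 < t0 `^ k by exact: powR_gt0.
have -> : t1 `^ k = t0 `^ k * (t1 / t0) `^ k.
  rewrite -powRM ?(ltW t00) //; last by rewrite divr_ge0 // ltW.
  by rewrite mulrCA mulfV ?mulr1 // gt_eqF.
move=> /(ler_wpM2l (ltW P0)) H.
have E : (t0 - t1) * (t0 `^ k / t0) * k = t0 `^ k * (k * (1 - t1 / t0)).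
  by field; rewrite gt_eqF.
rewrite E; move: H; rewrite mulrDr; lra.
Qed.

(** Split l^gamma = l^beta l^(gamma - beta - a) l^a. The middle exponent is not positive, so l >= l0
    bounds that factor, and (l tau)^a e^(-l tau) <= 1. This leaves tau^(-2a) = tau^k / tau with k =
    1 - 2a > 0. *)
Lemma smoothing_bound (beta gamma l0 : R) : 0 < l0 -> gamma < 1 / 2 + beta ->
  exists k C : R, [/\ 0 < k, k <= 1, 0 <= C &
  forall l tau, l0 <= l -> 0 < tau ->
    (l `^ gamma * expR (- (l * tau))) ^+ 2 <= C * (l `^ beta) ^+ 2 * (tau `^ k / tau)].
Proof.
move=> l00 gb; pose a := Num.max (gamma - beta) (1 / 4 : R).
(* Here gamma < 1/2 + beta enters. The value 1/4 keeps a positive when gamma <= beta. *)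
have ah : a < 1 / 2 by rewrite gt_max; apply/andP; split; lra.
have a4 : 1 / 4 <= a by rewrite le_max lexx orbT.
have ag : gamma - beta <= a by rewrite le_max lexx.
exists (1 - 2 * a), ((l0 `^ (gamma - beta - a)) ^+ 2); split; [lra|lra|exact: sqr_ge0|].
move=> l tau l0l tau0; have lp : 0 < l by exact: lt_le_trans l0l.
have E1 : l `^ gamma = l `^ beta * (l `^ (gamma - beta - a) * l `^ a).
  by rewrite -powRD ?(gt_eqF lp) ?implybT // -powRD ?(gt_eqF lp) ?implybT //; congr (_ `^ _); lra.
have B1 : l `^ (gamma - beta - a) <= l0 `^ (gamma - beta - a).
  have -> : gamma - beta - a = - (a - (gamma - beta)) by lra.
  rewrite !powRN lef_pV2 ?posrE ?powR_gt0 //.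
  by apply: ge0_ler_powR => //; rewrite ?nnegrE ?(ltW lp) ?(ltW l00) //; lra.
have B2 : (l `^ a * expR (- (l * tau))) ^+ 2 <= tau `^ (1 - 2 * a) / tau.
  have -> : tau `^ (1 - 2 * a) / tau = (tau `^ a) ^- 2.
    rewrite -[X in _ / X]powRr1 ?(ltW tau0) // -powRB ?(gt_eqF tau0) ?implybT //.
    rewrite -exprVn -powRN -powR_mulrn ?powR_ge0 // -powRrM; congr (_ `^ _); lra.
  have ta : 0 < tau `^ a by exact: powR_gt0.
  rewrite -exprVn lerXn2r ?nnegrE ?mulr_ge0 ?powR_ge0 ?expR_ge0 ?invr_ge0 ?(ltW ta) //.
  rewrite -(ler_pM2r ta) mulVf ?gt_eqF // mulrAC -powRM ?(ltW lp) ?(ltW tau0) // expRN.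
  rewrite ler_pdivrMr ?expR_gt0 // mul1r powR_le_expR ?mulr_ge0 ?(ltW lp) ?(ltW tau0) //.
  by apply/andP; split; lra.
have -> : (l `^ gamma * expR (- (l * tau))) ^+ 2 = (l `^ beta) ^+ 2 *
    ((l `^ (gamma - beta - a)) ^+ 2 * (l `^ a * expR (- (l * tau))) ^+ 2).
  by rewrite E1 !exprMn; ring.
rewrite [leRHS](_ : _ = (l `^ beta) ^+ 2 *
  ((l0 `^ (gamma - beta - a)) ^+ 2 * (tau `^ (1 - 2 * a) / tau))); last by ring.
apply: ler_wpM2l; first exact: sqr_ge0.
apply: ler_pM => //; [exact: sqr_ge0|exact: sqr_ge0|].
by rewrite lerXn2r ?nnegrE ?powR_ge0.
Qed.

End power_bounds.

Section moment_bound.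
Context (R : realType) (U : completeNormedModType R) (dotU : {dot U for idfun}).
Hypothesis hilbU : induces_norm dotU.
Context (d : measure_display) (Omega : measurableType d) (P : probability Omega R).
Context (T : R) (F : R -> set (set Omega)).
Hypothesis T0 : 0 < T.
Hypothesis Ffilt : filtration T F.
Context (W : R -> U -> Omega -> R).
Hypothesis Wwiener : cylindrical_wiener P T F dotU W.

Notation Fs s := (g_sigma_algebraType (F s)).
Notation incr := (incr W).

(** The left side is at most (1 + r)(1 + L G) with L = K D (1 + (D Gmax)^m), and both factors lie
    below exponentials. In the additive term, m of the m + 1 factors Q are replaced by their bound D
    Gmax, so that it is linear in G and sums along the grid. *)
Lemma gronwall_step (r K Q D G Gmax X : R) m : 0 <= r -> 0 <= K -> 0 <= Q -> 0 <= D ->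
  0 <= G -> G <= Gmax -> Q <= D * G -> 1 + r <= expR X ->
  1 + (r + K * Q * (1 + r) + K * Q ^+ m.+1) <=
  expR (X + K * D * (1 + (D * Gmax) ^+ m) * G).
Proof.
move=> r0 K0 Q0 D0 G0 GM QD rX.
have Gm0 : 0 <= Gmax by exact: le_trans GM.
set L := K * D * (1 + (D * Gmax) ^+ m).
have DG0 : 0 <= D * Gmax by exact: mulr_ge0.
have p0 : 0 <= (D * Gmax) ^+ m by exact: exprn_ge0.
have r1 : 0 <= 1 + r by lra.
rewrite expRD; apply: (@le_trans _ _ ((1 + r) * (1 + L * G))); last first.
  by apply: ler_pM => //; [rewrite addr_ge0 // !mulr_ge0 // addr_ge0|exact: expR_ge1Dx].
have Qm : Q ^+ m <= (D * Gmax) ^+ m.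
  rewrite lerXn2r ?nnegrE //; apply: le_trans QD _; exact: ler_wpM2l.
have H1 : K * Q ^+ m.+1 <= K * Q * (D * Gmax) ^+ m * (1 + r).
  rewrite exprS mulrA; apply: (@le_trans _ _ (K * Q * (D * Gmax) ^+ m)).
    by apply: ler_wpM2l => //; exact: mulr_ge0.
  by rewrite ler_peMr ?mulr_ge0 //; lra.
have H2 : K * Q * (1 + (D * Gmax) ^+ m) * (1 + r) <= L * G * (1 + r).
  apply: ler_wpM2r => //; rewrite /L -[leRHS]mulrA (mulrC _ G) mulrA.
  apply: ler_wpM2r; first by rewrite addr_ge0.
  by rewrite -[leRHS]mulrA; apply: ler_wpM2l.
have -> : 1 + (r + K * Q * (1 + r) + K * Q ^+ m.+1) =
  (1 + r) + (K * Q * (1 + r) + K * Q ^+ m.+1) by ring.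
rewrite [leRHS]mulrDr [(1 + r) * 1]mulr1 lerD2l (mulrC (1 + r)); apply: le_trans H2.
have -> : K * Q * (1 + (D * Gmax) ^+ m) * (1 + r) =
  K * Q * (1 + r) + K * Q * (D * Gmax) ^+ m * (1 + r) by ring.
by rewrite lerD2l.
Qed.

(* The moments of the coordinates at time s, propagated to the final time t by
   the semigroup, grow at most like exp(L G(s)) with
   G(s) = (t^k - (t - s)^k) / k = \int_0^s (t - r)^(k - 1) dr. Since the
   integrand increases, a step from s0 to s contributes at least
   (s - s0) (t - s0)^(k - 1) to G. The summand d G / (n + 1) of q only serves
   to make q positive. *)
Lemma moment_bound (m : nat) (beta gamma l0 Kb : R) :
  0 < l0 -> 0 <= Kb -> gamma < 1 / 2 + beta -> exists Bd : R,
  forall theta n (lam : 'I_n -> R) (b : 'I_n -> U) (chi : R -> Omega -> R)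
    (Y : R -> 'I_n -> Omega -> R),
  varpi T theta -> (forall i, l0 <= lam i) ->
  \sum_i (lam i `^ beta) ^+ 2 * `|b i| ^+ 2 <= Kb ->
  (forall s, 0 <= s -> s <= T -> measurable_fun setT (chi s : Fs s -> R)) ->
  (forall s w, 0 <= s -> s <= T -> 0 <= chi s w <= 1) ->
  (forall s i, 0 <= s -> s <= T -> measurable_fun setT (Y s i)) ->
  (forall i w, Y 0 i w = 0) ->
  (forall s, 0 < s -> s <= T -> let s0 := grid_floor theta s in exists k : R -> R,
    [/\ measurable_fun setT k, forall x, 0 <= k x <= 1 &
    {ae P, forall w, forall i, Y s i w = expR (- (lam i * (s - s0))) *
      (Y s0 i w + chi s0 w * k (\sum_j incr s0 s (b j) w ^+ 2) * incr s0 s (b i) w)}]) ->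
  forall t, 0 <= t -> t <= T ->
  (\int[P]_w ((\sum_i (lam i `^ gamma * Y t i w) ^+ 2) ^+ m.+1)%:E <= Bd%:E)%E.
Proof.
move=> l00 Kb0 gb.
have [k [C [k0 k1 C0 smooth]]] := smoothing_bound l00 gb.
have [K K0 step] := step_moment hilbU Ffilt Wwiener m.
(* [Gmax] bounds G for all t in [0, T]; the 1 in [D] pays for the summands that make q positive. *)
pose Gmax := T `^ k / k; pose D := Kb * C + 1.
pose L := K * D * (1 + (D * Gmax) ^+ m).
exists (expR (L * Gmax)) => theta n lam b chi Y th laml lamb mchi chi01 mY Y0 YS t t0 tT.
have D0 : 0 <= D by rewrite addr_ge0 // mulr_ge0.
pose G s := (t `^ k - (t - s) `^ k) / k.
have Gle s : G s <= Gmax.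
  rewrite ler_pM2r ?invr_gt0 //; apply: (@le_trans _ _ (t `^ k)).
    by rewrite gerBl powR_ge0.
  by apply: ge0_ler_powR; rewrite ?nnegrE ?(ltW k0) ?(ltW T0).
have Gmax0 : 0 <= Gmax by rewrite mulr_ge0 ?powR_ge0 // invr_ge0 ltW.
have L0 : 0 <= L by rewrite !mulr_ge0 // addr_ge0 // exprn_ge0 // mulr_ge0.
(* Y s is measurable but not assumed adapted; the step estimate needs data measurable in F s, so the
   induction carries an adapted version Z of the propagated coordinates along. The summand 1 makes
   the bound multiplicative. *)
pose ok s := s <= t -> exists Z : 'I_n -> Omega -> R,
  [/\ forall i, measurable_fun setT (Z i : Fs s -> R),
      {ae P, forall w, forall i, Z i w = lam i `^ gamma * expR (- (lam i * (t - s))) * Y s i w} &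
      (1 + \int[P]_w ((\sum_i Z i w ^+ 2) ^+ m.+1)%:E <= (expR (L * G s))%:E)%E].
have all_ok : forall s, 0 <= s -> s <= T -> ok s.
  apply: (grid_induction th).
    move=> _; exists (fun _ _ => 0); split.
    - by move=> i; exact: measurable_cst.
    - by apply: aeW => w i; rewrite Y0 mulr0.
    - under eq_integral do rewrite big1 ?expr0n //.
      by rewrite integral0 adde0 /G subr0 subrr mul0r mulr0 expR0.
  move=> s sp sT IH st; set s0 := grid_floor theta s in IH *.
  have [_ s00 s0s] := grid_floor_in th sp; rewrite -/s0 in s00 s0s.
  have s0T : s0 <= T by exact: le_trans (ltW s0s) sT.
  have s0t : s0 < t by exact: lt_le_trans s0s st.
  have [Z0 [mZ0 aeZ0 EZ0]] := IH (ltW s0t).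
  have [kk [mkk kk01 YE]] := YS s sp sT; rewrite -/s0 in YE.
  pose tau := t - s0; have tau0 : 0 < tau by rewrite subr_gt0.
  pose dG := G s - G s0.
  have dGE : dG = (tau `^ k - (t - s) `^ k) / k.
    by rewrite /dG /G -mulrBl; congr (_ / _); rewrite /tau; ring.
  have rho0 : 0 < tau `^ k / tau by rewrite divr_gt0 // powR_gt0.
  have dGge : (s - s0) * (tau `^ k / tau) <= dG.
    have ts0 : 0 <= t - s by rewrite subr_ge0.
    have := powR_increment_ge tau0 ts0 k0 k1; rewrite -dGE.
    by have -> : tau - (t - s) = s - s0 by rewrite /tau; ring.
  have ss0 : 0 < s - s0 by rewrite subr_gt0.
  have dG0 : 0 < dG by apply: lt_le_trans dGge; exact: mulr_gt0.
  have dGM : dG <= Gmax.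
    rewrite dGE ler_pM2r ?invr_gt0 //; apply: (@le_trans _ _ (tau `^ k)).
      by rewrite gerBl powR_ge0.
    apply: ge0_ler_powR; rewrite ?nnegrE ?(ltW k0) ?(ltW T0) ?(ltW tau0) //.
    by rewrite /tau; lra.
  pose c i := lam i `^ gamma * expR (- (lam i * tau)).
  pose q i := c i ^+ 2 * ((s - s0) * `|b i| ^+ 2) + dG / n.+1%:R.
  have q0 i : 0 < q i.
    by rewrite ltr_wpDl ?divr_gt0 // mulr_ge0 ?sqr_ge0 // mulr_ge0 ?sqr_ge0 // ltW.
  have cq i : c i ^+ 2 * ((s - s0) * `|b i| ^+ 2) <= q i.
    by rewrite lerDl divr_ge0 // ltW.
  have QD : \sum_i q i <= D * dG.
    rewrite big_split /= /D [leRHS]mulrDl mul1r; apply: lerD; last first.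
      rewrite sumr_const card_ord -[leLHS]mulr_natr -mulrA ler_piMr ?(ltW dG0) //.
      by rewrite mulrC ler_pdivrMr // mul1r ler_nat.
    apply: (@le_trans _ _ (\sum_i C * ((s - s0) * (tau `^ k / tau)) *
        ((lam i `^ beta) ^+ 2 * `|b i| ^+ 2))).
      apply: ler_sum => i _.
      have H := smooth (lam i) tau (laml i) tau0.
      have w0 : 0 <= (s - s0) * `|b i| ^+ 2 by rewrite mulr_ge0 ?sqr_ge0 // ltW.
      apply: le_trans (ler_wpM2r w0 H) _.
      by rewrite le_eqVlt; apply/orP; left; apply/eqP; ring.
    rewrite -mulr_sumr; apply: (@le_trans _ _ (C * ((s - s0) * (tau `^ k / tau)) * Kb)).
      by apply: ler_wpM2l => //; rewrite mulr_ge0 // mulr_ge0 ?(ltW ss0) ?(ltW rho0).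
    rewrite mulrC mulrA; apply: ler_wpM2l => //; exact: mulr_ge0.
  have Q0 : 0 <= \sum_i q i by apply: sumr_ge0 => i _; exact: ltW.
  pose Z i w := Z0 i w + c i * (chi s0 w * kk (\sum_j incr s0 s (b j) w ^+ 2) *
      incr s0 s (b i) w).
  have mZ0T i : measurable_fun setT (Z0 i).
    exact: (filtration_measurable Ffilt s00 s0T (mZ0 i)).
  exists Z; split.
  - have minc i : measurable_fun setT (incr s0 s (b i) : Fs s -> R).
      exact: (incr_measurable Ffilt Wwiener _ s00 (ltW s0s) sT).
    move=> i; apply: measurable_funD.
      exact: (filtration_measurable_le Ffilt s00 (ltW s0s) sT (mZ0 i)).
    apply: measurable_funM => //; apply: measurable_funM => //; apply: measurable_funM.
      exact: (filtration_measurable_le Ffilt s00 (ltW s0s) sT (mchi s0 s00 s0T)).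
    apply: (measurableT_comp mkk); apply: measurable_sum => j; exact: measurable_funX.
  - apply: filterS2 aeZ0 YE => w E1 E2 i; rewrite /Z E1 E2 /c.
    have -> : expR (- (lam i * tau)) = expR (- (lam i * (t - s))) * expR (- (lam i * (s - s0))).
      by rewrite -expRD; congr expR; rewrite /tau; ring.
    ring.
  - have S := step s0 s n b c q Z0 (chi s0) kk s00 s0s sT q0 cq mZ0 (mchi s0 s00 s0T)
      (fun w => chi01 s0 w s00 s0T) mkk kk01.
    pose a w := \sum_i Z0 i w ^+ 2.
    have a0 w : 0 <= a w by apply: sumr_ge0 => i _; exact: sqr_ge0.
    have ma : measurable_fun setT a by apply: measurable_sum => i; exact: measurable_funX.
    have E0 : (0 <= \int[P]_w (a w ^+ m.+1)%:E)%E.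
      by apply: integral_ge0 => w _; rewrite lee_fin exprn_ge0.
    have [r r0 rE] : exists2 r, 0 <= r & (\int[P]_w (a w ^+ m.+1)%:E = r%:E)%E.
      have fin : (\int[P]_w (a w ^+ m.+1)%:E)%E \is a fin_num.
        rewrite ge0_fin_numE //; apply: (@le_lt_trans _ _ (expR (L * G s0))%:E); last exact: ltry.
        by apply: le_trans EZ0; rewrite leeDr.
      by exists (fine (\int[P]_w (a w ^+ m.+1)%:E)%E); [exact: fine_ge0|rewrite fineK].
    have rX : 1 + r <= expR (L * G s0).
      by move: EZ0; rewrite -/a; under eq_integral do rewrite -/(a _); rewrite rE -EFinD lee_fin.
    (* From x^m <= 1 + x^(m+1) for x >= 0. *)
    have am : (\int[P]_w (a w ^+ m)%:E <= (1 + r)%:E)%E.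
      rewrite EFinD -rE -[1%:E in leRHS](_ : \int[P]_w (cst 1%:E w) = _)%E; last first.
        rewrite integral_cst // mul1e; exact: probability_setT.
      rewrite -ge0_integralD //; last 2 first.
      - by move=> w _; rewrite lee_fin exprn_ge0.
      - by apply/measurable_EFinP; exact: measurable_funX.
      apply: ge0_le_integral => //.
      - by move=> w _; rewrite lee_fin exprn_ge0.
      - by apply/measurable_EFinP; exact: measurable_funX.
      - apply: emeasurable_funD => //; apply/measurable_EFinP; exact: measurable_funX.
      move=> w _; rewrite -EFinD lee_fin; have [a1|/ltW a1] := leP (a w) 1.
        by apply: (@le_trans _ _ 1); [rewrite exprn_ile1|rewrite lerDl exprn_ge0].
      by apply: (@le_trans _ _ (a w ^+ m.+1)); [rewrite exprS ler_peMl // exprn_ge0|rewrite lerDr].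
    apply: (@le_trans _ _ (1 + (r + K * (\sum_i q i) * (1 + r) + K * (\sum_i q i) ^+ m.+1))%:E).
      rewrite [leRHS]EFinD; apply: leeD2l; apply: le_trans S _.
      rewrite -/a !EFinD; apply: leeD2r; apply: leeD; first by rewrite -rE.
      rewrite [leRHS]EFinM; apply: lee_wpmul2l => //; rewrite lee_fin mulr_ge0 //.
    rewrite lee_fin.
    have -> : L * G s = L * G s0 + L * dG by rewrite /dG; ring.
    exact: (gronwall_step m r0 K0 Q0 D0 (ltW dG0) dGM QD rX).
have [Z [mZ aeZ EZ]] := all_ok t t0 tT (lexx t).
have mZT i : measurable_fun setT (Z i) by exact: (filtration_measurable Ffilt t0 tT (mZ i)).
apply: (@le_trans _ _ (\int[P]_w ((\sum_i Z i w ^+ 2) ^+ m.+1)%:E)%E).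
  rewrite le_eqVlt; apply/orP; left; apply/eqP; apply: ge0_ae_eq_integral => //.
  - apply/measurable_EFinP; apply: measurable_funX; apply: measurable_sum => i.
    by apply: measurable_funX; apply: measurable_funM => //; exact: mY.
  - by apply/measurable_EFinP; apply: measurable_funX; apply: measurable_sum => i; exact: measurable_funX.
  - by move=> w _; rewrite lee_fin exprn_ge0 // sumr_ge0 // => i _; exact: sqr_ge0.
  - by move=> w _; rewrite lee_fin exprn_ge0 // sumr_ge0 // => i _; exact: sqr_ge0.
  - apply: filterS aeZ => w E _; congr (_ ^+ _)%:E; apply: eq_bigr => i _.
    by rewrite E subrr mulr0 oppr0 expR0 mulr1.
apply: (@le_trans _ _ (expR (L * G t))%:E).
  by apply: le_trans EZ; rewrite leeDr.
by rewrite lee_fin ler_expR ler_wpM2l.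
Qed.

End moment_bound.

(** * The scheme in coordinates *)

Section orthonormal_family.
Context (R : realType) (H : completeNormedModType R) (dot : {dot H for idfun}).
Hypothesis hilb : induces_norm dot.
Context (n : nat) (h : 'I_n -> H).
Hypothesis oh : forall i j, dot (h i) (h j) = (i == j)%:R.

Lemma orthonormal_family_dot (a : 'I_n -> R) i : dot (h i) (\sum_j a j *: h j) = a i.
Proof.
rewrite dot_sumr (bigD1 i) //= dotZr oh eqxx mulr1 big1 ?addr0 // => j ji.
by rewrite dotZr oh eq_sym (negbTE ji) mulr0.
Qed.

Lemma orthonormal_family_norm (a : 'I_n -> R) :
  `|\sum_j a j *: h j| ^+ 2 = \sum_j a j ^+ 2.
Proof.
rewrite -hilb dot_suml; apply: eq_bigr => i _.
by rewrite dotZl orthonormal_family_dot expr2.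
Qed.

End orthonormal_family.

Section galerkin.
Context (R : realType) (H : completeNormedModType R) (dot : {dot H for idfun}).
Hypothesis hilb : induces_norm dot.
Context (basH : set H).
Hypothesis onH : orthonormal_set dot basH.
Context (A : {fset H}).
Hypothesis AB : [set` A] `<=` basH.

(** An enumeration of A, since the probabilistic estimates are stated for families over ['I_n]. *)
Definition fset_nth (i : 'I_(size A)) : H := tnth (in_tuple A) i.
Notation h := fset_nth.

Lemma fset_nth_mem i : h i \in A.
Proof. exact: mem_tnth. Qed.

Lemma fset_nth_dot i j : dot (h i) (h j) = (i == j)%:R.
Proof.
rewrite onH; try exact: AB (fset_nth_mem _).
congr ((_ : bool)%:R); apply/eqP/eqP => [|->//].
by apply: (elimT (tuple_uniqP (in_tuple A))); exact: fset_uniq.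
Qed.

Lemma big_fset_nth (V : zmodType) (f : H -> V) : \sum_(x <- A) f x = \sum_i f (h i).
Proof. by rewrite big_tnth. Qed.

Lemma proj_fset_nth v : proj dot [set` A] v = \sum_i dot (h i) v *: h i.
Proof. by rewrite (proj_fin _ A) big_fset_nth. Qed.

Lemma range_proj_nth v : range (proj dot [set` A]) v -> v = \sum_i dot (h i) v *: h i.
Proof.
move=> [u _ <-]; rewrite proj_fset_nth; apply: eq_bigr => i _.
by rewrite (orthonormal_family_dot fset_nth_dot).
Qed.

Lemma diag_op_fset_nth (g : H -> R) (a : 'I_(size A) -> R) :
  diag_op dot basH g (\sum_i a i *: h i) = \sum_i (g (h i) * a i) *: h i.
Proof.
set v := \sum_i a i *: h i.
have vE : v = \sum_(x <- A) dot x v *: x.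
  rewrite big_fset_nth; apply: eq_bigr => i _.
  by rewrite (orthonormal_family_dot fset_nth_dot).
rewrite {1}vE (diag_op_fin onH g _ AB (@subset_refl _ basH)) big_fset_nth.
by apply: eq_bigr => i _; rewrite (orthonormal_family_dot fset_nth_dot).
Qed.

End galerkin.

(** For x <= 1 the 1 dominates, otherwise x^p <= x^m <= x^(2m). *)
Lemma powR_le_even_power (R : realType) (p x : R) (m : nat) : 0 <= p -> p <= m%:R -> 0 <= x ->
  x `^ p <= 1 + (x ^+ 2) ^+ m.
Proof.
move=> p0 pm x0; have [x1|/ltW x1] := leP x 1.
  apply: (@le_trans _ _ 1); last by rewrite lerDl exprn_ge0 // sqr_ge0.
  by have := ge0_ler_powR p0 (x0 : x \in Num.nneg) (ler01 : 1 \in Num.nneg) x1; rewrite powR1.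
apply: (@le_trans _ _ (x ^+ m)); first by rewrite -powR_mulrn // ler_powR.
apply: (@le_trans _ _ ((x ^+ 2) ^+ m)); last by rewrite lerDr.
by rewrite -exprM mulnC exprM expr2 ler_peMr ?exprn_ge0 // exprn_ege1.
Qed.

Lemma Lnorm_le_moment (R : realType) (d : measure_display) (Omega : measurableType d)
    (P : probability Omega R) (p Bd : R) (m : nat) (f : Omega -> R) :
  1 <= p -> p <= m%:R -> (forall w, 0 <= f w) ->
  measurable_fun setT (fun w => f w ^+ 2) ->
  (\int[P]_w ((f w ^+ 2) ^+ m)%:E <= Bd%:E)%E ->
  ('N[P]_(p%:E)[(fun w => (f w)%:E)] <= ((1 + Bd) `^ p^-1)%:E)%E.
Proof.
move=> p1 pm f0 mf H; have p0 : 0 <= p by lra.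
have I0 : (0 <= \int[P]_w ((f w ^+ 2) ^+ m)%:E)%E.
  by apply: integral_ge0 => w _; rewrite lee_fin exprn_ge0 // sqr_ge0.
have Bd0 : 0 <= Bd by rewrite -lee_fin; exact: le_trans H.
rewrite unlock -poweR_EFin; apply: gt0_ler_poweR.
- by rewrite invr_ge0.
- by rewrite in_itv /= integral_ge0 // leey.
- by rewrite in_itv /= leey andbT lee_fin addr_ge0.
apply: (@le_trans _ _ (\int[P]_w (1 + (f w ^+ 2) ^+ m)%:E)%E).
  apply: le_lower_integral => w _; first by rewrite lee_fin addr_ge0 // exprn_ge0 // sqr_ge0.
  by rewrite /= lee_fin ger0_norm // powR_le_even_power.
under eq_integral do rewrite EFinD.
rewrite ge0_integralD //; last 2 first.
- by move=> w _; rewrite lee_fin exprn_ge0 // sqr_ge0.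
- by apply/measurable_EFinP; exact: measurable_funX.
rewrite EFinD; apply: leeD => //.
rewrite (integral_cst P measurableT 1%:E) mul1e; exact: probability_le1.
Qed.

Section scheme_coordinates.
Context (R : realType) (U H : completeNormedModType R).
Context (dotU : {dot U for idfun}) (dotH : {dot H for idfun}).
Hypotheses (hilbU : induces_norm dotU) (hilbH : induces_norm dotH).
Context (d : measure_display) (Omega : measurableType d) (P : probability Omega R).
Context (T : R) (F : R -> set (set Omega)).
Hypothesis Ffilt : filtration T F.
Context (W : R -> U -> Omega -> R).
Hypothesis Wwiener : cylindrical_wiener P T F dotU W.
Context (basU : set U) (basH : set H) (ev : H -> R).
Hypothesis onbU : orthonormal_basis dotU basU.
Hypothesis onbH : orthonormal_basis dotH basH.
Context (A : {fset H}) (PBP : U -> H) (b : 'I_(size A) -> U).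
Hypothesis AB : [set` A] `<=` basH.
Notation h := (@fset_nth R H A).
Hypothesis PBPE : forall y, PBP y = \sum_i dotU (b i) y *: h i.

Notation Fs s := (g_sigma_algebraType (F s)).
Let onH : orthonormal_set dotH basH. Proof. by case: onbH. Qed.
Let oh := fset_nth_dot onH AB.

Lemma semigroup_nth (r : R) (a : 'I_(size A) -> R) :
  semigroup dotH basH ev r (\sum_i a i *: h i) =
  \sum_i (expR (r * ev (h i)) * a i) *: h i.
Proof. exact: (diag_op_fset_nth onH AB). Qed.

(* The stochastic integrals are determined almost surely by ito_unique as soon
   as they exist; by the convention for ito_integral the numerator is 0 (k = 0)
   or the denominator is 1 (k = 1) otherwise. *)
Lemma scheme_step (s0 s : R) (chi : Omega -> R) :
  0 <= s0 -> s0 < s -> s <= T ->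
  measurable_fun setT (chi : Fs s0 -> R) -> (forall w, 0 <= chi w <= 1) ->
  let S := semigroup dotH basH ev (s - s0) in
  let num := ito_integral P F dotU dotH basU W s0 s (fun _ w y => chi w *: S (PBP y)) in
  let den := ito_integral P F dotU dotH basU W s0 s (fun _ _ y => PBP y) in
  exists k : R -> R, [/\ measurable_fun setT k, forall x, 0 <= k x <= 1 &
    {ae P, forall w, forall Z : 'I_(size A) -> R,
      S (\sum_i Z i *: h i) + (1 + `|den w| ^+ 2)^-1 *: num w =
      \sum_i (expR ((s - s0) * ev (h i)) *
        (Z i + chi w * k (\sum_j incr W s0 s (b j) w ^+ 2) * incr W s0 s (b i) w)) *: h i}].
Proof.
move=> s00 s0s sT mchi chi01 S num den.
pose dt i : rand_term U H Omega := RandTerm s0 s (cst 1) (b i) (h i).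
pose nt i : rand_term U H Omega := RandTerm s0 s chi (b i) (expR ((s - s0) * ev (h i)) *: h i).
have dadm i : rand_admissible F s0 s (dt i).
  split => //=; [exact: ltW|by move=> w; rewrite ler01 lexx].
have nadm i : rand_admissible F s0 s (nt i) by split => //=; exact: ltW.
have in1 r : r \in `]s0, s] -> \1_`]s0, s] r = 1 :> R.
  by move=> rs; rewrite indicE mem_set.
have denP : (exists X, is_ito_integral P F dotU dotH basU W s0 s (fun _ _ y => PBP y) X) ->
    {ae P, forall w, `|den w| ^+ 2 = \sum_j incr W s0 s (b j) w ^+ 2}.
  move=> ex.
  have D : is_ito_integral P F dotU dotH basU W s0 s (fun _ _ y => PBP y) den.
    exact: (xgetPex (cst 0) ex).
  have := ito_unique hilbU hilbH Ffilt Wwiener onbU s00 sT D dadm.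
  have YE r w y : r \in `]s0, s] -> PBP y = rand_integrand dotU dt r w y.
    move=> rs; rewrite PBPE; apply: eq_bigr => i _ /=.
    by rewrite in1 // !mul1r.
  move=> /(_ YE); apply: filterS => w ->; rewrite /rand_integral /=.
  rewrite (orthonormal_family_norm hilbH oh); apply: eq_bigr => i _.
  by rewrite mul1r.
have numP : (exists X, is_ito_integral P F dotU dotH basU W s0 s
      (fun _ w y => chi w *: S (PBP y)) X) ->
    {ae P, forall w, num w = \sum_i (expR ((s - s0) * ev (h i)) *
       (chi w * incr W s0 s (b i) w)) *: h i}.
  move=> ex.
  have D : is_ito_integral P F dotU dotH basU W s0 s (fun _ w y => chi w *: S (PBP y)) num.
    exact: (xgetPex (cst 0) ex).
  have := ito_unique hilbU hilbH Ffilt Wwiener onbU s00 sT D nadm.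
  have YE r w y : r \in `]s0, s] -> chi w *: S (PBP y) = rand_integrand dotU nt r w y.
    move=> rs; rewrite PBPE /S semigroup_nth scaler_sumr; apply: eq_bigr => i _ /=.
    by rewrite in1 // mul1r !scalerA; congr (_ *: _); ring.
  move=> /(_ YE); apply: filterS => w ->; apply: eq_bigr => i _ /=.
  by rewrite scalerA mulrC.
have [nex|nex] := pselect (exists X, is_ito_integral P F dotU dotH basU W s0 s
    (fun _ w y => chi w *: S (PBP y)) X); last first.
  exists (cst 0).
  split; [exact: measurable_cst|by move=> x; rewrite lexx ler01|].
  apply: aeW => w Z; rewrite /S semigroup_nth.
  have -> : num w = 0.
    suff -> : num = cst 0 by [].
    by apply: xgetPN => X HX; apply: nex; exists X.
  rewrite scaler0 addr0; apply: eq_bigr => i _.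
  by rewrite mulr0 mul0r addr0.
have [dex|dex] := pselect (exists X,
    is_ito_integral P F dotU dotH basU W s0 s (fun _ _ y => PBP y) X).
  (* The absolute value keeps k continuous and in [0, 1] on all of R; it is evaluated at sums of
     squares only. *)
  exists (fun x => (1 + `|x|)^-1); split.
  - apply: continuous_measurable_fun => x; apply: cvgV.
      by rewrite gt_eqF // ltr_pwDl.
    by apply: cvgD; [exact: cvg_cst|apply: cvg_norm; exact: cvg_id].
  - move=> x; have x0 := normr_ge0 x.
    by rewrite invr_ge0 addr_ge0 //= invf_le1 ?lerDl // ltr_pwDl.
  - apply: filterS2 (denP dex) (numP nex) => w -> -> Z.
    rewrite /S semigroup_nth scaler_sumr -big_split /=; apply: eq_bigr => i _.
    rewrite scalerA -scalerDl; congr (_ *: _).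
    rewrite ger0_norm ?sumr_ge0 // => [|j _]; last exact: sqr_ge0.
    ring.
exists (cst 1); split; [exact: measurable_cst|by move=> x; rewrite lexx ler01|].
have := numP nex; apply: filterS => w -> Z.
have -> : den w = 0.
  suff -> : den = cst 0 by [].
  by apply: xgetPN => X HX; apply: dex; exists X.
rewrite normr0 expr0n /= addr0 invr1 scale1r /S semigroup_nth -big_split /=.
apply: eq_bigr => i _; rewrite -scalerDl; congr (_ *: _).
by rewrite -mulrDr /= (mulr1 (chi w)).
Qed.

End scheme_coordinates.

Theorem corollary3p1 (R : realType) (H U : completeNormedModType R)
  (dotH : {dot H for idfun}) (dotU : {dot U for idfun})
  (hilbH : induces_norm dotH) (hilbU : induces_norm dotU)
  (sepH : separable H) (sepU : separable U)
  (basH : set H) (basH_neq0 : basH !=set0) (basH_onb : orthonormal_basis dotH basH)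
  (ev : H -> R) (ev_lt0 : (ereal_sup [set (ev h)%:E | h in basH] < 0)%E)
  (beta T : R) (beta_ge0 : 0 <= beta) (T_gt0 : 0 < T)
  (d : measure_display) (Omega : measurableType d) (P : probability Omega R)
  (F : R -> set (set Omega)) (Ffilt : filtration T F)
  (Fusual : usual_conditions P T F)
  (W : R -> U -> Omega -> R) (Wwiener : cylindrical_wiener P T F dotU W)
  (basU : set U) (basU_onb : orthonormal_basis dotU basU)
  (B : U -> H)
  (BHS : hilbert_schmidt basU (interp_space dotH basH ev beta)
           (interp_norm dotH basH ev beta) B)
  (chi : set R -> set H -> set U -> R -> Omega -> R)
  (chi_itv : forall theta I J, varpi T theta -> finite_subsets basH I -> J `<=` basU ->
     forall (t : R) w, t \in `[0, T] -> 0 <= chi theta I J t w <= 1)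
  (chi_adapted : forall theta I J, varpi T theta -> finite_subsets basH I -> J `<=` basU ->
     adapted T F (chi theta I J))
  (O : set R -> set H -> set U -> R -> Omega -> H)
  (O_range : forall theta I J, varpi T theta -> finite_subsets basH I -> J `<=` basU ->
     forall (t : R) w, t \in `[0, T] -> range (proj dotH I) (O theta I J t w))
  (O_meas : forall theta I J, varpi T theta -> finite_subsets basH I -> J `<=` basU ->
     forall t : R, t \in `[0, T] -> borel_measurable measurable (O theta I J t))
  (O_zero : forall theta I J, varpi T theta -> finite_subsets basH I -> J `<=` basU ->
     forall w, O theta I J 0 w = 0)
  (O_eq : forall theta I J, varpi T theta -> finite_subsets basH I -> J `<=` basU ->
     forall t : R, t \in `[0, T] ->
     let t0 := grid_floor theta t in
     let S := semigroup dotH basH ev (t - t0) in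
     let PBP := fun y : U => proj dotH I (B (proj dotU J y)) in
     let num := ito_integral P F dotU dotH basU W t0 t
                  (fun _ w y => chi theta I J t0 w *: S (PBP y)) in
     let den := ito_integral P F dotU dotH basU W t0 t (fun _ _ y => PBP y) in
     {ae P, forall w, O theta I J t w =
        S (O theta I J t0 w) + (1 + `|den w| ^+ 2)^-1 *: num w})
  (p gamma : R) (p_ge1 : 1 <= p) (gamma_ge0 : 0 <= gamma)
  (gamma_lt : gamma < 1 / 2 + beta) :
  (ereal_sup [set ereal_sup [set ereal_sup [set ereal_sup
     [set 'N[P]_(p%:E)[(fun w => (interp_norm dotH basH ev gamma (O theta I J t w))%:E)]
      | t in `[0%R, T]]
      | I in finite_subsets basH]
      | J in [set J : set U | J `<=` basU]]
      | theta in varpi T] < +oo)%E.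

(* The spectral gap is minus the supremum, which is a real number because [basH] is non-empty. *)
have [l0 l00 evl0] : exists2 l0 : R, 0 < l0 & forall h, basH h -> l0 <= - ev h.
  have ub h : basH h -> ((ev h)%:E <= ereal_sup [set (ev h)%:E | h in basH])%E.
    by move=> hH; apply: ereal_sup_ubound; exists h.
  case: (ereal_sup _) ev_lt0 ub => [r r0 ub|//|_ ub].
    exists (- r) => [|h /ub]; first by rewrite oppr_gt0 -lte_fin.
    by rewrite lee_fin lerN2.
  by case: basH_neq0 => h /ub; rewrite leeNy_eq.
have ev0 h : basH h -> ev h < 0.
  by move=> /evl0 H0; rewrite -oppr_gt0; exact: lt_le_trans H0.
have onH : orthonormal_set dotH basH by case: basH_onb.
have [Kb [Kb0 KbP]] := hs_coordinates hilbU hilbH basU_onb basH_onb ev0 BHS.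
have p0 : 0 <= p by apply: le_trans p_ge1.
pose m := Num.bound p.
have pm : p <= m.+1%:R.
  by apply: ltW; apply: lt_le_trans (archi_boundP p0) _; rewrite ler_nat.
(* [Bd] is fixed before theta, J, I and t, which gives the uniformity of the final bound. *)
have [Bd BdP] := moment_bound hilbU T_gt0 Ffilt Wwiener m l00 Kb0 gamma_lt.
apply: (@le_lt_trans _ _ ((1 + Bd) `^ p^-1)%:E); last exact: ltry.
apply: ge_ereal_sup => _ [theta th <-].
apply: ge_ereal_sup => _ [J JU <-].
apply: ge_ereal_sup => _ [I IH <-].
apply: ge_ereal_sup => _ [t t_itv <-].
have /andP[t0 tT] : 0 <= t <= T by move: t_itv; rewrite /= in_itv.
have [Ifin IB] := IH; pose A := fset_set I.
have AI : [set` A] = I by exact: fset_setK.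
have AB : [set` A] `<=` basH by rewrite AI.
have oh := fset_nth_dot onH AB.
have [b [bP bK]] := KbP J JU.
pose Oc := O theta I J.
(* As O takes values in the range of P_I, these finitely many coordinates determine it. *)
pose Y s (i : 'I_(size A)) w := dotH (fset_nth i) (Oc s w).
pose lam (i : 'I_(size A)) := - ev (fset_nth i).
have hH (i : 'I_(size A)) : basH (fset_nth i) by apply: AB; exact: fset_nth_mem.
have itv s : 0 <= s -> s <= T -> s \in `[0, T] by move=> s0 sT; rewrite in_itv /= s0.
have OE s w : 0 <= s -> s <= T -> Oc s w = \sum_i Y s i w *: fset_nth i.
  move=> s0 sT; apply: (range_proj_nth onH AB); rewrite AI.
  by apply: O_range => //; exact: itv.
have mO s : 0 <= s -> s <= T -> borel_measurable measurable (Oc s).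
  by move=> s0 sT; apply: O_meas => //; exact: itv.
have mY s i : 0 <= s -> s <= T -> measurable_fun setT (Y s i).
  move=> s0 sT.
  exact: (borel_measurable_comp (mO s s0 sT) (@dot_continuous _ _ _ hilbH (fset_nth i))).
have PBPE y : proj dotH I (B (proj dotU J y)) =
    \sum_(i < size A) dotU (b (fset_nth i)) y *: fset_nth i.
  rewrite -AI proj_fset_nth; apply: eq_bigr => i _.
  by rewrite bP.
have normE w : interp_norm dotH basH ev gamma (Oc t w) ^+ 2 =
    \sum_i (lam i `^ gamma * Y t i w) ^+ 2.
  rewrite OE // /interp_norm /fcalc (diag_op_fset_nth onH AB).
  exact: (orthonormal_family_norm hilbH oh).
apply: (@Lnorm_le_moment _ _ _ P p Bd m.+1 (fun w => interp_norm dotH basH ev gamma (Oc t w))) => //.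
- by move=> w; rewrite /interp_norm normr_ge0.
- apply: (eq_measurable_fun (fun w => \sum_i (lam i `^ gamma * Y t i w) ^+ 2)).
    by move=> w _; rewrite -normE.
  apply: measurable_sum => i; apply: measurable_funX; apply: measurable_funM => //.
  exact: mY.
under eq_integral do rewrite normE.
apply: (BdP theta (size A) lam (fun i => b (fset_nth i)) (chi theta I J) Y) => //.
- by move=> i; exact: evl0.
- by have := bK A AB; rewrite big_fset_nth.
- move=> s s0 sT _ C mC; rewrite (filtration_measurableE Ffilt) // setTI.
  by apply: chi_adapted => //; exact: itv.
- by move=> s w s0 sT; apply: chi_itv => //; exact: itv.
- by move=> i w; rewrite /Y /Oc O_zero // dotC dot0l.
move=> s s0 sT s1; have [_ s10 s1s] := grid_floor_in th s0.
have s1T : s1 <= T by exact: le_trans (ltW s1s) sT.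
have mchi : measurable_fun setT (chi theta I J s1 : g_sigma_algebraType (F s1) -> R).
  move=> _ C mC; rewrite (filtration_measurableE Ffilt) // setTI.
  by apply: chi_adapted => //; exact: itv.
have chi01 w : 0 <= chi theta I J s1 w <= 1 by apply: chi_itv => //; exact: itv.
have [k [mk k01 kE]] := scheme_step hilbU hilbH Ffilt Wwiener ev basU_onb basH_onb AB PBPE
  s10 s1s sT mchi chi01.
exists k; split => //.
have := O_eq theta I J th IH JU s (itv s (ltW s0) sT).
apply: filterS2 kE => w E1 E2 i.
rewrite {1}/Y /Oc E2 -/s1 -/(Oc s1 w) (OE s1) // E1.
rewrite (orthonormal_family_dot oh); congr (expR _ * _).
by rewrite /lam mulNr opprK mulrC.
Qed.
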